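(* Let $\Omega\subset\mathbb R^n$ be a nonempty open set, let $X(\Omega)$ be a Banach function space, and let $V$ be a Banach space. Then $V$ has the Radon-Nikodým property if and only if $R^1X(\Omega;V)=W^1X(\Omega;V)$ (equality as sets of functions, modulo equality a.e.).
   Context: Banach spaces are real; $|A|$ is Lebesgue measure. $M(\Omega)$ is the set of real-valued measurable functions on $\Omega$ (identified when equal a.e.). A Banach space $X(\Omega)\subset M(\Omega)$ with norm $\|\cdot\|_X$ (put $\|f\|_X=\infty$ if $f\notin X(\Omega)$) is a Banach function space if: (P1) $|f|\le g$, $f\in M(\Omega)$, $g\in X(\Omega)$ imply $f\in X(\Omega)$ and $\|f\|_X\le\|g\|_X$; (P2) $0\le f_n\nearrow f$ a.e. implies $\|f_n\|_X\nearrow\|f\|_X$; (P3) $\chi_A\in X(\Omega)$ for every measurable $A\subset\Omega$ with $|A|<\infty$; (P4) for every measurable $A\subset\Omega$ with $|A|<\infty$ there is $C_A>0$ with $\int_A|f|\,dx\le C_A\|f\chi_A\|_X$ for all $f\in X(\Omega)$. $X(\Omega;V)$ is the space of strongly measurable $u:\Omega\to V$ with $\|u(\cdot)\|_V\in X(\Omega)$, with norm $\|u\|_{X(\Omega;V)}=\big\|\|u(\cdot)\|_V\big\|_X$. A function $w\in L^1_{loc}(\Omega;V)$ is the weak partial derivative $\partial_j u$ of $u\in L^1_{loc}(\Omega;V)$ if $\int_\Omega \frac{\partial\varphi}{\partial x_j}u\,dx=-\int_\Omega\varphi w\,dx$ (Bochner integrals) for all $\varphi\in C_0^\infty(\Omega)$.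 $W^1X(\Omega;V)$ is the space of $u\in X(\Omega;V)$ whose weak partial derivatives $\partial_1u,\dots,\partial_nu$ exist and belong to $X(\Omega;V)$; $W^1X(\Omega)=W^1X(\Omega;\mathbb R)$; $|\nabla u|=\big(\sum_{j=1}^n\|\partial_ju\|_V^2\big)^{1/2}$. $R^1X(\Omega;V)$ (Reshetnyak--Sobolev space) is the class of $u\in X(\Omega;V)$ such that: (A) $\langle v^*,u\rangle\in W^1X(\Omega)$ for every $v^*\in V^*$ with $\|v^*\|\le1$; (B) there is a non-negative $g\in X(\Omega)$ such that for every $v^*\in V^*$ with $\|v^*\|\le 1$, $|\nabla\langle v^*,u\rangle|\le g$ a.e. on $\Omega$. $V$ has the Radon-Nikodým property if for every $\sigma$-finite complete measure space $(S,\Sigma,\mu)$ and every $V$-valued measure $\nu$ on $\Sigma$ of bounded variation that is absolutely continuous with respect to $\mu$ there is $f\in L^1(S;V)$ with $\nu(A)=\int_Af\,d\mu$ for all $A\in\Sigma$. Equivalently, every locally Lipschitz function $\mathbb R\to V$ is differentiable a.e. *)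

(* Defs.v *)
From HB Require Import structures.
From mathcomp Require Import all_boot all_order all_algebra.
From mathcomp Require Import all_classical all_reals all_analysis.
Import Order.TTheory GRing.Theory Num.Theory.
Import numFieldNormedType.Exports.

Set Implicit Arguments.
Unset Strict Implicit.
Unset Printing Implicit Defensive.

Local Open Scope classical_set_scope.
Local Open Scope ring_scope.

(* R^d is represented by 'rV[R]_n.+1, i.e. d = n + 1 >= 1. *)

Section lebesgue_measure_Rn.
Context {R : realType} {n : nat}.
Local Notation E := 'rV[R]_n.+1.
Implicit Types (p : E * E) (A : set E).

Definition box p : set E :=
  [set x | forall i, p.1 ord0 i < x ord0 i <= p.2 ord0 i].

(* The maximum makes this 0 on empty boxes. *)
Definition box_volume p : R :=
  \prod_(i < n.+1) Num.max 0 (p.2 ord0 i - p.1 ord0 i).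

Definition lebesgue_outer A : \bar R :=
  ereal_inf [set (\sum_(0 <= k <oo) (box_volume (B k))%:E)%E |
    B in [set B : nat -> E * E | A `<=` \bigcup_k box (B k)]].

Local Open Scope ereal_scope.

Lemma box_volume_ge0 p : (0 <= box_volume p)%R.
Proof. by apply: prodr_ge0 => i _; rewrite le_max lexx. Qed.

Lemma lebesgue_outer_ge0 A : 0 <= lebesgue_outer A.
Proof.
apply: le_ereal_inf_tmp => _ [B AB <-]; apply: nneseries_ge0 => k _ _.
by rewrite lee_fin box_volume_ge0.
Qed.

Lemma lebesgue_outer0 : lebesgue_outer set0 = 0.
Proof.
apply/eqP; rewrite eq_le lebesgue_outer_ge0 andbT.
apply: ereal_inf_lbound; exists (fun=> (0%R, 0%R)) => //=.
apply: eseries0 => k _ _; rewrite /box_volume big_ord_recl /=.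
by rewrite subrr maxxx mul0r.
Qed.

Lemma le_lebesgue_outer : {homo lebesgue_outer : A B / A `<=` B >-> A <= B}.
Proof.
move=> A B AB; apply: ereal_inf_le_tmp => _ [C BC <-].
by exists C => //=; exact: subset_trans BC.
Qed.

Lemma lebesgue_outer_sigma_subadditive : sigma_subadditive lebesgue_outer.
Proof.
move=> A; have [[i ioo]|] := pselect (exists i, lebesgue_outer (A i) = +oo).
  rewrite (eseries_pinfty _ _ ioo) ?leey// => k _.
  by rewrite -ltNye (lt_le_trans _ (lebesgue_outer_ge0 _)).
rewrite -forallNE => Aoo.
suff add2e (e : {posnum R}) :
    lebesgue_outer (\bigcup_k A k) <=
      \sum_(i <oo) lebesgue_outer (A i) + e%:num%:E.
  by apply/lee_addgt0Pr => _/posnumP[].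
rewrite (le_trans _ (epsilon_trick _ _ _))//; last first.
  by move=> k; exact: lebesgue_outer_ge0.
pose P k (B : nat -> E * E) := A k `<=` \bigcup_i box (B i) /\
  \sum_(i <oo) (box_volume (B i))%:E <=
    lebesgue_outer (A k) + (e%:num / (2 ^ k.+1)%:R)%:E.
have [G PG] : {G : nat -> nat -> E * E & forall k, P k (G k)}.
  apply: (@choice _ _ P) => k; rewrite /P.
  have fA : lebesgue_outer (A k) \is a fin_num.
    by rewrite ge0_fin_numE ?lebesgue_outer_ge0// ltey; apply/eqP/Aoo.
  have e0 : (0 < e%:num / (2 ^ k.+1)%:R)%R by [].
  have [_ [B AB <-] Be] := lb_ereal_inf_adherent e0 fA.
  by exists B; split => //; exact: ltW.
pose v (ij : nat * nat) : \bar R := (box_volume (G ij.1 ij.2))%:E.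
have v0 ij : 0 <= v ij by rewrite lee_fin box_volume_ge0.
apply: (@le_trans _ _ (\esum_(i in setT) v i)).
  apply: ereal_inf_lbound => /=.
  have /card_esym/ppcard_eqP[f] := card_nat2.
  exists (fun k => G (f k).1 (f k).2).
    move=> t [i _ /(PG i).1 [j _ Gt]].
    by exists (f^-1%FUN (i, j)) => //=; rewrite invK ?inE.
  rewrite nneseries_esumT; last by move=> k; exact: (v0 (f k)).
  by rewrite (@reindex_esum _ _ _ setT setT f v).
have -> : \esum_(i in setT) v i = \esum_(i in setT) \esum_(j in setT) v (i, j).
  rewrite esum_esum; last by move=> i j _ _; exact: v0.
  congr (esum _ _); first by apply/seteqP; split.
rewrite -nneseries_esumT; last by move=> i; exact: esum_ge0.
apply: lee_nneseries => [i _ _|i _]; first exact: esum_ge0.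
by rewrite -nneseries_esumT//; exact: (PG i).2.
Qed.

HB.instance Definition _ := isOuterMeasure.Build R E lebesgue_outer
  lebesgue_outer0 lebesgue_outer_ge0 le_lebesgue_outer
  lebesgue_outer_sigma_subadditive.

End lebesgue_measure_Rn.

(* The Caratheodory measurable sets of the outer measure above are the Lebesgue
   measurable sets; the resulting measure is complete. *)
Definition lebesgue_space (R : realType) (n : nat) :=
  caratheodory_type (@lebesgue_outer R n : {outer_measure set _ -> \bar R}).

HB.instance Definition _ R n := Measurable.on (lebesgue_space R n).

Definition lebesgue_Rn (R : realType) (n : nat) (A : set (lebesgue_space R n)) :=
  (@lebesgue_outer R n : {outer_measure set _ -> \bar R}) A.
HB.instance Definition _ R n := Measure.copy (@lebesgue_Rn R n)
  ((@lebesgue_outer R n : {outer_measure set _ -> \bar R})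
     : set (caratheodory_type _) -> _).

Section bochner.
Context d (S : measurableType d) (R : realType) (V : normedModType R).
Variable mu : {measure set S -> \bar R}.
Implicit Types (s u : S -> V) (D : set S).

Definition simple_function s :=
  finite_set (range s) /\ forall v, measurable (s @^-1` [set v]).

Definition integrable_simple_function D s :=
  simple_function s /\
  forall v, v != 0 -> (mu (D `&` s @^-1` [set v]) < +oo)%E.

(* The value v = 0, whose level set may have infinite measure, contributes 0. *)
Definition simple_integral D s : V :=
  \sum_(v \in range s) fine (mu (D `&` s @^-1` [set v])) *: v.

Definition strongly_measurable D u :=
  exists s_ : nat -> S -> V, (forall k, simple_function (s_ k)) /\
    {ae mu, forall x, D x -> s_ ^~ x @ \oo --> u x}.

Definition bochner_L1 D u :=
  strongly_measurable D u /\ (\int[mu]_(x in D) `|u x|%:E < +oo)%E.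

(* A relation rather than a function: it asserts both that u is Bochner
   integrable over D and that its integral is v. *)
Definition is_bochner_integral D u (v : V) :=
  strongly_measurable D u /\
  exists s_ : nat -> S -> V,
    [/\ forall k, integrable_simple_function D (s_ k),
        (\int[mu]_(x in D) `|u x - s_ k x|%:E)%E @[k --> \oo] --> 0%E &
        simple_integral D (s_ k) @[k --> \oo] --> v].

End bochner.

Section vector_measure.
Context d (S : measurableType d) (R : realType) (V : normedModType R).
Implicit Type nu : set S -> V.

Definition vector_measure nu :=
  forall F : nat -> set S, (forall i, measurable (F i)) -> trivIset setT F ->
    \sum_(i < k) nu (F i) @[k --> \oo] --> nu (\bigcup_i F i).

Definition variation nu : \bar R :=
  ereal_sup [set y | exists k (F : 'I_k -> set S),
    [/\ forall i, measurable (F i), trivIset setT F, \bigcup_i F i = setT &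
        y = (\sum_(i < k) `|nu (F i)|)%:E]].

Definition abs_continuous nu (mu : {measure set S -> \bar R}) :=
  forall A, measurable A -> mu A = 0%E -> nu A = 0.

End vector_measure.

Definition radon_nikodym_property (R : realType) (V : completeNormedModType R) :=
  forall d (S : measurableType d) (mu : {measure set S -> \bar R})
    (nu : set S -> V),
    sigma_finite setT mu -> measure_is_complete mu ->
    vector_measure nu -> (variation nu < +oo)%E -> abs_continuous nu mu ->
    exists f : S -> V, bochner_L1 mu setT f /\
      forall A, measurable A -> is_bochner_integral mu A f (nu A).

(* Functions on Omega are represented by functions on R^d of which only the
   restriction to Omega, up to a.e. equality, is ever used. *)

Definition Mfun (R : realType) (n : nat) (Omega : set 'rV[R]_n.+1) :
    set ('rV[R]_n.+1 -> R) :=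
  [set f | measurable_fun (Omega : set (lebesgue_space R n))
                          (f : lebesgue_space R n -> R)].

(* The norm takes values in [0, +oo]; X(Omega) is the set bfs_mem below of the
   measurable functions of finite norm, so that ||f||_X = +oo off X(Omega). *)
Record banach_function_space (R : realType) (n : nat)
    (Omega : set 'rV[R]_n.+1) := BanachFunctionSpace {
  bfs_norm : ('rV[R]_n.+1 -> R) -> \bar R ;
  bfs_mem := [set f | Mfun Omega f /\ (bfs_norm f < +oo)%E] ;
  bfs_norm_ae : forall f g, Mfun Omega f -> Mfun Omega g ->
    {ae @lebesgue_Rn R n, forall x, Omega x -> f x = g x} ->
    bfs_norm f = bfs_norm g ;
  bfs_norm_ge0 : forall f, Mfun Omega f -> (0 <= bfs_norm f)%E ;
  bfs_norm_eq0 : forall f, Mfun Omega f ->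
    (bfs_norm f = 0%E <->
     {ae @lebesgue_Rn R n, forall x, Omega x -> f x = 0}) ;
  bfs_normZ : forall (c : R) f, bfs_mem f ->
    bfs_norm (fun x => c * f x) = (`|c|%:E * bfs_norm f)%E ;
  bfs_normD : forall f g, bfs_mem f -> bfs_mem g ->
    (bfs_norm (fun x => f x + g x)%R <= bfs_norm f + bfs_norm g)%E ;
  bfs_complete : forall f_ : nat -> 'rV[R]_n.+1 -> R,
    (forall k, bfs_mem (f_ k)) ->
    (forall e : R, 0 < e -> exists K, forall k l, (K <= k)%N -> (K <= l)%N ->
      (bfs_norm (fun x => f_ k x - f_ l x)%R < e%:E)%E) ->
    exists2 f, bfs_mem f &
      bfs_norm (fun x => f_ k x - f x) @[k --> \oo] --> 0%E ;
  bfs_ideal : forall f g, Mfun Omega f -> bfs_mem g ->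
    {ae @lebesgue_Rn R n, forall x, Omega x -> `|f x| <= g x} ->
    bfs_mem f /\ (bfs_norm f <= bfs_norm g)%E ;
  bfs_fatou : forall (f_ : nat -> 'rV[R]_n.+1 -> R) f,
    (forall k, Mfun Omega (f_ k)) -> Mfun Omega f ->
    {ae @lebesgue_Rn R n, forall x, Omega x ->
      [/\ forall k, 0 <= f_ k x, nondecreasing_seq (f_ ^~ x) &
          f_ ^~ x @ \oo --> f x]} ->
    nondecreasing_seq (bfs_norm \o f_) /\
    bfs_norm (f_ k) @[k --> \oo] --> bfs_norm f ;
  bfs_indic : forall A : set (lebesgue_space R n), measurable A ->
    A `<=` Omega -> (lebesgue_Rn A < +oo)%E -> bfs_mem \1_A ;
  bfs_L1 : forall A : set (lebesgue_space R n), measurable A ->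
    A `<=` Omega -> (lebesgue_Rn A < +oo)%E ->
    exists2 C : R, 0 < C & forall f, bfs_mem f ->
      (\int[@lebesgue_Rn R n]_(x in A) `|f x|%:E <=
       C%:E * bfs_norm (fun x => (f x * \1_A x)%R))%E }.

Section test_functions.
Context {R : realType} {n : nat}.
Local Notation E := 'rV[R]_n.+1.
Implicit Types (phi : E -> R) (Omega : set E).

Definition partial (j : 'I_n.+1) phi (x : E) : R :=
  'D_(delta_mx ord0 j) phi x.

Definition smooth phi := forall s : seq 'I_n.+1,
  continuous (foldr partial phi s) /\
  forall x j, derivable (foldr partial phi s) x (delta_mx ord0 j).

Definition test_function Omega phi :=
  let K := closure [set x | phi x != 0] in
  [/\ smooth phi, compact K & K `<=` Omega].

End test_functions.

Section sobolev_spaces.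
Context {R : realType} {n : nat} {Omega : set 'rV[R]_n.+1}.
Variable X : banach_function_space Omega.
Local Notation E := 'rV[R]_n.+1.
Local Notation mu := (@lebesgue_Rn R n).

Definition L1_loc {V : normedModType R} (u : E -> V) :=
  strongly_measurable mu Omega u /\
  forall K : set E, compact K -> K `<=` Omega ->
    (\int[mu]_(x in K) `|u x|%:E < +oo)%E.

Definition weak_partial {V : normedModType R} (j : 'I_n.+1) (u w : E -> V) :=
  [/\ L1_loc u, L1_loc w &
      forall phi, test_function Omega phi -> exists2 v : V,
        is_bochner_integral mu Omega (fun x => partial j phi x *: u x) v &
        is_bochner_integral mu Omega (fun x => phi x *: w x) (- v)].

Definition bochner_bfs (V : normedModType R) : set (E -> V) :=
  [set u | strongly_measurable mu Omega u /\ bfs_mem X (fun x => `|u x|)].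

Arguments bochner_bfs V : clear implicits.

Definition sobolev (V : normedModType R) : set (E -> V) :=
  [set u | bochner_bfs V u /\
    forall j, exists2 w, weak_partial j u w & bochner_bfs V w].

Arguments sobolev V : clear implicits.

Definition grad_norm {V : normedModType R} (w : 'I_n.+1 -> E -> V) (x : E) : R :=
  Num.sqrt (\sum_(j < n.+1) `|w j x| ^+ 2).

Definition dual_norm {V : normedModType R} (f : {linear V -> R^o}) : \bar R :=
  ereal_sup [set `|f v|%:E | v in [set v : V | `|v| <= 1]].

(* The existential over w is harmless: the weak gradient of <f, u> is unique up
   to a.e. equality. *)
Definition reshetnyak_sobolev (V : normedModType R) : set (E -> V) :=
  [set u | [/\ bochner_bfs V u,
    forall f : {linear V -> R^o}, continuous f -> (dual_norm f <= 1)%E ->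
      sobolev R^o (f \o u) &
    exists g : E -> R, [/\ bfs_mem X g,
      {ae mu, forall x, Omega x -> 0 <= g x} &
      forall f : {linear V -> R^o}, continuous f -> (dual_norm f <= 1)%E ->
        exists2 w : 'I_n.+1 -> E -> R^o,
          forall j, weak_partial j (f \o u) (w j) &
          {ae mu, forall x, Omega x -> grad_norm w x <= g x}]]].

End sobolev_spaces.

Arguments L1_loc {R n} Omega {V} u.
Arguments weak_partial {R n} Omega {V} j u w.
Arguments bochner_bfs {R n Omega} X V.
Arguments sobolev {R n Omega} X V.
Arguments reshetnyak_sobolev {R n Omega} X V.

(* Main.v *)
Require Import Defs.
From HB Require Import structures.
From mathcomp Require Import all_boot all_order all_algebra.
From mathcomp Require Import all_classical all_reals all_analysis.
From mathcomp Require Import measurable_realfun ring lra.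
Import Order.TTheory GRing.Theory Num.Theory.
Import numFieldNormedType.Exports HBNNSimple.

Set Implicit Arguments.
Unset Strict Implicit.
Unset Printing Implicit Defensive.

Local Open Scope classical_set_scope.
Local Open Scope ring_scope.

(* If V has the Radon-Nikodym property and u is in R^1X, the scalar weak derivatives d_f of
   <f, u> satisfy |d_f| <= g, so A |-> int_A rho d_f (rho a weight making everything
   integrable) is represented by a V-valued measure nu(A); its density divided by rho is the
   weak derivative of u.  That nu(A) lies in V (and not only in its bidual) is checked on boxes by
   integration by parts and extended by dominated limits.

   Conversely, suppose that nu is dominated by h d(mu) but has no density.  Then some e > 0 is
   such that every step function has defect at least e on some finite partition; refining
   along such partitions gives an e-bush, a V-valued martingale whose consecutive levels stay
   e apart.  Listing every child twice makes the masses of the nodes tend to 0, so the partial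
   sums of the bush define a 1-Lipschitz curve gamma in V.  Multiplied by a tent function,
   gamma(x_0) is in R^1X: real Lipschitz functions are weakly differentiable, with derivative
   the weak limit of the difference quotients.  If it were in W^1X, its weak derivative w would
   integrate to increments of gamma over slabs, and approximating w by simple functions in L^1
   shows, by orthogonality of real martingale increments, that the consecutive levels of the
   bush approach each other. *)

(** * Hahn-Banach: norming functionals *)

(** Vector identities are tested with functionals of norm at most 1: Hahn-Banach makes them
    separating and norming, so Bochner integrals and weak derivatives become families of real ones.
    What scalars do not give is membership in [V]; it comes from Cauchy estimates in norm, or from
    Bochner integrals that exist because [u] itself is strongly measurable. The space [X] is
    arbitrary, but (P4) gives local integrability, and (P1) with (P3) put bounded measurable
    functions supported in a box inside [Omega] into it; hence one compactly supported curve serves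
    for every [X]. The Radon-Nikodym property speaks of measures, so the curve has to be made from a
    measure without density, whose underlying space may have atoms. An atom would stay a node of
    fixed mass and leave a gap in the parameter interval; duplication with halved weights closes all
    gaps. The contradiction compares mean slopes of the curve on nested intervals, so that no
    pointwise differentiability is involved. *)

Section hahn_banach.
Context {R : realType} {V : normedModType R}.
Implicit Types (G : set (V * R)) (x y v : V).

(** A partial functional is kept as a linear relation below the norm. Domination makes it
    single-valued: two values over [x] differ by a value over 0, which is at most 0 in either
    order. *)
Let partial_functional G := [/\ forall a p q, G p -> G q -> G (a *: p.1 + q.1, a * p.2 + q.2) &
  forall p, G p -> p.2 <= `|p.1|].

Let graph_uniq G x r s : partial_functional G -> G (x, r) -> G (x, s) -> r = s.
Proof.
move=> [GD Gle] Gr Gs; apply/eqP; rewrite eq_le.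
have := Gle _ (GD (-1) _ _ Gr Gs); have := Gle _ (GD (-1) _ _ Gs Gr).
by rewrite /= !scaleN1r addNr normr0 !mulN1r => h1 h2; apply/andP; split; lra.
Qed.

(** One-dimensional extension: a value at [x] is admissible if it lies above every p.2 - |p.1 - x|
    and below every |q.1 + x| - q.2. The triangle inequality orders these bounds, the supremum of
    the lower ones is taken, and homogeneity reduces a multiple [t *: x] to t = 1 or t = -1. *)
Let extend G x : partial_functional G -> G (0, 0) -> 
  exists G', [/\ partial_functional G', G `<=` G' & exists r, G' (x, r)].
Proof.
move=> [GD Gle] G0.
have [xG|xG] := pselect (exists r, G (x, r)); first by exists G; split.
pose A := [set p.2 - `|p.1 - x| | p in G].
have ub q : G q -> ubound A (`|q.1 + x| - q.2).
  move=> Gq _ [p Gp <-].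
  have := Gle _ (GD 1 _ _ Gp Gq); rewrite /= scale1r mul1r => h.
  have : `|p.1 + q.1| <= `|p.1 - x| + `|q.1 + x|.
    by rewrite (le_trans _ (ler_normD _ _))// addrACA (addrC _ x) subrr addr0.
  by lra.
have Ane : A !=set0 by exists (0 - `|0 - x|), (0, 0).
have hubA : has_ubound A by exists (`|0 + x| - 0); exact: (ub _ G0).
pose a := sup A.
have a1 p : G p -> p.2 - `|p.1 - x| <= a by move=> Gp; apply: ub_le_sup => //; exists p.
have a2 q : G q -> a <= `|q.1 + x| - q.2 by move=> Gq; apply: ge_sup => //; exact: ub.
exists [set p | exists q t, [/\ G q, p.1 = q.1 + t *: x & p.2 = q.2 + t * a]]; split.
- split => [b _ _ [q1 [t1 [Gq1 -> ->]]] [q2 [t2 [Gq2 -> ->]]]|].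
    exists (b *: q1.1 + q2.1, b * q1.2 + q2.2), (b * t1 + t2); split => /=.
    + exact: GD.
    + by rewrite scalerDr scalerDl scalerA addrACA.
    + by ring.
  move=> _ [q [t [Gq -> ->]]].
  have GZ (b : R) p : G p -> G (b *: p.1, b * p.2).
    by move=> Gp; have := GD b _ _ Gp G0; rewrite /= !addr0.
  have [t0|t0|->] := ltgtP t 0.
  + have s0 : 0 < (- t)^-1 by rewrite invr_gt0 oppr_gt0.
    have := a1 _ (GZ ((- t)^-1) _ Gq) => /=.
    have -> : q.1 + t *: x = (- t) *: ((- t)^-1 *: q.1 - x).
      by rewrite scalerBr scalerA mulfV ?oppr_eq0 ?lt_eqF// scale1r scaleNr opprK.
    rewrite normrZ ger0_norm; last by rewrite oppr_ge0 ltW.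
    move=> h.
    have h2 : (- t) * ((- t)^-1 * q.2 - `|(- t)^-1 *: q.1 - x|) <= (- t) * a.
      by apply: ler_wpM2l; [rewrite oppr_ge0 ltW|exact: h].
    move: h2; rewrite mulrBr mulrA mulfV ?oppr_eq0 ?lt_eqF// mul1r; lra.
  + have := a2 _ (GZ t^-1 _ Gq) => /=.
    have -> : q.1 + t *: x = t *: (t^-1 *: q.1 + x).
      by rewrite scalerDr scalerA mulfV ?gt_eqF// scale1r.
    rewrite normrZ gtr0_norm// => h.
    have h2 : t * a <= t * (`|t^-1 *: q.1 + x| - t^-1 * q.2) by rewrite ler_pM2l.
    move: h2; rewrite mulrBr mulrA mulfV ?gt_eqF// mul1r; lra.
  + by rewrite scale0r mul0r !addr0; exact: Gle.
- by move=> p Gp; exists p, 0; rewrite scale0r mul0r !addr0; split.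
- by exists a, (0, 0), 1; rewrite /= scale1r mul1r !add0r; split.
Qed.

Lemma norming_functional v : exists f : {linear V -> R^o},
  (forall x, `|f x| <= `|x|) /\ f v = `|v|.
Proof.
pose G0 := [set p : V * R | exists t, p = (t *: v, t * `|v|)].
have pG0 : partial_functional G0.
  split=> [a _ _ [t ->] [s ->]|_ [t ->]] /=.
    by exists (a * t + s); rewrite scalerDl scalerA mulrDl mulrA.
  by rewrite normrZ ler_wpM2r// ler_norm.
pose P := [set G | G = set0 \/ (partial_functional G /\ G0 `<=` G)].
have PG0 : P G0 by right; split.
have [|G [PG Gmax]] := @Zorn_bigcup _ P.
  move=> F FP Ftot.
  have [[B FB B0]|FB] := pselect (exists2 B, F B & B !=set0); last first.
    left; rewrite -subset0 => p [B FB' Bp].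
    by apply: FB; exists B => //; exists p.
  right; split; last first.
    move=> p G0p; exists B => //.
    by case: (FP _ FB) => [B00|[_]]; [move/set0P: B0; rewrite B00 eqxx|exact].
  split=> [a p q [B1 FB1 Bp] [B2 FB2 Bq]|p [B1 FB1 Bp]]; last first.
    by case: (FP _ FB1) => [B10|[[_ +] _]]; [rewrite B10 in Bp|apply].
  case: (Ftot _ _ FB1 FB2) => h.
    exists B2 => //; case: (FP _ FB2) => [B20|[[+ _] _]]; first by rewrite B20 in Bq.
    by apply => //; exact: h.
  exists B1 => //; case: (FP _ FB1) => [B10|[[+ _] _]]; first by rewrite B10 in Bp.
  by apply => //; exact: h.
have [pG G0G] : partial_functional G /\ G0 `<=` G.
  case: PG => [G00|//]; exfalso; apply: (Gmax G0) => //.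
  rewrite G00; split; first by [].
  by move=> h; apply: (h (0, 0)); exists 0; rewrite scale0r mul0r.
have G00 : G (0, 0) by apply: G0G; exists 0; rewrite scale0r mul0r.
have Gtot x : exists r, G (x, r).
  have [G' [pG' GG' [r G'r]]] := extend x pG G00.
  have [|GnG'] := pselect (G' `<=` G); first by exists r; auto.
  exfalso; apply: (Gmax G'); first by split.
  by right; split=> //; exact: subset_trans GG'.
have [f0 Gf0] := choice Gtot.
have f0lin : linear (f0 : V -> R^o).
  by move=> a x y; apply: (graph_uniq pG (Gf0 _)); exact: (pG.1 a _ _ (Gf0 x) (Gf0 y)).
pose L := GRing.isLinear.Build _ _ _ _ (f0 : V -> R^o) f0lin.
pose f : {linear V -> R^o} := HB.pack (f0 : V -> R^o) L.
exists f; split=> [x|]; last first.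
  apply: (graph_uniq pG (Gf0 v)).
  by apply: G0G; exists 1; rewrite scale1r mul1r.
rewrite ler_norml lerNl; apply/andP; split; last exact: (pG.2 _ (Gf0 x)).
have -> : - f x = f0 (- x) by rewrite -[RHS]/(f (- x)) linearN.
by rewrite -normrN; exact: (pG.2 _ (Gf0 (- x))).
Qed.

Lemma dual_norm_le1P (f : {linear V -> R^o}) :
  (dual_norm f <= 1)%E <-> forall x, `|f x| <= `|x|.
Proof.
split=> [f1 x|f1]; last first.
  by apply: ge_ereal_sup => _ [x x1 <-]; rewrite lee_fin; apply: le_trans (f1 x) _.
have [->|x0] := eqVneq x 0; first by rewrite linear0 !normr0.
have nx0 : 0 < `|x| by rewrite normr_gt0.
have : ((`|f (`|x|^-1 *: x)|)%:E <= 1)%E.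
  apply: le_trans f1; apply: ereal_sup_ubound; exists (`|x|^-1 *: x) => //=.
  by rewrite normrZ ger0_norm ?invr_ge0// mulVf ?gt_eqF.
rewrite lee_fin linearZ /= normrM ger0_norm ?invr_ge0//.
by rewrite -(ler_pM2l nx0) mulrA mulfV ?gt_eqF// mul1r mulr1.
Qed.

Lemma le1_functional_continuous (f : {linear V -> R^o}) :
  (forall x, `|f x| <= `|x|) -> continuous f.
Proof.
move=> f1; apply: bounded_linear_continuous.
exists 1; split=> // M M1; apply/nbhs_ballP; exists 1 => //= y.
rewrite -ball_normE /= sub0r normrN => y1.
by apply: le_trans (f1 y) _; apply: ltW; exact: lt_trans y1 M1.
Qed.

Lemma functional_sep v v' : 
  (forall f : {linear V -> R^o}, (forall x, `|f x| <= `|x|) -> f v = f v') -> v = v'.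
Proof.
move=> h; have [f [f1 fv]] := norming_functional (v - v').
by apply/eqP; rewrite -subr_eq0 -normr_eq0 -fv linearB /= (h f f1) subrr.
Qed.

Lemma norm_le_functional v (c : R) : 
  (forall f : {linear V -> R^o}, (forall x, `|f x| <= `|x|) -> `|f v| <= c) -> `|v| <= c.
Proof.
move=> h; have [f [f1 fv]] := norming_functional v.
by rewrite -fv (le_trans (ler_norm _))// h.
Qed.

End hahn_banach.

(** * Lebesgue measure on R^d *)

Section lebesgue_boxes.
Context {R : realType} {n : nat}.
Local Notation E := 'rV[R]_n.+1.
Local Notation lo := (@lebesgue_outer R n).
Implicit Types (p : E * E) (A X : set E) (x : E).

Let len p (i : 'I_n.+1) : R := Num.max 0 (p.2 ord0 i - p.1 ord0 i).

Let len_ge0 p i : 0 <= len p i. Proof. by rewrite /len le_max lexx. Qed.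

(* The first [m] coordinates have been integrated out of the indicator of
   [box p]. *)
Let partial_volume p (m : nat) x : R :=
  \prod_(i < n.+1) (if (i < m)%N then len p i
                    else \1_[set t | p.1 ord0 i < t <= p.2 ord0 i] (x ord0 i)).

Let upd x (j : 'I_n.+1) (t : R) : E := \row_i (if i == j then t else x ord0 i).

Let partial_volume_ge0 p m x : 0 <= partial_volume p m x.
Proof. by apply: prodr_ge0 => i _; case: ifP. Qed.

Let rest_volume p (j : 'I_n.+1) x : R :=
  \prod_(i < n.+1 | i != j) (if (i < j)%N then len p i
                    else \1_[set t | p.1 ord0 i < t <= p.2 ord0 i] (x ord0 i)).

Let rest_volume_ge0 p j x : 0 <= rest_volume p j x.
Proof. by apply: prodr_ge0 => i _; case: ifP. Qed.

Let partial_volume_upd p (j : 'I_n.+1) x t : partial_volume p j (upd x j t) =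
  rest_volume p j x * \1_[set t | p.1 ord0 j < t <= p.2 ord0 j] t.
Proof.
rewrite /partial_volume (bigD1 j)//= ltnn mxE eqxx mulrC; congr (_ * _).
by apply: eq_bigr => i /negbTE ij; rewrite mxE ij.
Qed.

Let partial_volumeS p (j : 'I_n.+1) x : partial_volume p j.+1 x =
  rest_volume p j x * len p j.
Proof.
rewrite /partial_volume (bigD1 j)//= ltnSn mulrC; congr (_ * _).
apply: eq_bigr => i ij; rewrite ltnS leq_eqVlt.
by have -> : (i == j :> nat) = false by apply/negbTE.
Qed.

Let itvE (a b : R) : [set t | a < t <= b] = [set` `]a, b]].
Proof. by apply/seteqP; split => t /=; rewrite in_itv. Qed.

Let measurable_oc (a b : R) : measurable [set t : R | a < t <= b].
Proof. by rewrite itvE; exact: measurable_itv. Qed.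

Let integral_partial_volume p (j : 'I_n.+1) x :
  (\int[lebesgue_measure]_t (partial_volume p j (upd x j t))%:E =
   (partial_volume p j.+1 x)%:E)%E.
Proof.
under eq_integral do rewrite partial_volume_upd EFinM.
rewrite ge0_integralZl_EFin//; last first.
  by apply/measurable_EFinP; apply: measurable_indic; exact: measurable_oc.
rewrite integral_indic//; last exact: measurable_oc.
rewrite setIT partial_volumeS EFinM; congr (_ * _)%E.
rewrite itvE [LHS]lebesgue_measure_itv/= lte_fin /len.
case: ltP => ab; first by rewrite max_r ?subr_ge0 ?ltW.
by rewrite max_l// subr_le0.
Qed.

Let measurable_partial_volume p (j : 'I_n.+1) x :
  measurable_fun setT (fun t => (partial_volume p j (upd x j t))%:E).
Proof.
apply/measurable_EFinP; under eq_fun do rewrite partial_volume_upd.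
by apply: measurable_funM => //; apply: measurable_indic; exact: measurable_oc.
Qed.

(** The inequality between the indicator of a box and the sum of the indicators of its cover is
    integrated one coordinate at a time against one-dimensional Lebesgue measure. Monotone
    convergence handles the countable cover, so no compactness argument enters. *)
Let box_volume_cover p (B : nat -> E * E) : box p `<=` \bigcup_k box (B k) ->
  ((box_volume p)%:E <= \sum_(0 <= k <oo) (box_volume (B k))%:E)%E.
Proof.
move=> pB.
have pvE q x : partial_volume q n.+1 x = box_volume q.
  by apply: eq_bigr => i _; rewrite ltn_ord.
suff main m : (m <= n.+1)%N -> forall x, ((partial_volume p m x)%:E <=
    \sum_(0 <= k <oo) (partial_volume (B k) m x)%:E)%E.
  have := main n.+1 (leqnn _) 0; rewrite pvE.
  by under eq_eseriesr do rewrite pvE.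
elim: m => [_ x|m ih mn x].
  have [px|npx] := pselect (box p x); last first.
    suff -> : partial_volume p 0 x = 0.
      by apply: nneseries_ge0 => k _ _; rewrite lee_fin.
    have /existsNP [i ip] := npx.
    rewrite /partial_volume (bigD1 i)//= indicE memNset ?mul0r//.
  have [k _ Bk] := pB _ px.
  have one q : box q x -> partial_volume q 0 x = 1.
    move=> qx; rewrite /partial_volume big1// => i _ /=.
    by rewrite indicE mem_set//; exact: qx.
  rewrite one// -(one _ Bk).
  rewrite (nneseries_split 0 k.+1)//; last by move=> *; rewrite lee_fin.
  rewrite add0n big_nat_recr//= -addeA addeCA leeDl//.
  rewrite adde_ge0//; first by apply: sume_ge0 => i _; rewrite lee_fin.
  by apply: nneseries_ge0 => i _ _; rewrite lee_fin.
pose j := Ordinal mn.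
rewrite -[m in m.+1]/(j : nat) -integral_partial_volume.
under eq_eseriesr do rewrite -integral_partial_volume.
rewrite -integral_nneseries//=; first last.
- by move=> *; rewrite lee_fin.
- by move=> k; exact: (measurable_partial_volume (B k) j x).
apply: ge0_le_integral => //=.
- by move=> t _; rewrite lee_fin.
- exact: (measurable_partial_volume p j x).
- apply: ge0_emeasurable_sum => [k t _ _|k _]; first by rewrite lee_fin.
  exact: (measurable_partial_volume (B k) j x).
- by move=> t _; apply: ih; exact: ltnW.
Qed.

Lemma lebesgue_outer_box p : lo (box p) = (box_volume p)%:E.
Proof.
apply/eqP; rewrite eq_le; apply/andP; split; last first.
  by apply: le_ereal_inf_tmp => _ [B pB <-]; exact: box_volume_cover.
apply: ereal_inf_lbound; exists (fun k => if k == 0%N then p else (0, 0)).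
  by move=> x px; exists 0%N.
rewrite nneseries_recl//; last by move=> k _; rewrite lee_fin box_volume_ge0.
rewrite eseries0 ?adde0// => -[//|k] _ _ /=; rewrite /box_volume big_ord_recl /=.
by rewrite subrr maxxx mul0r.
Qed.

(** The hyperplane cuts each half-open box of a cover into two half-open boxes whose volumes add up
    exactly; the two families cover the two parts of [X]. *)
Lemma halfspace_caratheodory (j : 'I_n.+1) (a : R) :
  caratheodory_measurable lo [set x : E | x ord0 j <= a].
Proof.
apply: (@le_caratheodory_measurable _ _ lo) => X /=.
apply: le_ereal_inf_tmp => _ [B XB <-].
pose B1 k : E * E := ((B k).1, \row_i if i == j then Num.min ((B k).2 ord0 i) a else (B k).2 ord0 i).
pose B2 k : E * E := (\row_i if i == j then Num.max ((B k).1 ord0 i) a else (B k).1 ord0 i, (B k).2).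
have -> : (\sum_(0 <= k <oo) (box_volume (B k))%:E =
   \sum_(0 <= k <oo) (box_volume (B1 k))%:E + \sum_(0 <= k <oo) (box_volume (B2 k))%:E)%E.
  rewrite -nneseriesD; try by move=> *; rewrite lee_fin box_volume_ge0.
  apply: eq_eseriesr => k _; rewrite -EFinD; congr EFin.
  rewrite /box_volume (bigD1 j)//= [in X in _ = X + _](bigD1 j)//= [in X in _ = _ + X](bigD1 j)//=.
  rewrite !mxE eqxx.
  have -> : \prod_(i < n.+1 | i != j) Num.max 0 ((B1 k).2 ord0 i - (B1 k).1 ord0 i) =
            \prod_(i < n.+1 | i != j) Num.max 0 ((B k).2 ord0 i - (B k).1 ord0 i).
    by apply: eq_bigr => i /negbTE ij; rewrite !mxE ij.
  have -> : \prod_(i < n.+1 | i != j) Num.max 0 ((B2 k).2 ord0 i - (B2 k).1 ord0 i) =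
            \prod_(i < n.+1 | i != j) Num.max 0 ((B k).2 ord0 i - (B k).1 ord0 i).
    by apply: eq_bigr => i /negbTE ij; rewrite !mxE ij.
  rewrite -mulrDl; congr (_ * _).
  rewrite /B1 /B2 /=; move: ((B k).1 ord0 j) ((B k).2 ord0 j).
  rewrite /Order.max /Order.min => s t /=; case: (ltP t a); case: (ltP s a) => ? ?;
    repeat case: ltP => ?; lra.
apply: leeD; apply: ereal_inf_lbound.
  exists B1 => //= x [Xx xa]; have [k _ Bk] := XB _ Xx; exists k => // i /=.
  rewrite mxE; have := Bk i; case: eqP => [->|//].
  by move=> /andP[-> xi] /=; rewrite le_min xi.
exists B2 => //= x [Xx /negP]; rewrite -ltNge => xa.
have [k _ Bk] := XB _ Xx; exists k => // i /=.
rewrite mxE; have := Bk i; case: eqP => [->|//].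
by move=> /andP[xi ->]; rewrite gt_max xi xa.
Qed.

End lebesgue_boxes.

Section euclidean_boxes.
Context {R : realType} {n : nat}.
Local Notation E := 'rV[R]_n.+1.
Local Notation L := (lebesgue_space R n).
Local Notation mu := (@lebesgue_Rn R n).
Implicit Types (p : E * E) (A X : set E) (x : E).

Definition obox p : set E :=
  [set x | forall i, p.1 ord0 i < x ord0 i < p.2 ord0 i].
Definition cbox p : set E :=
  [set x | forall i, p.1 ord0 i <= x ord0 i <= p.2 ord0 i].

Lemma coord_le_norm x (i : 'I_n.+1) : `|x ord0 i| <= `|x|.
Proof.
rewrite {2}/Num.norm/= mx_normrE.
exact: (le_bigmax _ (fun ij : 'I_1 * 'I_n.+1 => `|x ij.1 ij.2|) (ord0, i)).
Qed.

Lemma norm_le_coord x (c : R) : 0 <= c -> (forall i, `|x ord0 i| <= c) -> `|x| <= c.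
Proof.
move=> c0 h; rewrite /Num.norm/= mx_normrE; apply/bigmax_leP; split=> // -[i j] _ /=.
by rewrite ord1.
Qed.

Lemma obox_sub_box p : obox p `<=` box p.
Proof. by move=> x px i; have /andP[-> /ltW ->] := px i. Qed.

Lemma box_sub_cbox p : box p `<=` cbox p.
Proof. by move=> x px i; have /andP[/ltW -> ->] := px i. Qed.

Lemma obox_sub_cbox p : obox p `<=` cbox p.
Proof. by apply: subset_trans (@box_sub_cbox p); exact: obox_sub_box. Qed.

Lemma coordinatewiseE (Q : 'I_n.+1 -> set R) :
  [set x : E | forall i, Q i (x ord0 i)] =
  \bigcap_(i in [set: 'I_n.+1]) ((fun x : E => x ord0 i) @^-1` Q i).
Proof. by apply/seteqP; split => x /= h i; [move=> _; exact: h|exact: (h i I)]. Qed.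

Lemma compact_cbox p : compact (cbox p).
Proof.
rewrite (_ : cbox p = [set v : E | forall i, [set` `[p.1 ord0 i, p.2 ord0 i]] (v ord0 i)]).
  by apply: (@rV_compact _ _ (fun i => [set` `[p.1 ord0 i, p.2 ord0 i]])) => i; exact: segment_compact.
by apply/seteqP; split => x /= px i; have := px i; rewrite in_itv.
Qed.

Lemma closed_cbox p : closed (cbox p).
Proof. by apply: compact_closed (@compact_cbox p); exact: norm_hausdorff. Qed.

Lemma measurable_coord (j : 'I_n.+1) :
  measurable_fun setT (fun x : L => (x : E) ord0 j).
Proof.
apply: (measurability _ (RGenOInfty.measurableE R)) => _ [_ [a ->] <-].
rewrite setTI; have -> : (fun x : L => (x : E) ord0 j) @^-1` `]a, +oo[%classic =
  ~` [set x : E | x ord0 j <= a].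
  apply/seteqP; split => x; rewrite /= in_itv/= andbT; first by rewrite ltNge => /negP.
  by move=> /negP; rewrite -ltNge.
by apply: measurableC; exact: halfspace_caratheodory.
Qed.

Lemma measurable_coordinatewise (Q : 'I_n.+1 -> set R) :
  (forall i, measurable (Q i)) ->
  measurable ([set x : E | forall i, Q i (x ord0 i)] : set L).
Proof.
move=> mQ; rewrite coordinatewiseE.
apply: (@fin_bigcap_measurable _ L) => [|i _]; first exact: finite_finset.
by rewrite -[X in measurable X]setTI; exact: measurable_coord.
Qed.

Lemma measurable_box p : measurable (box p : set L).
Proof.
apply: (measurable_coordinatewise (Q := fun i => [set t | p.1 ord0 i < t <= p.2 ord0 i])) => i.
rewrite (_ : mkset _ = [set` `]p.1 ord0 i, p.2 ord0 i]]); first exact: measurable_itv.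
by apply/seteqP; split => t /=; rewrite in_itv.
Qed.

Lemma lebesgue_box p : mu (box p) = (box_volume p)%:E.
Proof. exact: lebesgue_outer_box. Qed.

Lemma open_cover_obox (U : set E) : open U ->
  exists B : nat -> E * E, U = \bigcup_k obox (B k) /\ forall k, cbox (B k) `<=` U.
Proof.
move=> oU.
pose toE (v : 'rV[rat]_n.+1) : E := map_mx ratr v.
(* Pairs of rational corners are enumerated by [pickle]. A code without a pair, or whose closed box
   leaves [U], is sent to a box with reversed ends, which is empty. *)
pose B k : E * E := if @unpickle ('rV[rat]_n.+1 * 'rV[rat]_n.+1)%type k is Some pq
  then if pselect (cbox (toE pq.1, toE pq.2) `<=` U) then (toE pq.1, toE pq.2) else (0, const_mx (-1))
  else (0, const_mx (-1)).
have cB k : cbox (B k) `<=` U.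
  have emp : cbox (0, const_mx (-1)) `<=` U.
    by move=> x /(_ ord0); rewrite /= !mxE => /andP[? ?]; exfalso; lra.
  by rewrite /B; case: unpickle => // pq; case: pselect.
exists B; split=> //; apply/seteqP; split=> [x Ux|x [k _]]; last first.
  by move=> /obox_sub_cbox; exact: cB.
have := oU; rewrite openE => /(_ _ Ux) /nbhs_ballP[e /= e0 xe].
have /fin_all_exists[q qP] : forall i, exists q : rat * rat,
    [/\ x ord0 i - e < ratr q.1, ratr q.1 < x ord0 i, x ord0 i < ratr q.2 & ratr q.2 < x ord0 i + e].
  move=> i; have [q1] := @rat_in_itvoo R (x ord0 i - e) (x ord0 i) ltac:(lra).
  have [q2] := @rat_in_itvoo R (x ord0 i) (x ord0 i + e) ltac:(lra).
  by rewrite !in_itv/= => /andP[? ?] /andP[? ?]; exists (q1, q2).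
pose pq := (\row_i (q i).1, \row_i (q i).2).
exists (pickle pq) => //; rewrite /B pickleK; case: pselect => [_|] /=.
  by move=> i; rewrite !mxE; have [_ -> -> _] := qP i.
case=> y yq; apply: xe; split=> // i j; rewrite ord1.
have := yq j; rewrite /= !mxE -ball_normE /= => /andP[? ?].
by have [? ? ? ?] := qP j; rewrite ltr_norml; apply/andP; split; lra.
Qed.

Lemma measurable_obox p : measurable (obox p : set L).
Proof.
apply: (measurable_coordinatewise (Q := fun i => [set t | p.1 ord0 i < t < p.2 ord0 i])) => i.
rewrite (_ : mkset _ = [set` `]p.1 ord0 i, p.2 ord0 i[]); first exact: measurable_itv.
by apply/seteqP; split => t /=; rewrite in_itv.
Qed.

Lemma open_lebesgue_measurable (U : set E) : open U -> measurable (U : set L).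
Proof.
move=> /open_cover_obox[B [-> _]].
by apply: bigcupT_measurable => k; exact: measurable_obox.
Qed.

Lemma closed_lebesgue_measurable (U : set E) : closed U -> measurable (U : set L).
Proof.
by move=> cU; rewrite -(setCK U); apply: measurableC; apply: open_lebesgue_measurable; exact: closed_openC.
Qed.

Lemma compact_lebesgue_measurable (K : set E) : compact K -> measurable (K : set L).
Proof.
by move=> cK; apply: closed_lebesgue_measurable; apply: compact_closed => //; exact: norm_hausdorff.
Qed.

Lemma measurable_cbox p : measurable (cbox p : set L).
Proof. exact/closed_lebesgue_measurable/closed_cbox. Qed.

Lemma continuous_lebesgue_measurable (f : E -> R) : continuous f ->
  measurable_fun setT (f : L -> R).
Proof.
move=> cf; apply: (measurability _ (RGenOInfty.measurableE R)) => _ [_ [a ->] <-].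
rewrite setTI; apply: open_lebesgue_measurable; apply: open_comp.
  by move=> x _; exact: cf.
exact: interval_open.
Qed.

Lemma bounded_sub_box A (M : R) : (forall x, A x -> `|x| <= M) ->
  A `<=` obox (const_mx (- M - 1), const_mx (M + 1)).
Proof.
move=> AM x /AM xM i /=; rewrite !mxE.
have := le_trans (coord_le_norm x i) xM; rewrite ler_norml => /andP[? ?].
by apply/andP; split; lra.
Qed.

Lemma lebesgue_bounded_lty A (M : R) : measurable (A : set L) ->
  (forall x, A x -> `|x| <= M) -> (mu A < +oo)%E.
Proof.
move=> mA /bounded_sub_box AM.
apply: (@le_lt_trans _ _ (mu (box (const_mx (- M - 1), const_mx (M + 1))))).
  apply: le_measure; rewrite ?inE//; first exact: measurable_box.
  by apply: subset_trans AM _; exact: obox_sub_box.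
by rewrite lebesgue_box ltry.
Qed.

Lemma compact_le_norm (K : set E) : compact K -> exists M : R, forall x, K x -> `|x| <= M.
Proof.
move=> /compact_bounded [M0 [_ M0K]].
by exists (M0 + 1) => x Kx; apply: (M0K _ _ x Kx); rewrite ltrDl.
Qed.

Lemma lebesgue_compact_lty (K : set E) : compact K -> (mu K < +oo)%E.
Proof.
move=> cK; have [M KM] := compact_le_norm cK.
by apply: lebesgue_bounded_lty KM; exact: compact_lebesgue_measurable.
Qed.

Lemma lebesgue_obox_lty p : (mu (obox p) < +oo)%E.
Proof.
apply: le_lt_trans (lebesgue_compact_lty (@compact_cbox p)).
apply: le_measure; rewrite ?inE//; [exact: measurable_obox|exact: measurable_cbox|].
exact: obox_sub_cbox.
Qed.

Lemma lebesgue_sigma_finite : sigma_finite [set: L] mu.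
Proof.
exists (fun k => obox (const_mx (- k%:R - 1), const_mx (k%:R + 1)) : set L).
  apply/seteqP; split=> // x _.
  exists (Num.bound `|x : E|) => //.
  apply: (@bounded_sub_box [set x : E]) => // _ ->.
  by rewrite ltW// archi_boundP.
by move=> k; split; [exact: measurable_obox|exact: lebesgue_obox_lty].
Qed.

Lemma lebesgue_complete : measure_is_complete mu.
Proof. exact: (@measure_is_complete_caratheodory R E (@lebesgue_outer R n)). Qed.

End euclidean_boxes.

Section translation.
Context {R : realType} {n : nat}.
Local Notation E := 'rV[R]_n.+1.
Local Notation L := (lebesgue_space R n).
Local Notation mu := (@lebesgue_Rn R n).
Local Notation lo := (@lebesgue_outer R n).
Implicit Types (p : E * E) (A X : set E) (a x : E).

Let shift a : E -> E := fun x => x + a.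

Lemma lebesgue_outer_shift a A : lo (shift a @^-1` A) = lo A.
Proof.
have main b C : (lo (shift b @^-1` C) <= lo C)%E.
  apply: le_ereal_inf_tmp => _ [B CB <-]; apply: ereal_inf_lbound => /=.
  exists (fun k => ((B k).1 - b, (B k).2 - b)).
    move=> x /CB [k _ Bk]; exists k => // i /=.
    by have := Bk i; rewrite !mxE => /andP[? ?]; apply/andP; split; lra.
  apply: eq_eseriesr => k _; congr EFin; apply: eq_bigr => i _ /=.
  by rewrite !mxE; congr (Num.max _ _); lra.
apply/eqP; rewrite eq_le main /=.
have := main (- a) (shift a @^-1` A); congr (lo _ <= _)%E.
by apply/seteqP; split => x; rewrite /shift /= subrK.
Qed.

(** The Caratheodory criterion for the preimage of [A], tested on [X], is the criterion for [A]
    tested on a translate of [X], because the outer measure is translation invariant. *)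
Lemma measurable_shift a : measurable_fun setT (fun x : L => ((x : E) + a : L)).
Proof.
move=> _ A mA; rewrite setTI.
suff : caratheodory_measurable lo (shift a @^-1` A) by [].
move=> X.
have shiftX Y : lo ((shift (- a) @^-1` X) `&` Y) = lo (X `&` (shift a @^-1` Y)).
  rewrite -[LHS](lebesgue_outer_shift a); congr lo.
  by apply/seteqP; split => x; rewrite /shift /= addrK.
have : lo (shift (- a) @^-1` X) = (lo ((shift (- a) @^-1` X) `&` A) +
    lo ((shift (- a) @^-1` X) `&` ~` A))%E := mA _.
by rewrite lebesgue_outer_shift !shiftX.
Qed.

Lemma ge0_integral_lebesgue_shift a (f : L -> \bar R) : measurable_fun setT f ->
  (forall x, 0 <= f x)%E -> (\int[mu]_x f ((x : E) + a)%R = \int[mu]_x f x)%E.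
Proof.
move=> mf f0.
have := ge0_integral_pushforward (measurable_shift a) mu measurableT mf (fun x _ => f0 x).
rewrite preimage_setT => <-.
apply: eq_measure_integral => [|? A mA _]; first exact: measurable_shift.
exact: (lebesgue_outer_shift a A).
Qed.

Lemma integral_lebesgue_shift a (f : L -> \bar R) : measurable_fun setT f ->
  (\int[mu]_x f ((x : E) + a)%R = \int[mu]_x f x)%E.
Proof.
move=> mf; rewrite [LHS]integralE [RHS]integralE.
rewrite -(ge0_integral_lebesgue_shift a (measurable_funepos mf) (funepos_ge0 f)).
rewrite -(ge0_integral_lebesgue_shift a (measurable_funeneg mf) (funeneg_ge0 f)).
by congr (_ - _)%E; apply: eq_integral => x _; rewrite ?funeposE ?funenegE.
Qed.

End translation.

Section density.
Context {R : realType} {n : nat}.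
Local Notation E := 'rV[R]_n.+1.
Local Notation L := (lebesgue_space R n).
Local Notation mu := (@lebesgue_Rn R n).
Implicit Types (p q : E * E) (A X : set E) (a x : E).

Let oboxes : set (set E) := [set A | exists p, A = obox p].
Let B := g_sigma_algebraType oboxes.

Let measurable_box_gen p : measurable (box p : set B).
Proof.
have -> : box p = \bigcap_k obox (p.1, p.2 + const_mx k.+1%:R^-1).
  apply/seteqP; split => x.
    move=> px k _ i /=; rewrite !mxE; have /andP[-> h] := px i.
    by rewrite (le_lt_trans h)// ltrDl.
  move=> h i; have /andP[/= -> _] := h 0%N I i => /=.
  rewrite leNgt; apply/negP => /ltr_add_invr[k].
  by have := h k I i; rewrite /= !mxE => /andP[_ /ltW]; rewrite leNgt => /negP.
by apply: bigcapT_measurable => k; apply: sub_sigma_algebra; eexists; reflexivity.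
Qed.

(** The hull is the intersection of covers by boxes of total volume below mu(A) + 1/(k+1). It
    belongs to the sigma-algebra generated by open boxes, which lets statements about boxes reach
    every Lebesgue measurable set up to a null set. *)
Lemma measurable_gen_hull A : (mu A < +oo)%E ->
  exists G : set E, [/\ measurable (G : set B), measurable (G : set L), A `<=` G & (mu G <= mu A)%E].
Proof.
move=> Afin.
have fA : mu A \is a fin_num.
  by rewrite ge0_fin_numE//; exact: lebesgue_outer_ge0.
have H k : exists C : nat -> E * E, A `<=` \bigcup_i box (C i) /\
    (\sum_(0 <= i <oo) (box_volume (C i))%:E < mu A + (k.+1%:R^-1)%:E)%E.
  have k0 : 0 < k.+1%:R^-1 :> R by [].
  by have [_ [C AC <-] Ce] := lb_ereal_inf_adherent k0 fA; exists C.
have [C CP] := choice H.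
exists (\bigcap_k \bigcup_i box (C k i)); split.
- apply: bigcapT_measurable => k; apply: bigcupT_measurable => i.
  exact: measurable_box_gen.
- apply: (@bigcapT_measurable _ L) => k; apply: bigcupT_measurable => i.
  exact: measurable_box.
- by move=> x Ax k _; exact: (CP k).1.
- apply/lee_addgt0Pr => e e0.
  have [k] := ltr_add_invr e0; rewrite add0r => ke.
  apply: (@le_trans _ _ (\sum_(0 <= i <oo) (box_volume (C k i))%:E)%E).
    by apply: ereal_inf_lbound; exists (C k) => //= x; exact.
  by rewrite (le_trans (ltW (CP k).2))// leeD2l// lee_fin ltW.
Qed.

Let obox_setI p q : obox p `&` obox q =
  obox (\row_i Num.max (p.1 ord0 i) (q.1 ord0 i), \row_i Num.min (p.2 ord0 i) (q.2 ord0 i)).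
Proof.
apply/seteqP; split => x /=.
  move=> [px qx] i; rewrite !mxE gt_max lt_min.
  by have /andP[-> ->] := px i; have /andP[-> ->] := qx i.
move=> h; split=> i; have := h i; rewrite /= !mxE gt_max lt_min.
  by move=> /andP[/andP[-> _] /andP[-> _]].
by move=> /andP[/andP[_ ->] /andP[_ ->]].
Qed.

Lemma obox_density p (P : (E -> R) -> Prop) :
  (forall q, (forall i, p.1 ord0 i <= q.1 ord0 i /\ q.2 ord0 i <= p.2 ord0 i) -> P \1_(obox q)) ->
  (forall (a : R) f g, P f -> P g -> P (fun x => a * f x + g x)) ->
  (forall (f_ : nat -> E -> R) f, (forall k, P (f_ k)) ->
    (forall k, measurable_fun setT (f_ k : L -> R)) -> measurable_fun setT (f : L -> R) ->
    (forall k x, `|f_ k x| <= \1_(obox p) x) -> (forall x, `|f x| <= \1_(obox p) x) ->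
    {ae mu, forall x : L, f_ ^~ x @ \oo --> f x} -> P f) ->
  forall A, measurable (A : set L) -> P \1_(A `&` obox p).
Proof.
move=> Pbox Plin Plim.
have mO : measurable (obox p : set L) by exact: measurable_obox.
have P1 : P \1_(obox p) by exact: Pbox.
have P0 : P (fun=> 0).
  by have := Plin (-1) _ _ P1 P1; congr P; apply/funext => x; rewrite mulN1r addNr.
have le1 A x : A `<=` obox p -> `|\1_A x : R| <= \1_(obox p) x.
  move=> AO; rewrite !indicE; case: (boolP (x \in A)) => xA; last by rewrite normr0.
  by rewrite (mem_set (AO _ (set_mem xA))) normr1.
pose Q A := measurable (A : set L) /\ P \1_(A `&` obox p).
have QB A : measurable (A : set B) -> Q A.
  apply: (@dynkin_induction _ B oboxes Q) => //.
  - by move=> _ _ [q ->] [r ->]; rewrite obox_setI; eexists.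
  - by split; [exact: measurableT|rewrite setTI].
  - move=> _ [q ->]; split; first exact: measurable_obox.
    rewrite obox_setI; apply: Pbox => i.
    by rewrite /= !mxE; split; rewrite ?le_max ?ge_min lexx orbT.
  - move=> S _ [mS PS]; split; first exact: measurableC.
    have := Plin (-1) _ _ PS P1; congr P; apply/funext => x.
    rewrite !indicE !in_setI in_setC.
    by case: (x \in S); case: (x \in obox p) => /=; ring.
  - move=> F mF tF QF; split; first by apply: bigcupT_measurable => k; exact: (QF k).1.
    pose f k x : R := \sum_(i < k) \1_(F i `&` obox p) x.
    have fE k x j : F j x -> obox p x -> f k x = (j < k)%:R.
      move=> Fx Ox; rewrite /f.
      have others i : i != j -> \1_(F i `&` obox p) x = 0 :> R.
        move=> ij; rewrite indicE memNset// => -[Fi _].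
        by move/eqP: ij; apply; apply: (tF i j) => //; exists x.
      case: ltnP => jk.
        rewrite (bigD1 (Ordinal jk))//= big1 => [|i ij]; last exact: others.
        by rewrite indicE mem_set// addr0.
      by rewrite big1// => i _; apply: others; rewrite ltn_eqF// (leq_trans (ltn_ord i)).
    have fE0 k x : ~ ((\bigcup_k F k) `&` obox p) x -> f k x = 0.
      move=> nx; rewrite /f big1// => i _; rewrite indicE memNset// => -[Fi Ox].
      by apply: nx; split=> //; exists i.
    apply: (Plim f).
    + elim=> [|k ih]; first by rewrite /f; under eq_fun do rewrite big_ord0.
      have := Plin 1 _ _ (QF k).2 ih; congr P; apply/funext => x.
      by rewrite /f big_ord_recr/= mul1r addrC.
    + move=> k; apply: measurable_sum => i.
      by apply: measurable_indic; apply: measurableI => //; exact: (QF i).1.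
    + apply: measurable_indic; apply: measurableI => //.
      by apply: bigcupT_measurable => k; exact: (QF k).1.
    + move=> k x; have [[[j _ Fj] Ox]|/(fE0 k) ->] := pselect (((\bigcup_k F k) `&` obox p) x).
        by rewrite (fE _ _ _ Fj Ox) indicE mem_set//; case: (j < k)%N; rewrite ?normr1 ?normr0.
      by rewrite normr0.
    + by move=> x; apply: le1 => y [].
    + apply: aeW => x; have [[[j _ Fj] Ox]|nx] := pselect (((\bigcup_k F k) `&` obox p) x).
        rewrite indicE mem_set//; last by split=> //; exists j.
        apply: cvg_near_cst; exists j.+1 => // k /= jk.
        by rewrite (fE _ _ _ Fj Ox) jk.
      rewrite indicE memNset//; apply: cvg_near_cst; near=> k; exact: fE0.
move=> A mA; have mAO : measurable (A `&` obox p : set L) by exact: measurableI.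
have AOfin : (mu (A `&` obox p) < +oo)%E.
  apply: le_lt_trans (lebesgue_obox_lty p); apply: le_measure; rewrite ?inE//.
have [G [mG mG' AG GA]] := measurable_gen_hull AOfin.
have [_ PG] := QB _ mG.
(* Inside the box the hull exceeds [A] by a null set only, so a constant sequence converges almost
   everywhere to the wanted indicator. *)
apply: (Plim (fun=> \1_(G `&` obox p))) => //.
- by move=> k; apply: measurable_indic; exact: measurableI.
- by move=> k x; apply: le1 => y [].
- by move=> x; apply: le1 => y [].
exists (G `\` (A `&` obox p)); split; first exact: measurableD.
- rewrite measureD//; last by rewrite (le_lt_trans GA).
  have -> : G `&` (A `&` obox p) = A `&` obox p by apply/setIidr.
  have GE : mu G = mu (A `&` obox p).
    by apply/eqP; rewrite eq_le GA; apply: le_measure => //; rewrite inE.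
  rewrite [X in (X - _)%E = _]GE subee//.
  by rewrite ge0_fin_numE//; exact: lebesgue_outer_ge0.
- move=> x /= nx; apply: contrapT => ngx; apply: nx.
  suff -> : \1_(G `&` obox p) x = \1_(A `&` obox p) x :> R by exact: cvg_cst.
  rewrite !indicE; congr (_%:R); congr nat_of_bool; apply/idP/idP => /set_mem h; apply/mem_set.
    by apply: contrapT => nh; apply: ngx; split=> //; exact: h.1.
  by split; [exact: AG|exact: h.2].
Unshelve. all: by end_near. Qed.

End density.

(** * Bochner integration *)

Lemma ae_imply d (S : measurableType d) (R : realType) (mu : {measure set S -> \bar R})
    (P Q : S -> Prop) :
  {ae mu, forall x, P x} -> (forall x, P x -> Q x) -> {ae mu, forall x, Q x}.
Proof. by move=> aeP PQ; apply: filterS aeP. Qed.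

Lemma ae_imply2 d (S : measurableType d) (R : realType) (mu : {measure set S -> \bar R})
    (P P' Q : S -> Prop) : {ae mu, forall x, P x} -> {ae mu, forall x, P' x} ->
  (forall x, P x -> P' x -> Q x) -> {ae mu, forall x, Q x}.
Proof. by move=> aeP aeP' PQ; apply: filterS2 aeP aeP'. Qed.

Section real_integrals.
Context d (S : measurableType d) (R : realType) (mu : {measure set S -> \bar R}).
Implicit Types (D : set S) (f g : S -> R).

Lemma le_integrable_real D f g : measurable D -> measurable_fun D f ->
  mu.-integrable D (EFin \o g) -> (forall x, D x -> `|f x| <= g x) ->
  mu.-integrable D (EFin \o f).
Proof.
move=> mD mf ig fg; apply: (le_integrable mD _ _ ig).
  exact/measurable_EFinP.
move=> x Dx /=; rewrite lee_fin (le_trans (fg _ Dx))//; exact: ler_norm.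
Qed.

Lemma integrable_realP D f : mu.-integrable D (EFin \o f) <->
  measurable_fun D f /\ (\int[mu]_(x in D) `|f x|%:E < +oo)%E.
Proof.
split=> [/integrableP[/measurable_EFinP mf]|[mf h]]; first by [].
by apply/integrableP; split=> //; exact/measurable_EFinP.
Qed.

Lemma eq_integrable_real D f g : f =1 g -> mu.-integrable D (EFin \o f) ->
  mu.-integrable D (EFin \o g).
Proof. by move=> /funext ->. Qed.

Lemma integrable_real_norm D f : measurable D -> mu.-integrable D (EFin \o f) ->
  mu.-integrable D (EFin \o (fun x => `|f x|)).
Proof. by move=> mD; exact: integrable_norm. Qed.

Lemma Rintegral_sum (I : Type) (r : seq I) (F : I -> S -> R) D : measurable D ->
  (forall i, mu.-integrable D (EFin \o F i)) ->
  mu.-integrable D (EFin \o (fun x => \sum_(i <- r) F i x)) /\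
  \int[mu]_(x in D) (\sum_(i <- r) F i x) = \sum_(i <- r) \int[mu]_(x in D) F i x.
Proof.
move=> mD iF; elim: r => [|i r [ih1 ih2]].
  split; first by under eq_fun do rewrite big_nil; exact: integrable0.
  by under eq_Rintegral do rewrite big_nil; rewrite big_nil Rintegral_cst// mul0r.
split.
  have -> : EFin \o (fun x => \sum_(j <- i :: r) F j x) =
      (EFin \o F i) \+ (EFin \o (fun x => \sum_(j <- r) F j x)).
    by apply/funext => x /=; rewrite big_cons EFinD.
  exact: integrableD.
rewrite big_cons -ih2 -RintegralD//.
by apply: eq_Rintegral => x _; rewrite big_cons.
Qed.

Lemma integrable_realD D f g : measurable D -> mu.-integrable D (EFin \o f) ->
  mu.-integrable D (EFin \o g) -> mu.-integrable D (EFin \o (fun x => f x + g x)).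
Proof. by move=> mD ? ?; have := @integrableD _ _ _ mu D mD (EFin \o f) (EFin \o g); apply. Qed.

Lemma integrable_realB D f g : measurable D -> mu.-integrable D (EFin \o f) ->
  mu.-integrable D (EFin \o g) -> mu.-integrable D (EFin \o (fun x => f x - g x)).
Proof. by move=> mD ? ?; have := @integrableB _ _ _ mu D mD (EFin \o f) (EFin \o g); apply. Qed.

Lemma integrable_realZ D f (c : R) : measurable D -> mu.-integrable D (EFin \o f) ->
  mu.-integrable D (EFin \o (fun x => c * f x)).
Proof. by move=> mD ?; have := @integrableZl _ _ _ mu D mD c (EFin \o f); apply. Qed.

Lemma le_normr_Rintegral_dom D f g : measurable D -> measurable_fun D f ->
  mu.-integrable D (EFin \o g) -> (forall x, D x -> `|f x| <= g x) ->
  `|\int[mu]_(x in D) f x| <= \int[mu]_(x in D) g x.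
Proof.
move=> mD mf ig fg; have iF := le_integrable_real mD mf ig fg.
apply: le_trans (le_normr_Rintegral mD iF) _.
by apply: le_Rintegral => //; exact: integrable_norm.
Qed.

Lemma ae_eq_Rintegral D f g : measurable D -> measurable_fun D f -> measurable_fun D g ->
  {ae mu, forall x, D x -> f x = g x} -> \int[mu]_(x in D) f x = \int[mu]_(x in D) g x.
Proof.
move=> mD mf mg fg; congr fine; apply: ae_eq_integral => //.
- exact/measurable_EFinP.
- exact/measurable_EFinP.
- by apply: filterS fg => x h Dx; rewrite h.
Qed.

Lemma ae_le_integral_lty D f g : measurable D -> measurable_fun D f -> measurable_fun D g ->
  (forall x, D x -> 0 <= g x) -> {ae mu, forall x, D x -> `|f x| <= g x} ->
  (\int[mu]_(x in D) (g x)%:E < +oo)%E -> (\int[mu]_(x in D) `|f x|%:E < +oo)%E.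
Proof.
move=> mD mf mg g0 fg; apply: le_lt_trans; apply: ae_ge0_le_integral => //.
  by apply/measurable_EFinP; exact: measurableT_comp.
exact/measurable_EFinP.
Qed.

Lemma dominated_Rintegral D (f_ : nat -> S -> R) f g : measurable D ->
  (forall k, measurable_fun D (f_ k)) -> measurable_fun D f ->
  mu.-integrable D (EFin \o g) ->
  {ae mu, forall x, D x -> f_ ^~ x @ \oo --> f x} ->
  {ae mu, forall x, D x -> forall k, `|f_ k x| <= g x} ->
  mu.-integrable D (EFin \o f) /\
  \int[mu]_(x in D) f_ k x @[k --> \oo] --> \int[mu]_(x in D) f x.
Proof.
move=> mD mf_ mf ig cf fg.
have [|||||iF _ cI] := @dominated_convergence _ _ _ mu D mD (fun k => EFin \o f_ k) (EFin \o f) (EFin \o g).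
- by move=> k; exact/measurable_EFinP.
- exact/measurable_EFinP.
- by apply: filterS cf => x h Dx; apply/fine_cvgP; split; [exact: nearW|exact: h].
- exact: ig.
- by apply: filterS fg => x h k Dx /=; rewrite lee_fin; exact: h.
split=> //; apply: fine_cvg; rewrite fineK//.
exact: integrable_fin_num.
Qed.

End real_integrals.

Section simple_functions.
Context d (S : measurableType d) (R : realType).
Implicit Types (V W : normedModType R).

Local Notation srange s := (finmap.enum_fset (fset_set (range s))).

Lemma simple_preimage V (s : S -> V) (B : set V) : simple_function s ->
  measurable (s @^-1` B).
Proof.
move=> [fs ms].
have -> : s @^-1` B = \bigcup_(v in B `&` range s) s @^-1` [set v].
  apply/seteqP; split=> [x Bx|x [v [Bv _] /= sv]]; last by rewrite /preimage/= sv.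
  by exists (s x); [split=> //; exists x|].
by apply: fin_bigcup_measurable => [|v _]; [exact: finite_setIr|exact: ms].
Qed.

Lemma simple_map2 V1 V2 V3 (op : V1 -> V2 -> V3) (s : S -> V1) (t : S -> V2) :
  simple_function s -> simple_function t ->
  simple_function (fun x => op (s x) (t x)).
Proof.
move=> ss st; have [fs _] := ss; have [ft _] := st; split.
  apply: sub_finite_set (finite_image2 op fs ft).
  by move=> _ [x _ <-]; exists (s x); [exists x|exists (t x); [exists x|]].
move=> w.
have -> : (fun x => op (s x) (t x)) @^-1` [set w] =
    \bigcup_(v in range s) (s @^-1` [set v] `&` t @^-1` [set z | op v z = w]).
  apply/seteqP; split=> [x /= xw|x [v _ [/= -> ->]]//].
  by exists (s x) => //; exists x.
apply: fin_bigcup_measurable => // v _.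
by apply: measurableI; exact: simple_preimage.
Qed.

Lemma simple_cst V (v : V) : simple_function (cst v : S -> V).
Proof.
split; first by apply: sub_finite_set (finite_set1 v) => _ [x _ <-].
move=> w; rewrite preimage_cst; by case: ifP.
Qed.

Lemma simple_indic V (A : set S) (v : V) : measurable A ->
  simple_function (fun x => (\1_A x : R) *: v).
Proof.
move=> mA; split.
  apply: (@sub_finite_set _ _ [set v; 0]); last exact: finite_set2.
  move=> _ [x _ <-]; rewrite indicE; case: (x \in A) => /=.
    by left; rewrite scale1r.
  by right; rewrite scale0r.
move=> w.
have -> : (fun x => (\1_A x : R) *: v) @^-1` [set w] =
    (A `&` [set _ | v = w]) `|` (~` A `&` [set _ | 0 = w]).
  apply/seteqP; split=> [x /=|x [[Ax /=]|[Ax /=]]].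
  - by rewrite indicE; have [xA|xA] := pselect (A x);
      [rewrite mem_set// scale1r; left|rewrite memNset// scale0r; right].
  - by rewrite indicE mem_set// scale1r.
  - by rewrite indicE memNset// scale0r.
have mP (Q : Prop) : measurable [set _ : S | Q].
  have [q|q] := pselect Q.
    by rewrite (_ : mkset _ = setT)//; apply/seteqP; split.
  by rewrite (_ : mkset _ = set0)//; apply/seteqP; split.
by apply: measurableU; apply: measurableI => //; exact: measurableC.
Qed.

Lemma simple_measurable_comp V (s : S -> V) (g : V -> R) D : simple_function s ->
  measurable_fun D (g \o s).
Proof.
move=> ss; apply: measurable_funTS => _ B mB; rewrite setTI comp_preimage.
exact: simple_preimage.
Qed.

Lemma simple_expand V (s : S -> V) (g : V -> R) x : simple_function s ->
  g (s x) = \sum_(v <- srange s) g v * \1_(s @^-1` [set v]) x.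
Proof.
move=> [fs _]; have sx : s x \in srange s.
  by rewrite in_fset_set// inE; exists x.
rewrite (bigD1_seq (s x))//; last exact: finmap.fset_uniq.
rewrite indicE mem_set// mulr1 big1/= ?addr0// => v vs.
by rewrite indicE memNset ?mulr0//= => sv; rewrite sv eqxx in vs.
Qed.

(** The condition [g 0 = 0] discards the level set of 0, whose measure may be infinite and whose
    [fine] value would then be meaningless. Norms and functionals both satisfy it. *)
Lemma simple_Rintegral (mu : {measure set S -> \bar R}) V (s : S -> V) (g : V -> R) D :
  measurable D -> integrable_simple_function mu D s -> g 0 = 0 ->
  mu.-integrable D (EFin \o (g \o s)) /\
  \int[mu]_(x in D) g (s x) =
    \sum_(v <- srange s) g v * fine (mu (D `&` s @^-1` [set v])).
Proof.
move=> mD [ss si] g0.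
pose F v x : R := g v * \1_(s @^-1` [set v]) x.
have mv v : measurable (s @^-1` [set v]) by exact: simple_preimage.
have iF v : mu.-integrable D (EFin \o F v).
  have [->|v0] := eqVneq v 0.
    by rewrite /F g0; under eq_fun do rewrite mul0r; exact: integrable0.
  apply: integrable_realZ => //; apply/integrable_realP; split.
    exact: measurable_indic.
  under eq_integral do rewrite ger0_norm//.
  by rewrite integral_indic// setIC; exact: si.
have [h1 h2] := Rintegral_sum (srange s) mD iF.
have gE : g \o s = fun x => \sum_(v <- srange s) F v x.
  by apply/funext => x; exact: simple_expand.
rewrite gE; split=> //.
rewrite (_ : (fun x => g (s x)) = g \o s)// gE h2; apply: eq_bigr => v _.
have [->|v0] := eqVneq v 0.
  by rewrite /F g0 mul0r; under eq_Rintegral do rewrite mul0r; rewrite Rintegral_cst// mul0r.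
rewrite RintegralZl//; last first.
  apply/integrable_realP; split; first exact: measurable_indic.
  under eq_integral do rewrite ger0_norm//.
  by rewrite integral_indic// setIC; exact: si.
by congr (_ * fine _); rewrite integral_indic// setIC.
Qed.

Lemma functional_simple_integral (mu : {measure set S -> \bar R}) V (s : S -> V)
    (f : {linear V -> R^o}) D : measurable D -> integrable_simple_function mu D s ->
  f (simple_integral mu D s) = \int[mu]_(x in D) f (s x).
Proof.
move=> mD is_; have [_ ->] := simple_Rintegral mD is_ (linear0 f).
rewrite /simple_integral fsbig_finite/=; last exact: is_.1.1.
rewrite linear_sum; apply: eq_bigr => v _.
by rewrite linearZ /= mulrC.
Qed.

End simple_functions.

Lemma cauchy_sequence_cvg (R : realType) (V : completeNormedModType R) (v_ : nat -> V) :
  (forall e : R, 0 < e -> exists K, forall k l, (K <= k)%N -> (K <= l)%N -> `|v_ k - v_ l| < e) ->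
  cvgn v_.
Proof.
move=> h; apply/cauchy_cvgP; apply/cauchy_exP => e /h[K HK].
by exists (v_ K); exists K => // k /= Kk; rewrite -ball_normE /=; exact: HK.
Qed.

Section strong_measurability.
Context d (S : measurableType d) (R : realType) (mu : {measure set S -> \bar R}).
Implicit Types (V W : normedModType R) (D : set S).

Lemma strongly_measurable_map2 V1 V2 V3 (op : V1 -> V2 -> V3) D (s : S -> V1) (t : S -> V2) :
  (forall (a_ : nat -> V1) (b_ : nat -> V2) a b, a_ @ \oo --> a -> b_ @ \oo --> b ->
     op (a_ k) (b_ k) @[k --> \oo] --> op a b) ->
  strongly_measurable mu D s -> strongly_measurable mu D t ->
  strongly_measurable mu D (fun x => op (s x) (t x)).
Proof.
move=> cop [s_ [ss sc]] [t_ [tt tc]].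
exists (fun k x => op (s_ k x) (t_ k x)); split.
  by move=> k; exact: simple_map2.
by apply: filterS2 sc tc => x h1 h2 Dx; apply: cop; [exact: h1|exact: h2].
Qed.

Lemma strongly_measurable_comp V W (g : V -> W) D (s : S -> V) : continuous g ->
  strongly_measurable mu D s -> strongly_measurable mu D (g \o s).
Proof.
move=> cg ss; apply: (@strongly_measurable_map2 _ _ _ (fun v _ => g v) _ _ _ _ ss ss).
by move=> a_ _ a _ h _; apply: continuous_cvg => //; exact: cg.
Qed.

Lemma strongly_measurableB V D (s t : S -> V) : strongly_measurable mu D s ->
  strongly_measurable mu D t -> strongly_measurable mu D (fun x => s x - t x).
Proof. by apply: (@strongly_measurable_map2 V V V (fun v w => v - w)) => *; exact: cvgB. Qed.

Lemma strongly_measurableZ V D (a : S -> R^o) (t : S -> V) : strongly_measurable mu D a ->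
  strongly_measurable mu D t -> strongly_measurable mu D (fun x => a x *: t x).
Proof.
by apply: (@strongly_measurable_map2 R^o V V (fun a v => a *: v)) => *; exact: cvgZ.
Qed.

Lemma simple_strongly_measurable V D (s : S -> V) : simple_function s ->
  strongly_measurable mu D s.
Proof. by move=> ss; exists (fun=> s); split=> //; apply: aeW => x _; exact: cvg_cst. Qed.

Lemma strongly_measurableS V D D' (s : S -> V) : D `<=` D' ->
  strongly_measurable mu D' s -> strongly_measurable mu D s.
Proof.
move=> DD [s_ [ss cs]]; exists s_; split=> //.
by apply: filterS cs => x h /DD; exact: h.
Qed.

Lemma strongly_measurable_ae V D (s t : S -> V) :
  {ae mu, forall x, D x -> s x = t x} ->
  strongly_measurable mu D s -> strongly_measurable mu D t.
Proof.
move=> st [s_ [ss cs]]; exists s_; split=> //.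
by apply: filterS2 cs st => x h1 h2 Dx; rewrite -h2//; exact: h1.
Qed.

Lemma measurable_strongly_measurable D (f : S -> R) : measurable D ->
  measurable_fun D f -> strongly_measurable mu D (f : S -> R^o).
Proof.
move=> mD.
have nn (g : S -> R) : measurable_fun D g -> (forall x, 0 <= g x) ->
    strongly_measurable mu D (g : S -> R^o).
  move=> mg g0; have mg' : measurable_fun D (EFin \o g) by exact/measurable_EFinP.
  exists (fun k x => nnsfun_approx mD mg' k x : R^o); split=> [k|].
    by split=> //; exact: fimfunP.
  apply: aeW => x Dx.
  have : (nnsfun_approx mD mg' k x)%:E @[k --> \oo] --> (g x)%:E.
    by apply: cvg_nnsfun_approx => // y _; rewrite lee_fin.
  by move=> /fine_cvgP[].
move=> mf; have -> : (f : S -> R^o) = fun x => (f^\+)%R x - (f^\-)%R x :> R^o.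
  by apply/funext => x; rewrite /funrpos /funrneg /Order.max; repeat case: ltP => ?; lra.
apply: strongly_measurableB; apply: nn => //.
- exact: measurable_funrpos.
- exact: measurable_funrneg.
Qed.

(** The compositions of [g] with the simple functions converge only almost everywhere. Their upper
    limit is measurable, and completeness of the measure transfers this to [g \o s]. *)
Lemma strongly_measurable_measurable_comp V D (s : S -> V) (g : V -> R) : measure_is_complete mu ->
  measurable D -> continuous g -> strongly_measurable mu D s ->
  measurable_fun D (g \o s).
Proof.
move=> cmu mD cg [s_ [ss cs]]; apply/measurable_EFinP.
pose f x := limn_esup (fun k => (g (s_ k x))%:E).
apply: (@ae_measurable_fun _ _ _ _ cmu D f).
  apply: filterS cs => x h Dx; rewrite /f.
  have cvgE : (g (s_ k x))%:E @[k --> \oo] --> (g (s x))%:E.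
    have gc : g (s_ k x) @[k --> \oo] --> g (s x).
      by apply: continuous_cvg; [exact: cg|exact: h].
    by apply/fine_cvgP; split; [exact: nearW|exact: gc].
  rewrite is_cvg_limn_esupE; last by apply/cvg_ex; eexists; exact: cvgE.
  exact/cvg_lim.
apply: measurable_fun_limn_esup => k; apply/measurable_EFinP.
exact: simple_measurable_comp.
Qed.

Lemma strongly_measurable_norm V D (s : S -> V) : measure_is_complete mu ->
  measurable D -> strongly_measurable mu D s -> measurable_fun D (fun x => `|s x|).
Proof.
move=> cmu mD; apply: (@strongly_measurable_measurable_comp _ _ _ (fun v => `|v|)) => //.
exact: norm_continuous.
Qed.

Lemma functional_L1 V D (u : S -> V) (f : {linear V -> R^o}) : measure_is_complete mu ->
  measurable D -> (forall v, `|f v| <= `|v|) -> strongly_measurable mu D u ->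
  (\int[mu]_(x in D) `|u x|%:E < +oo)%E -> (\int[mu]_(x in D) `|f (u x)|%:E < +oo)%E.
Proof.
move=> cmu mD f1 su; apply: ae_le_integral_lty => //.
- exact: (@strongly_measurable_measurable_comp V D u f cmu mD (le1_functional_continuous f1) su).
- exact: strongly_measurable_norm.
- by apply: aeW => x _; exact: f1.
Qed.

End strong_measurability.

Section bochner_integral.
Context d (S : measurableType d) (R : realType) (mu : {measure set S -> \bar R}).

(** A functional norming the difference of the two integrals turns it into a real integral, so that
    no common refinement of the two simple functions has to be formed. *)
Lemma norm_simple_integralB_le (V : normedModType R) D (s t : S -> V) : measurable D ->
  integrable_simple_function mu D s -> integrable_simple_function mu D t ->
  ((`|simple_integral mu D s - simple_integral mu D t|)%:E <=
   \int[mu]_(x in D) `|s x - t x|%:E)%E.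
Proof.
move=> mD is_ it.
have [f [f1 <-]] := norming_functional (simple_integral mu D s - simple_integral mu D t).
rewrite linearB /= !functional_simple_integral//.
have [if_ _] := simple_Rintegral mD is_ (linear0 f).
have [ig _] := simple_Rintegral mD it (linear0 f).
rewrite -RintegralB//.
apply: (@le_trans _ _ (`|\int[mu]_(x in D) (f (s x) - f (t x))|%R%:E)%E).
  by rewrite lee_fin ler_norm.
have ifg := integrable_realB mD if_ ig.
rewrite EFin_normr_Rintegral//.
apply: le_trans (le_abse_integral _ mD _) _; first by have /integrableP[] := ifg.
apply: ge0_le_integral => //=.
- apply/measurable_EFinP; apply: (measurableT_comp (@normr_measurable R setT)).
  by have /integrable_realP[] := ifg.
- apply/measurable_EFinP; apply: (@simple_measurable_comp _ _ _ _ (fun x => s x - t x) (fun v => `|v|)).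
  by apply: (simple_map2 (fun v w => v - w)); [exact: is_.1|exact: it.1].
- by move=> x _; rewrite lee_fin -linearB; exact: f1.
Qed.

(** The values of [f] on the approximating integrals tend to [f v] by continuity, and to the real
    integral because their distance to it is at most the integral of |u - s_k|. *)
Lemma is_bochner_integral_functional (V : normedModType R) D (u : S -> V) v :
  measure_is_complete mu -> measurable D -> is_bochner_integral mu D u v ->
  (\int[mu]_(x in D) `|u x|%:E < +oo)%E /\
  forall f : {linear V -> R^o}, (forall x, `|f x| <= `|x|) ->
    f v = \int[mu]_(x in D) f (u x).
Proof.
move=> cmu mD.
move=> [su [s_ [is_ c0 cI]]].
have mdiff k : measurable_fun D (fun x => `|u x - s_ k x|).
  apply: (strongly_measurable_norm cmu mD); apply: strongly_measurableB => //.
  by apply: simple_strongly_measurable; exact: (is_ k).1.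
have fin_near : \forall k \near \oo, (\int[mu]_(x in D) `|u x - s_ k x|%:E \is a fin_num)%E.
  by have /fine_cvgP[] := c0.
have idiff k : (\int[mu]_(x in D) `|u x - s_ k x|%:E \is a fin_num)%E ->
    mu.-integrable D (EFin \o (fun x => `|u x - s_ k x|)).
  move=> fk; apply/integrable_realP; split=> //.
  under eq_integral do rewrite normr_id.
  by rewrite ltey_eq fk.
have [K _ HK] := fin_near.
have iu : mu.-integrable D (EFin \o (fun x => `|u x|)).
  have [isK _] := simple_Rintegral mD (is_ K) (normr0 V).
  apply: (le_integrable_real mD _ (integrable_realD mD (idiff K (HK K (leqnn K))) isK)).
    exact: (strongly_measurable_norm cmu).
  move=> x _; rewrite ger0_norm//.
  by rewrite -[X in `|X| <= _](subrK (s_ K x)) ler_normD.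
split.
  by have /integrable_realP[_] := iu; under eq_integral do rewrite normr_id.
move=> f f1.
have cf := le1_functional_continuous f1.
have ifu : mu.-integrable D (EFin \o (f \o u)).
  apply: (le_integrable_real mD _ iu); last by move=> x _; exact: f1.
  exact: (@strongly_measurable_measurable_comp _ _ _ mu V D u f cmu mD cf su).
apply: (@cvg_unique _ (@Rhausdorff R) (f (simple_integral mu D (s_ k)) @[k --> \oo])).
  by apply: continuous_cvg; [exact: cf|exact: cI].
have /fine_cvgP[_ c0'] := c0.
apply/cvgrPdist_le => e e0.
move/cvgrPdist_le : c0' => /(_ _ e0) c0'.
near=> k.
have fk : (\int[mu]_(x in D) `|u x - s_ k x|%:E \is a fin_num)%E by near: k.
have [ifs _] := simple_Rintegral mD (is_ k) (linear0 f).
rewrite functional_simple_integral// -RintegralB//.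
apply: le_trans (_ : \int[mu]_(x in D) `|u x - s_ k x| <= _).
  apply: le_normr_Rintegral_dom => //.
  - by have /integrable_realP[] := integrable_realB mD ifu ifs.
  - exact: idiff.
  - by move=> x _; rewrite -linearB; exact: f1.
have : `|0 - (fine \o (fun k => \int[mu]_(x in D) `|u x - s_ k x|%:E)%E) k| <= e by near: k.
by rewrite sub0r normrN /=; apply: le_trans; rewrite ler_norm.
Unshelve. all: by end_near. Qed.

(** Strong measurability gives simple functions that converge without any control of their size.
    Once dominated, they converge in L^1, so their integrals are Cauchy by
    [norm_simple_integralB_le], and completeness of [V] supplies the value. *)
Lemma bochner_L1_integral_ex (V : completeNormedModType R) D (u : S -> V) :
  measure_is_complete mu -> measurable D -> bochner_L1 mu D u ->
  exists v, is_bochner_integral mu D u v.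
Proof.
move=> cmu mD [su iu].
have [s_ [ss cs]] := su.
have mu_ : measurable_fun D (fun x => `|u x|) by exact: (strongly_measurable_norm cmu).
have iu' : mu.-integrable D (EFin \o (fun x => `|u x|)).
  by apply/integrable_realP; split=> //; under eq_integral do rewrite normr_id.
(* truncating at 2|u| keeps the convergence and makes it dominated *)
pose A k := D `&` [set x | `|s_ k x| <= 2 * `|u x| ].
have mA k : measurable (A k).
  have -> : A k = D `&` (fun x => `|s_ k x| - 2 * `|u x|) @^-1` [set` `]-oo, 0]].
    by apply/seteqP; split => x [Dx] /=; rewrite in_itv/= subr_le0; split.
  have mf : measurable_fun D (fun x => `|s_ k x| - 2 * `|u x|).
    apply: measurable_funB.
      exact: (simple_measurable_comp (fun v : V => `|v|)).
    exact: measurable_funM.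
  by apply: mf => //; exact: measurable_itv.
pose t k x := (\1_(A k) x : R) *: s_ k x.
have st k : simple_function (t k).
  by apply: (simple_map2 (fun (a : R^o) v => a *: v)) => //; have := simple_indic (1 : R^o) (mA k);
    congr simple_function; apply/funext => x; rewrite /GRing.scale/= mulr1.
have tb k x : D x -> `|t k x| <= 2 * `|u x|.
  move=> Dx; rewrite /t indicE; case: (boolP (x \in A k)) => [/set_mem[_ /= h]|_].
    by rewrite scale1r.
  by rewrite scale0r normr0 mulr_ge0.
have ct : {ae mu, forall x, D x -> t ^~ x @ \oo --> u x}.
  apply: filterS cs => x h Dx; have {}h := h Dx.
  have [u0|u0] := eqVneq (u x) 0.
    apply: (@cvg_near_cst) => //; apply: nearW => k; apply/eqP; rewrite u0 -normr_le0.
    by rewrite (le_trans (tb k x Dx))// u0 normr0 mulr0.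
  have nu : 0 < `|u x| by rewrite normr_gt0.
  have /cvgrPdist_le /(_ _ nu) h' := h.
  apply: cvg_trans h; apply: near_eq_cvg; apply: filterS h' => k hk.
  rewrite /t indicE mem_set ?scale1r//; split=> //=.
  have -> : s_ k x = u x - (u x - s_ k x) by rewrite subKr.
  by rewrite (le_trans (ler_normB _ _))// mulr2n mulrDl mul1r lerD2l.
have it k : integrable_simple_function mu D (t k).
  split=> // w w0; have nw : 0 < `|w| by rewrite normr_gt0.
  have mw : measurable (D `&` t k @^-1` [set w]) by apply: measurableI => //; exact: simple_preimage.
  (* Chebyshev's inequality: where [t k] takes the value [w], the norm of [u] is at least half that
     of [w]. *)
  have : ((`|w|)%:E * mu (D `&` t k @^-1` [set w]) <= \int[mu]_(x in D) (2 * `|u x|)%:E)%E.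
    rewrite -integral_cst//.
    apply: (@le_trans _ _ (\int[mu]_(x in D `&` t k @^-1` [set w]) (2 * `|u x|)%:E)%E).
      apply: ge0_le_integral => //=.
      - by apply/measurable_EFinP; apply: measurable_funM => //; exact: measurable_funS mu_.
      - by move=> x [Dx /= <-]; rewrite lee_fin; exact: tb.
    apply: ge0_subset_integral => //=.
    by apply/measurable_EFinP; exact: measurable_funM.
  have fin2 : (\int[mu]_(x in D) (2 * `|u x|)%:E < +oo)%E.
    have /integrable_realP[_] := integrable_realZ 2 mD iu'.
    by under eq_integral do rewrite ger0_norm ?mulr_ge0//.
  move=> /le_lt_trans /(_ fin2).
  have [//|] := ltP (mu (D `&` t k @^-1` [set w])) +oo%E.
  by rewrite leye_eq => /eqP ->; rewrite gt0_muley ?lte_fin// ltxx.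
have ct0 : (\int[mu]_(x in D) `|u x - t k x|%:E @[k --> \oo] --> 0)%E.
  have mk k : measurable_fun D (fun x => `|u x - t k x|).
    apply: (strongly_measurable_norm cmu mD); apply: strongly_measurableB => //.
    exact: simple_strongly_measurable.
  have [|||||_ _] := @dominated_convergence _ _ _ mu D mD
      (fun k x => `|u x - t k x|%:E) (cst 0%E) (fun x => (3 * `|u x|)%:E).
  - by move=> k; exact/measurable_EFinP.
  - exact: measurable_cst.
  - apply: filterS ct => x h Dx; apply/fine_cvgP; split; first exact: nearW.
    rewrite -(normr0 V); apply: cvg_norm.
    rewrite -(subrr (u x)); apply: cvgB; [exact: cvg_cst|exact: h].
  - exact: (integrable_realZ 3 mD iu').
  - apply: aeW => x k Dx /=; rewrite lee_fin normr_id (le_trans (ler_normB _ _))//.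
    by have := tb k x Dx; lra.
  by rewrite integral0.
have /fine_cvgP[fin_near ct0'] := ct0.
suff : cvgn (fun k => simple_integral mu D (t k)).
  by move=> /cvg_ex[w hw]; exists w; split=> //; exists t; split.
apply: cauchy_sequence_cvg => e e0.
have e2 : 0 < e / 2 by rewrite divr_gt0.
move/cvgrPdist_lt : ct0' => /(_ _ e2) ct0'.
have [K _ HK] := filterI fin_near ct0'.
exists K => k l /HK[fk ck] /HK[fl cl]; rewrite -lte_fin.
apply: le_lt_trans (norm_simple_integralB_le mD (it k) (it l)) _.
apply: (@le_lt_trans _ _ (\int[mu]_(x in D) `|u x - t k x|%:E + \int[mu]_(x in D) `|u x - t l x|%:E)%E).
  have mk i : measurable_fun D (fun x => `|u x - t i x|).
    apply: (strongly_measurable_norm cmu mD); apply: strongly_measurableB => //.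
    exact: simple_strongly_measurable.
  rewrite -ge0_integralD//=; [|exact/measurable_EFinP|exact/measurable_EFinP].
  apply: ge0_le_integral => //=.
  - apply/measurable_EFinP; apply: (simple_measurable_comp (fun v : V => `|v|)).
    exact: (simple_map2 (fun v w => v - w)).
  - by apply: emeasurable_funD; exact/measurable_EFinP.
  - move=> x _; rewrite -EFinD lee_fin.
    have -> : t k x - t l x = (u x - t l x) - (u x - t k x) by rewrite opprB [RHS]addrC addrA subrK.
    by rewrite (le_trans (ler_normB _ _))// addrC.
move: ck cl; rewrite !sub0r !normrN /=.
rewrite -(fineK fk) -(fineK fl) -EFinD lte_fin.
move=> /(le_lt_trans (ler_norm _)) ? /(le_lt_trans (ler_norm _)) ?.
lra.
Qed.

(** The two integrability conditions produce some integral, and separation by functionals forces it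
    to be [v]. This is the passage from Bochner integrals to real ones. *)
Lemma is_bochner_integralP (V : completeNormedModType R) D (u : S -> V) v :
  measure_is_complete mu -> measurable D ->
  is_bochner_integral mu D u v <->
  [/\ strongly_measurable mu D u, (\int[mu]_(x in D) `|u x|%:E < +oo)%E &
    forall f : {linear V -> R^o}, (forall x, `|f x| <= `|x|) ->
      f v = \int[mu]_(x in D) f (u x)].
Proof.
move=> cmu mD; split=> [h|[su iu hf]].
  by have [? ?] := is_bochner_integral_functional cmu mD h; split=> //; exact: h.1.
have [w hw] := bochner_L1_integral_ex cmu mD (conj su iu).
suff -> : v = w by [].
apply: functional_sep => f f1; rewrite hf//.
by have [_ ->] := is_bochner_integral_functional cmu mD hw.
Qed.

End bochner_integral.

(** * Smooth bump functions *)

Section flat_functions.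
Context {R : realType}.
Implicit Types (t q : {poly R}) (m : nat) (x y : R).

(* With [t(x)] a polynomial, [flat t q m] is [q * t^-m * exp(-1/t)] on [t > 0]
   and [0] elsewhere; this family is stable under derivation. *)
Definition flat t q m x : R :=
  if 0 < t.[x] then q.[x] * (t.[x])^-1 ^+ m * expR (- (t.[x])^-1) else 0.

(** Numerator of the derivative of q t^-m exp(-1/t) over the denominator t^(m+2). *)
Let dflat t q m : {poly R} :=
  q^`() * t ^+ 2 - m%:R *: (q * t^`() * t) + q * t^`().

Let horner_continuous q : continuous (horner q).
Proof.
by move=> x; apply: differentiable_continuous; apply/derivable1_diffP; exact: derivable_horner.
Qed.

(** The exponential series gives exp(1/t) >= t^-(m+2) / (m+2)!, so the function is at most |q|
    (m+2)! t^2, which is quadratically small at a root [x] of [t]. *)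
Let flat_bound t q m r x y : t = r * ('X - x%:P) ->
  `|flat t q m y| <= `|q.[y]| * (m.+2)`!%:R * r.[y] ^+ 2 * (y - x) ^+ 2.
Proof.
move=> tr; rewrite /flat; case: ifP => [t0|_]; last first.
  by rewrite normr0 mulr_ge0 ?sqr_ge0// mulr_ge0 ?sqr_ge0// mulr_ge0.
have -> : `|q.[y]| * (m.+2)`!%:R * r.[y] ^+ 2 * (y - x) ^+ 2 = `|q.[y]| * ((m.+2)`!%:R * t.[y] ^+ 2).
  by rewrite tr hornerM hornerXsubC; ring.
rewrite -mulrA normrM; apply: ler_wpM2l => //.
move: t0; set s := t.[y] => t0.
have s0 : 0 < s^-1 by rewrite invr_gt0.
have h : s^-1 ^+ m.+2 * expR (- s^-1) <= (m.+2)`!%:R.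
  rewrite expRN ler_pdivrMr ?expR_gt0//.
  have := expR_ge1Dxn m.+1 (ltW s0).
  have f0 : 0 < (m.+2)`!%:R :> R by rewrite ltr0n fact_gt0.
  move=> h; rewrite mulrC -ler_pdivrMr//; apply: le_trans h; lra.
rewrite ger0_norm; last by rewrite mulr_ge0 ?expR_ge0// exprn_ge0// ltW.
have -> : s^-1 ^+ m * expR (- s^-1) = (s^-1 ^+ m.+2 * expR (- s^-1)) * s ^+ 2.
  by rewrite !exprS; field; rewrite gt_eqF.
by apply: ler_wpM2r => //; exact: sqr_ge0.
Qed.

Let is_derive_flat t q m x :
  is_derive x 1 (flat t q m) (flat t (dflat t q m) m.+2 x).
Proof.
have [tx|tx|tx] := ltgtP 0 t.[x].
- have tx0 : t.[x] != 0 by rewrite gt_eqF.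
  apply: (@near_eq_is_derive _ _ _ (fun y => q.[y] * (t.[y])^-1 ^+ m * expR (- (t.[y])^-1))).
    have : \forall y \near x, 0 < t.[y].
      exact: (cvgr_gt _ (@horner_continuous t x) _ tx).
    by apply: filterS => y ty; rewrite /flat ty.
  have dq := is_derive_poly q x.
  have dt := is_derive_poly t x.
  have dv := @is_deriveV R (horner t) x _ 1 tx0 dt.
  have de : is_derive x 1 (fun y => expR (- (t.[y])^-1))
      (expR (- (t.[x])^-1) * (- (- t.[x] ^- 2 *: t^`().[x]))).
    apply: (@is_derive1_comp _ expR (fun y => - (t.[y])^-1)).
  have dX : is_derive x 1 (fun y => (t.[y])^-1 ^+ m) (m%:R * (t.[x])^-1 ^+ m.-1 * (- t.[x] ^- 2 *: t^`().[x])).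
    rewrite (_ : (fun y => (t.[y])^-1 ^+ m) = (fun y => (t.[y])^-1) ^+ m).
      exact: (is_derive_eq (is_deriveX m dv)).
    by apply/funext => y; rewrite !fctE.
  have dqX := is_deriveM (is_deriveM dq dX) de.
  apply: (is_derive_eq dqX); rewrite !fctE.
  rewrite /flat tx [_ ^+ m.+2]exprS [_ ^+ m.+1]exprS /dflat /GRing.scale/= !hornerE/=.
  move: (expR _) => e; move: t.[x] tx0 q.[x] t^`().[x] q^`().[x] => T T0 a b c.
  case: (m) => [|k]; first by rewrite /= !exprS ?expr0; field.
  rewrite [k.+1.-1]/= !exprS expr0.
  by move: (T^-1 ^+ k) => P; field.
- apply: (@near_eq_is_derive _ _ _ (cst 0)).
    have : \forall y \near x, t.[y] < 0.
      exact: (cvgr_lt _ (@horner_continuous t x) _ tx).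
    by apply: filterS => y ty; rewrite /flat ltNge ltW.
  rewrite /flat ltNge ltW//=; exact: is_derive_cst.
(* At a root of [t] both the value and the claimed derivative are 0; by [flat_bound] the difference
   quotient is bounded by a multiple of |h|. *)
- have /factor_theorem[r tr] : root t x by apply/eqP.
  rewrite {2}/flat -tx ltxx.
  suff h : h^-1 *: ((flat t q m \o shift x) (h *: 1) - flat t q m x) @[h --> 0^'] --> (0 : R).
    by split; [apply/cvg_ex; exists 0|exact: (cvg_lim (@norm_hausdorff _ _))].
  have fx : flat t q m x = 0 by rewrite /flat -tx ltxx.
  pose B y := `|q.[y]| * (m.+2)`!%:R * (r.[y] * r.[y]).
  have cB : B y @[y --> x] --> B x.
    apply: cvgM; last by apply: cvgM; exact: horner_continuous.
    by apply: cvgM; [apply: cvg_norm; exact: horner_continuous|exact: cvg_cst].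
  have : \forall y \near x, B y < B x + 1 by apply: (cvgr_lt _ cB); rewrite ltrDl.
  move=> /nbhs_ballP[k /= k0 xk].
  apply: (@cvg_to_0_linear _ _ (B x + 1) k) => // h /andP[h0 hk].
  have hn0 : h != 0 by rewrite -normr_gt0.
  rewrite fx subr0 /= /GRing.scale/= mulr1 normrM normfV.
  apply: (@le_trans _ _ (`|h|^-1 * (B (h + x) * (h + x - x) ^+ 2))).
    by apply: ler_wpM2l => //; exact: flat_bound tr.
  rewrite addrK -[h ^+ 2]real_normK ?num_real//.
  have -> : `|h|^-1 * (B (h + x) * `|h| ^+ 2) = B (h + x) * `|h| by field; rewrite normr_eq0.
  apply: ler_wpM2r => //; apply/ltW/xk.
  by rewrite -ball_normE /= opprD addrCA subrr addr0 normrN.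
Qed.

Lemma flat_derivable t q m :
  exists q', forall x, is_derive x 1 (flat t q m) (flat t q' m.+2 x).
Proof. by exists (dflat t q m) => x; exact: is_derive_flat. Qed.

Lemma flat_continuous t q m : continuous (flat t q m).
Proof.
move=> x; apply: differentiable_continuous; apply/derivable1_diffP.
have [q' h] := flat_derivable t q m.
exact: (@ex_derive _ _ _ _ _ _ _ (h x)).
Qed.

End flat_functions.

Section bumps.
Context {R : realType} {n : nat}.
Local Notation E := 'rV[R]_n.+1.
Implicit Types (p : E * E) (x : E) (phi : E -> R).

(** With the [T i] fixed, this class is closed under every [partial j], so continuity and
    derivability of its members alone give smoothness. *)
Definition flat_product (T : 'I_n.+1 -> {poly R}) : set (E -> R) :=
  [set phi | exists (q : 'I_n.+1 -> {poly R}) (m : 'I_n.+1 -> nat),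
    phi = fun x => \prod_i flat (T i) (q i) (m i) (x ord0 i)].

Lemma flat_product_continuous T phi : flat_product T phi -> continuous phi.
Proof.
move=> [q [m ->]]; elim: (index_enum _) => [|i r ih].
  by rewrite (_ : (fun x : E => _) = cst 1); [exact: cst_continuous|apply/funext => x; rewrite big_nil].
rewrite (_ : (fun x : E => _) = fun x => flat (T i) (q i) (m i) (x ord0 i) *
    \prod_(j <- r) flat (T j) (q j) (m j) (x ord0 j)); last by apply/funext => x; rewrite big_cons.
move=> x; apply: (@continuousM _ _ (fun y : E => flat (T i) (q i) (m i) (y ord0 i))); last exact: ih.
apply: (@continuous_comp _ _ _ (fun y : E => y ord0 i) (flat (T i) (q i) (m i))).
  exact: coord_continuous.
exact: flat_continuous.
Qed.

Lemma flat_product_partial T phi (j : 'I_n.+1) : flat_product T phi ->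
  (forall x, derivable phi x (delta_mx ord0 j)) /\ flat_product T (partial j phi).
Proof.
move=> [q [m ->]].
have /choice[dq dqP] := fun i : 'I_n.+1 => flat_derivable (T i) (q i) (m i).
pose c x := \prod_(i | i != j) flat (T i) (q i) (m i) (x ord0 i).
have main x : is_derive x (delta_mx ord0 j : E) (fun x => \prod_i flat (T i) (q i) (m i) (x ord0 i))
    (c x * flat (T j) (dq j) (m j).+2 (x ord0 j)).
  have [/= dj dvj] := dqP j (x ord0 j).
  suff h : h^-1 *: (((fun x => \prod_i flat (T i) (q i) (m i) (x ord0 i)) \o shift x)
      (h *: (delta_mx ord0 j : E)) - (\prod_i flat (T i) (q i) (m i) (x ord0 i))) @[h --> 0^'] -->
      c x * flat (T j) (dq j) (m j).+2 (x ord0 j).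
    by split; [apply/cvg_ex; eexists; exact: h|exact: (cvg_lim (@norm_hausdorff _ _))].
  have -> : (fun h : R => h^-1 *: (((fun x => \prod_i flat (T i) (q i) (m i) (x ord0 i)) \o shift x)
      (h *: (delta_mx ord0 j : E)) - (\prod_i flat (T i) (q i) (m i) (x ord0 i)))) =
    (fun h : R => c x * (h^-1 *: ((flat (T j) (q j) (m j) \o shift (x ord0 j)) (h *: 1) - flat (T j) (q j) (m j) (x ord0 j)))).
    apply/funext => h /=; rewrite (bigD1 j)//= [in X in _ - X](bigD1 j)//= !mxE !eqxx/= ?mulr1.
    have -> : \prod_(i < n.+1 | i != j) flat (T i) (q i) (m i) ((h *: delta_mx ord0 j + x) ord0 i) = c x.
      by apply: eq_bigr => i /negbTE ij; rewrite !mxE eqxx ij mulr0 add0r.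
    rewrite /c /GRing.scale/= ?mulr1; ring.
  apply: cvgM; first exact: cvg_cst.
  by rewrite -dvj; exact: dj.
split=> [x|]; first exact: (@ex_derive _ _ _ _ _ _ _ (main x)).
exists (fun i => if i == j then dq j else q i), (fun i => if i == j then (m j).+2 else m i).
apply/funext => x; rewrite /partial (@derive_val _ _ _ _ _ _ _ (main x)) [RHS](bigD1 j)//= eqxx mulrC.
by congr (_ * _); apply: eq_bigr => i /negbTE ->.
Qed.

Lemma flat_product_smooth T phi : flat_product T phi -> smooth phi.
Proof.
move=> Tphi s; have {Tphi} : flat_product T (foldr partial phi s).
  by elim: s => //= j s ih; exact: (flat_product_partial j ih).2.
move=> h; split; first exact: flat_product_continuous h.
by move=> x j; exact: (flat_product_partial j h).1.
Qed.

(** In each coordinate this is exp(-1/((k+1)(t-a)(b-t))) between the ends a and b of the side; as k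
    grows it increases to 1 there, hence the bumps tend to the indicator of the open box. *)
Definition smooth_bump p (k : nat) x : R :=
  \prod_i flat (k.+1%:R *: (('X - (p.1 ord0 i)%:P) * ((p.2 ord0 i)%:P - 'X))) 1 0 (x ord0 i).


Let factor_gt0 (a b t : R) (k : nat) : a < b ->
  (0 < (k.+1%:R *: (('X - a%:P) * (b%:P - 'X))).[t]) = (a < t < b).
Proof.
move=> ab; rewrite hornerZ pmulr_rgt0// !hornerE.
have [ta|ta|->] := ltgtP t a; rewrite ?subrr ?mul0r ?ltxx//.
  rewrite nmulr_rgt0 ?subr_lt0//; apply/negbTE; rewrite -leNgt; lra.
by rewrite pmulr_rgt0 ?subr_gt0.
Qed.

Lemma smooth_bump_flat_product p k : flat_product
  (fun i => k.+1%:R *: (('X - (p.1 ord0 i)%:P) * ((p.2 ord0 i)%:P - 'X))) (smooth_bump p k).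
Proof. by exists (fun=> 1), (fun=> 0%N). Qed.

Lemma smooth_bump_itv p k x : (forall i, p.1 ord0 i < p.2 ord0 i) ->
  0 <= smooth_bump p k x <= \1_(obox p) x.
Proof.
move=> p12; have b01 (i : 'I_n.+1) : 0 <= flat (k.+1%:R *: (('X - (p.1 ord0 i)%:P) * ((p.2 ord0 i)%:P - 'X))) 1 0 (x ord0 i)
    <= \1_[set t | p.1 ord0 i < t < p.2 ord0 i] (x ord0 i).
  rewrite /flat factor_gt0// indicE; case: ifPn => h; last first.
    by rewrite lexx ler0n.
  rewrite mem_set//; move: h; rewrite -(factor_gt0 _ k (p12 i)) => t0.
  have -> : (1 : {poly R}).[x ord0 i] = 1 by rewrite hornerE.
  rewrite expr0 mulr1 mul1r expR_ge0/= -[leRHS]expR0 ler_expR oppr_le0 invr_ge0.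
  exact: ltW.
apply/andP; split; first by apply: prodr_ge0 => i _; have /andP[] := b01 i.
apply: (@le_trans _ _ (\prod_i \1_[set t | p.1 ord0 i < t < p.2 ord0 i] (x ord0 i))).
  by apply: ler_prod => i _; exact: b01.
rewrite indicE; have [px|] := pselect (obox p x).
  by rewrite mem_set// big1// => i _; rewrite indicE mem_set//=; exact: px.
move=> npx; rewrite memNset//; have /existsNP[i ip] := npx.
by rewrite (bigD1 i)//= indicE memNset ?mul0r.
Qed.

Lemma smooth_bump_cvg p x : (forall i, p.1 ord0 i < p.2 ord0 i) ->
  smooth_bump p k x @[k --> \oo] --> (\1_(obox p) x : R).
Proof.
move=> p12; have [px|px] := pselect (obox p x); last first.
  rewrite indicE memNset//; apply: cvg_near_cst; apply: nearW => k.
  by have := smooth_bump_itv k x p12; rewrite indicE memNset// => /le_anti.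
rewrite indicE mem_set// [X in _ --> X](_ : _ = \prod_(i < n.+1) (1 : R)); last by rewrite big1_eq.
rewrite /smooth_bump.
elim: (index_enum _) => [|i r ih].
  by under eq_fun do rewrite big_nil; rewrite big_nil; exact: cvg_cst.
under eq_fun do rewrite big_cons; rewrite big_cons.
apply: cvgM; last exact: ih.
have sx : 0 < (x ord0 i - p.1 ord0 i) * (p.2 ord0 i - x ord0 i).
  by have /andP[? ?] := px i; rewrite mulr_gt0// subr_gt0.
have -> : (fun k : nat => flat (k.+1%:R *: (('X - (p.1 ord0 i)%:P) * ((p.2 ord0 i)%:P - 'X))) 1 0 (x ord0 i)) =
    (fun k : nat => expR (- (k.+1%:R^-1 * ((x ord0 i - p.1 ord0 i) * (p.2 ord0 i - x ord0 i))^-1))).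
  apply/funext => k; rewrite /flat factor_gt0//; have := px i => -> /=.
  have -> : (1 : {poly R}).[x ord0 i] = 1 by rewrite hornerE.
  by rewrite expr0 mulr1 mul1r hornerZ invfM hornerM hornerXsubC hornerD hornerN hornerC hornerX.
rewrite -[X in _ --> X]expR0; apply: continuous_cvg; first exact: continuous_expR.
rewrite -oppr0; apply: cvgN; rewrite -[X in _ --> X](mul0r ((x ord0 i - p.1 ord0 i) * (p.2 ord0 i - x ord0 i))^-1).
by apply: cvgM; [exact: cvg_harmonic|exact: cvg_cst].
Qed.

Lemma smooth_bump_test_function p k (Omega : set E) : (forall i, p.1 ord0 i < p.2 ord0 i) ->
  cbox p `<=` Omega -> test_function Omega (smooth_bump p k).
Proof.
move=> p12 pO.
have supp : closure [set x | smooth_bump p k x != 0] `<=` cbox p.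
  rewrite [X in _ `<=` X](closure_id (cbox p)).1; last exact: closed_cbox.
  apply: closure_subset => x /= bx; apply: obox_sub_cbox.
  apply: contrapT => npx; move/eqP: bx; apply.
  by have := smooth_bump_itv k x p12; rewrite indicE memNset// => /le_anti.
split.
- exact: flat_product_smooth (smooth_bump_flat_product p k).
- by apply: subclosed_compact (@compact_cbox _ _ p) supp; exact: closed_closure.
- exact: subset_trans supp pO.
Qed.

End bumps.

(** * Scalar characterisation of weak derivatives *)

Section dominated_set_functions.
Context d (S : measurableType d) (R : realType) (V : normedModType R).
Context (mu : {measure set S -> \bar R}).

(** The exceptional null set depends on [f], and there may be uncountably many functionals. It is
    enough to use one functional norming each value of the approximating simple functions: these are
    countably many, and near [w x] one of them almost norms [w x]. *)
Lemma norm_functional_ae_le D (w : S -> V) (g : S -> R) : strongly_measurable mu D w ->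
  (forall f : {linear V -> R^o}, (forall x, `|f x| <= `|x|) ->
    {ae mu, forall x, D x -> `|f (w x)| <= g x}) ->
  {ae mu, forall x, D x -> `|w x| <= g x}.
Proof.
move=> [s_ [ss cs]] fw.
have /choice[F FP] := @norming_functional R V.
have H k : {ae mu, forall x, D x -> forall v, range (s_ k) v -> `|F v (w x)| <= g x}.
  have [frk _] := ss k.
  have : {ae mu, forall x, forall v, v \in finmap.enum_fset (fset_set (range (s_ k))) -> D x -> `|F v (w x)| <= g x}.
    elim: (finmap.enum_fset _) => [|v r ih]; first by apply: aeW.
    apply: filterS2 (fw (F v) (FP v).1) ih => x h1 h2 v'.
    by rewrite inE => /orP[/eqP ->|]; [exact: h1|exact: h2].
  apply: filterS => x h Dx v rv; apply: h => //.
  by rewrite (in_fset_set frk) inE.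
apply: filterS2 cs (ae_foralln H) => x cx hx Dx.
apply/ler_addgt0Pr => e e0; have e2 : 0 < e / 2 by rewrite divr_gt0.
have /cvgrPdist_le /(_ _ e2)[K _ HK] := cx Dx.
have := HK K (leqnn K) => /= wK.
have h1 := hx K Dx (s_ K x) (ex_intro2 _ _ x I erefl).
have [F1 F2] := FP (s_ K x).
have h2 : `|w x| <= `|s_ K x| + `|w x - s_ K x|.
  by rewrite -[X in `|X| <= _](subrK (s_ K x)) addrC ler_normD.
have h3 : `|s_ K x| <= `|F (s_ K x) (w x)| + `|w x - s_ K x|.
  rewrite -[X in X <= _]F2.
  have -> : F (s_ K x) (s_ K x) = F (s_ K x) (w x) - F (s_ K x) (w x - s_ K x).
    by rewrite linearB/= subKr.
  rewrite (le_trans (ler_norm _))// (le_trans (ler_normB _ _))// lerD2l.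
  exact: F1.
lra.
Qed.

Lemma integral_tail_cvg0 (h : S -> R) (F : nat -> set S) : (forall x, 0 <= h x) ->
  mu.-integrable setT (EFin \o h) -> (forall i, measurable (F i)) -> trivIset setT F ->
  \int[mu]_(x in \bigcup_i F i `\` \bigcup_(i < k) F i) h x @[k --> \oo] --> 0.
Proof.
move=> h0 ih mF tF.
have mfin k : measurable (\bigcup_(i < k) F i) by exact: bigcup_measurable.
have mU : measurable (\bigcup_i F i) by exact: bigcupT_measurable.
have mh : measurable_fun setT h by have /integrable_realP[] := ih.
pose A k := \bigcup_i F i `\` \bigcup_(i < k) F i.
have mA k : measurable (A k) by exact: measurableD.
have -> : (fun k => \int[mu]_(x in \bigcup_i F i `\` \bigcup_(i < k) F i) h x) =
    (fun k => \int[mu]_x (h x * \1_(A k) x)).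
  apply/funext => k; rewrite [LHS]Rintegral_mkcond; apply: eq_Rintegral => x _.
  by rewrite patchE indicE; case: ifP; rewrite ?mulr1 ?mulr0.
have [|||||_] := @dominated_Rintegral _ _ _ mu setT (fun k x => h x * \1_(A k) x) (cst 0) h measurableT.
- by move=> k; apply: measurable_funM => //; exact: measurable_indic.
- exact: measurable_cst.
- exact: ih.
- apply: aeW => x _; apply: cvg_near_cst.
  have [[i _ Fi]|nx] := pselect ((\bigcup_i F i) x).
    exists i.+1 => // k /= ik; rewrite indicE memNset ?mulr0// => -[_]; apply.
    by exists i.
  by apply: nearW => k; rewrite indicE memNset ?mulr0// => -[].
- by apply: aeW => x _ k; rewrite normrM !ger0_norm// ler_piMr// indicE lern1 leq_b1.
by rewrite Rintegral_cst// mul0r.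
Qed.

(** Domination upgrades finite additivity: the remainder of a countable disjoint union has norm at
    most the integral of [h] over a tail, which tends to 0. Finite variation and absolute continuity
    are read off the same bound. *)
Lemma dominated_additive_measure (nu : set S -> V) (h : S -> R) :
  (forall x, 0 <= h x) -> mu.-integrable setT (EFin \o h) ->
  (forall A B, measurable A -> measurable B -> A `&` B = set0 ->
    nu (A `|` B) = nu A + nu B) ->
  (forall A, measurable A -> `|nu A| <= \int[mu]_(x in A) h x) ->
  [/\ vector_measure nu, (Defs.variation nu < +oo)%E & abs_continuous nu mu].
Proof.
move=> h0 ih nuD nuh.
have nu0 : nu set0 = 0.
  by apply/eqP; rewrite -normr_le0 (le_trans (nuh _ measurable0))// Rintegral_set0.
have ihA A : measurable A -> mu.-integrable A (EFin \o h) by move=> mA; exact: integrableS ih.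
have fin_add k (F : nat -> set S) : (forall i, measurable (F i)) -> trivIset setT F ->
    nu (\bigcup_(i < k) F i) = \sum_(i < k) nu (F i).
  move=> mF tF; elim: k => [|k ihk]; first by rewrite bigcup_mkord !big_ord0.
  rewrite big_ord_recr/= -ihk !bigcup_mkord big_ord_recr/= nuD//.
    by apply: bigsetU_measurable.
  rewrite -bigcup_mkord setI_bigcupl; apply: bigcup0 => i /= ik.
  apply: contrapT => /eqP/set0P ne; have := tF i k I I ne => ik'.
  by rewrite ik' ltnn in ik.
have nuhle A B : measurable A -> measurable B -> A `<=` B ->
    \int[mu]_(x in A) h x <= \int[mu]_(x in B) h x.
  move=> mA mB AB; rewrite [leLHS]Rintegral_mkcond [leRHS]Rintegral_mkcond.
  apply: le_Rintegral => //.
  - by rewrite -restrict_EFin -integrable_mkcond//; exact: ihA.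
  - by rewrite -restrict_EFin -integrable_mkcond//; exact: ihA.
  - move=> x _; rewrite !patchE; case: ifPn => [/set_mem/AB xB|_]; first by rewrite mem_set.
    by case: ifP.
split.
- move=> F mF tF.
  have mfin k : measurable (\bigcup_(i < k) F i) by exact: bigcup_measurable.
  have mU : measurable (\bigcup_i F i) by exact: bigcupT_measurable.
  apply/cvgrPdist_le => e e0.
  have /cvgrPdist_le /(_ _ e0) := integral_tail_cvg0 h0 ih mF tF.
  apply: filterS => k; rewrite sub0r normrN => hk.
  rewrite -fin_add//.
  have -> : nu (\bigcup_i F i) = nu (\bigcup_(i < k) F i) + nu (\bigcup_i F i `\` \bigcup_(i < k) F i).
    rewrite -nuD//.
    + by congr nu; rewrite setDUK// => x [i _ Fi]; exists i.
    + exact: measurableD.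
    + by rewrite setDE setIA setIAC setICr set0I.
  rewrite addrC addKr (le_trans (nuh _ _))//; first exact: measurableD.
  by rewrite (le_trans _ hk)// ler_norm.
- apply: (@le_lt_trans _ _ (\int[mu]_x h x)%:E); last exact: ltry.
  apply: ge_ereal_sup => _ [k [F [mF tF FT ->]]]; rewrite lee_fin.
  apply: (@le_trans _ _ (\sum_(i < k) \int[mu]_(x in F i) h x)).
    by apply: ler_sum => i _; exact: nuh.
  pose G i x : R := h x * \1_(F i) x.
  have iG i : mu.-integrable setT (EFin \o G i).
    apply: (le_integrable_real measurableT _ ih).
      by apply: measurable_funM; [have /integrable_realP[] := ih|exact: measurable_indic].
    by move=> x _; rewrite normrM !ger0_norm// ler_piMr// indicE lern1 leq_b1.
  have [isum sumE] := Rintegral_sum (index_enum 'I_k) measurableT iG.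
  have -> : \sum_(i < k) \int[mu]_(x in F i) h x = \sum_(i < k) \int[mu]_x G i x.
    apply: eq_bigr => i _; rewrite [LHS]Rintegral_mkcond; apply: eq_Rintegral => x _.
    by rewrite patchE /G indicE; case: ifP; rewrite ?mulr1 ?mulr0.
  rewrite -sumE; apply: le_Rintegral => // x _.
  have [i _ Fi] : (\bigcup_i F i) x by rewrite FT.
  rewrite (bigD1 i)//= {1}/G indicE mem_set// mulr1 big1 ?addr0// => j ji.
  rewrite /G indicE memNset ?mulr0// => Fj; move/eqP: ji; apply.
  by apply: (tF j i) => //; exists x.
- move=> A mA A0; apply/eqP; rewrite -normr_le0 (le_trans (nuh _ mA))//.
  suff -> : \int[mu]_(x in A) h x = 0 by [].
  by rewrite /Rintegral (null_set_integral mA (measurable_int _ (ihA A mA)) A0).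
Qed.

End dominated_set_functions.

Section test_function_facts.
Context {R : realType} {n : nat}.
Local Notation E := 'rV[R]_n.+1.
Local Notation L := (lebesgue_space R n).
Local Notation mu := (@lebesgue_Rn R n).
Implicit Types (Omega : set E) (phi : E -> R).

Lemma test_function_continuous Omega phi : test_function Omega phi -> continuous phi.
Proof. by move=> [sm _ _]; have [] := sm [::]. Qed.

Lemma test_function_partial_continuous Omega phi j : test_function Omega phi -> continuous (partial j phi).
Proof. by move=> [sm _ _]; have [] := sm [:: j]. Qed.

Lemma bounded_of_compact_support (K : set E) phi : compact K -> continuous phi ->
  (forall x, ~ K x -> phi x = 0) -> exists2 M, 0 <= M & forall x, `|phi x| <= M.
Proof.
move=> cK cphi phi0.
have /compact_bounded[M0 [_ M0K]] : compact (phi @` K).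
  by apply: continuous_compact => //; exact: continuous_subspaceT.
exists (`|M0| + 1); first by rewrite addr_ge0.
move=> x; have [Kx|/phi0 ->] := pselect (K x); last by rewrite normr0 addr_ge0.
apply: (M0K (`|M0| + 1)); last by exists x.
by rewrite (le_lt_trans (ler_norm _))// ltrDl.
Qed.

Lemma test_function_support Omega phi : test_function Omega phi ->
  exists K, [/\ compact K, K `<=` Omega,
    forall x, ~ K x -> phi x = 0 & forall x j, ~ K x -> partial j phi x = 0].
Proof.
move=> [sm cK KO]; eexists; split; [exact: cK|exact: KO| |].
  move=> x nKx; apply: contrapT => /eqP phix; apply: nKx.
  exact: subset_closure.
move=> x j nKx; rewrite /partial -(@derive_cst R E R^o 0 x (delta_mx ord0 j)).
apply: near_eq_derive.
have : \forall y \near x, (~` closure [set x | phi x != 0]) y.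
  by apply: open_nbhs_nbhs; split=> //; apply: closed_openC; exact: closed_closure.
apply: filterS => y ny; apply: contrapT => /eqP phiy; apply: ny.
exact: subset_closure.
Qed.

Lemma compact_integral_lty (V : normedModType R) Omega (u : E -> V) (a : E -> R) (K : set E) (M : R) :
  open Omega -> L1_loc Omega u -> compact K -> K `<=` Omega -> 0 <= M ->
  continuous a -> (forall x, `|a x| <= M) -> (forall x, ~ K x -> a x = 0) ->
  strongly_measurable mu Omega (fun x => a x *: u x) /\
  (\int[mu]_(x in Omega) `|a x *: u x|%:E < +oo)%E.
Proof.
move=> oO [su iu] cK KO M0 ca aM a0.
have mO : measurable (Omega : set L) by exact: open_lebesgue_measurable.
have mK : measurable (K : set L) by exact: compact_lebesgue_measurable.
have sau : strongly_measurable mu Omega (fun x => a x *: u x).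
  apply: strongly_measurableZ => //; apply: measurable_strongly_measurable => //.
  by apply: measurable_funTS; exact: continuous_lebesgue_measurable.
split=> //.
have mau := strongly_measurable_norm lebesgue_complete mO sau.
have mu_ := strongly_measurable_norm lebesgue_complete mO su.
have -> : (\int[mu]_(x in Omega) `|a x *: u x|%:E = \int[mu]_(x in K) `|a x *: u x|%:E)%E.
  rewrite -[in RHS](setIidr KO) integral_mkcondr; apply: eq_integral => x _.
  rewrite patchE; case: ifPn => // /negP; rewrite inE => /a0 ->.
  by rewrite scale0r normr0.
have mKau : measurable_fun (K : set L) (fun x : L => (`|a x *: u x|)%:E).
  by apply/measurable_EFinP; exact: (measurable_funS mO KO mau).
have mKu : measurable_fun (K : set L) (fun x : L => (`|u x|)%:E).
  by apply/measurable_EFinP; exact: (measurable_funS mO KO mu_).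
have mKMu : measurable_fun (K : set L) (fun x : L => (M%:E * (`|u x|)%:E)%E).
  exact: (measurable_funeM M%:E mKu).
apply: (@le_lt_trans _ _ (\int[mu]_(x in K) (M%:E * `|u x|%:E))%E).
  apply: (ge0_le_integral _ mK _ mKau mKMu) => x _; rewrite lee_fin//.
  by rewrite normrZ ler_wpM2r.
rewrite (ge0_integralZl_EFin _ mK _ mKu M0)//.
by rewrite lte_mul_pinfty// iu.
Qed.

(** Products with a test function or its derivative are Bochner integrable because they are bounded
    multiples of [u] and [w] on a compact set; the vector identity is then equivalent to its images
    under functionals. *)
Lemma weak_partialP (V : completeNormedModType R) Omega j (u w : E -> V) : open Omega ->
  weak_partial Omega j u w <->
  [/\ L1_loc Omega u, L1_loc Omega w &
    forall (f : {linear V -> R^o}) phi, (forall x, `|f x| <= `|x|) -> test_function Omega phi ->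
      \int[mu]_(x in Omega) (phi x * f (w x)) =
      - \int[mu]_(x in Omega) (partial j phi x * f (u x))].
Proof.
move=> oO; have mO : measurable (Omega : set L) by exact: open_lebesgue_measurable.
have cmu : measure_is_complete mu by exact: lebesgue_complete.
have fE (f : {linear V -> R^o}) (a : E -> R) (v : E -> V) :
    \int[mu]_(x in Omega) (f (a x *: v x)) = \int[mu]_(x in Omega) (a x * f (v x)).
  by apply: eq_Rintegral => x _; rewrite linearZ.
split=> [[lu lw h]|[lu lw h]]; split=> //.
  move=> f phi f1 tphi; have [v bu bw] := h phi tphi.
  have [_ _ hu] := (is_bochner_integralP _ _ cmu mO).1 bu.
  have [_ _ hw] := (is_bochner_integralP _ _ cmu mO).1 bw.
  by rewrite -!fE -hu// -hw// linearN.
move=> phi tphi; have [K [cK KO p0 dp0]] := test_function_support tphi.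
have cp := test_function_continuous tphi.
have cdp := @test_function_partial_continuous _ _ j tphi.
have [M M0 pM] := bounded_of_compact_support cK cp p0.
have [M' M'0 dpM] := bounded_of_compact_support cK cdp (fun x => dp0 x j).
have [s1 i1] := compact_integral_lty oO lu cK KO M'0 cdp dpM (fun x => dp0 x j).
have [s2 i2] := compact_integral_lty oO lw cK KO M0 cp pM p0.
have [v bu] := bochner_L1_integral_ex cmu mO (conj s1 i1).
exists v => //; apply/is_bochner_integralP => //; split=> // f f1.
have [_ _ hu] := (is_bochner_integralP _ _ cmu mO).1 bu.
by rewrite linearN/= hu// !fE h.
Qed.

(** A functional on R is multiplication by [f 1], so the test with the identity decides all of
    them. *)
Lemma weak_partial_realP Omega j (c d : E -> R^o) : open Omega ->
  weak_partial Omega j c d <->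
  [/\ L1_loc Omega c, L1_loc Omega d &
    forall phi, test_function Omega phi ->
      \int[mu]_(x in Omega) (phi x * d x) = - \int[mu]_(x in Omega) (partial j phi x * c x)].
Proof.
move=> oO; have mO : measurable (Omega : set L) by exact: open_lebesgue_measurable.
have cmu : measure_is_complete mu by exact: lebesgue_complete.
rewrite weak_partialP//; split=> -[lc ld h]; split=> //.
  by move=> phi tphi; apply: (h (idfun : {linear R^o -> R^o}) phi).
move=> f phi f1 tphi.
have fE x : f x = x * f 1 by rewrite -[in LHS](mulr1 x) -[x * 1]/(x *: (1 : R^o)) linearZ.
have [K [cK KO p0 dp0]] := test_function_support tphi.
have cp := test_function_continuous tphi.
have cdp := @test_function_partial_continuous _ _ j tphi.
have [M M0 pM] := bounded_of_compact_support cK cp p0.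
have [M' M'0 dpM] := bounded_of_compact_support cK cdp (fun x => dp0 x j).
have [s1 i1] := compact_integral_lty oO lc cK KO M'0 cdp dpM (fun x => dp0 x j).
have [s2 i2] := compact_integral_lty oO ld cK KO M0 cp pM p0.
under eq_Rintegral do rewrite fE mulrA.
under [in RHS]eq_Rintegral do rewrite fE mulrA.
have cid : continuous (id : R^o -> R) by move=> x; exact: cvg_id.
have m1 := strongly_measurable_measurable_comp cmu mO cid s1.
have m2 := strongly_measurable_measurable_comp cmu mO cid s2.
rewrite !RintegralZr//; first by rewrite h// mulNr.
- by apply/integrable_realP.
- by apply/integrable_realP.
Qed.

End test_function_facts.

(** * From the Radon-Nikodym property to weak derivatives *)

(** Since 0 is its own inverse here, the set where 1/f > a is {f > 0 and a f < 1} for a >= 0, and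
    everything for a < 0. *)
Lemma ge0_measurable_fun_inv d (S : measurableType d) (R : realType) (f : S -> R) :
  measurable_fun setT f -> (forall x, 0 <= f x) -> measurable_fun setT (fun x => (f x)^-1).
Proof.
move=> mf f0; apply: (measurability _ (RGenOInfty.measurableE R)) => _ [_ [a ->] <-].
rewrite setTI; have [a0|a0] := ltP a 0.
  rewrite (_ : _ @^-1` _ = setT)//; apply/seteqP; split=> // x _ /=.
  by rewrite in_itv/= andbT (lt_le_trans a0)// invr_ge0.
rewrite (_ : _ @^-1` _ = f @^-1` `]0, +oo[%classic `&` (fun x => a * f x) @^-1` `]-oo, 1[%classic).
  apply: measurableI; rewrite -[X in measurable X]setTI; first exact: mf.
  by apply: (measurable_funM (measurable_cst a) mf).
apply/seteqP; split => x /=; rewrite !in_itv/= !andbT.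
  move=> afx; have fx : 0 < f x by rewrite -invr_gt0 (le_lt_trans a0).
  by split=> //; rewrite -ltr_pdivlMr// mul1r.
by move=> [fx afx]; rewrite -[X in _ < X]mul1r ltr_pdivlMr.
Qed.

Section represented_functionals.
Context d (S : measurableType d) (R : realType) (mu : {measure set S -> \bar R}).
Context (V : completeNormedModType R) (G : S -> R) (D : {linear V -> R^o} -> S -> R).
Context (mG : measurable_fun setT G).
Context (G0 : forall x, 0 <= G x).
Context (DP : forall f : {linear V -> R^o}, (forall v, `|f v| <= `|v|) ->
  measurable_fun setT (D f) /\ forall x, `|D f x| <= G x).

(* [D f] stands for the weak derivative of [<f, u>]; then [represented h v] says
   that [v] plays the role of the integral of [h] times the derivative of [u]. *)
Definition represented (h : S -> R) (v : V) := forall f : {linear V -> R^o}, (forall v, `|f v| <= `|v|) ->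
  f v = \int[mu]_x (h x * D f x).

Definition dominated (h : S -> R) := measurable_fun setT h /\
  mu.-integrable setT (EFin \o (fun x => h x * G x)).

Lemma le_dominated (h h' : S -> R) : measurable_fun setT h -> dominated h' ->
  (forall x, `|h x| <= h' x) -> dominated h.
Proof.
move=> mh [_ ih'] hh'; split=> //.
apply: (le_integrable_real measurableT _ ih'); first exact: measurable_funM.
by move=> x _; rewrite normrM (ger0_norm (G0 x)) ler_wpM2r.
Qed.

Lemma dominated_normr (h : S -> R) : dominated h -> dominated (fun x => `|h x|).
Proof.
move=> dh; have [mh ih] := dh; split; first exact: measurableT_comp.
apply: (eq_integrable_real _ (integrable_real_norm measurableT ih)) => x /=.
by rewrite normrM (ger0_norm (G0 x)).
Qed.

Lemma dominatedMD (a : R) (h k : S -> R) : dominated h -> dominated k ->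
  dominated (fun x => a * h x + k x).
Proof.
move=> [mh ih] [mk ik]; split.
  by apply: measurable_funD => //; exact: measurable_funM.
apply: (eq_integrable_real _ (integrable_realD measurableT (integrable_realZ a measurableT ih) ik)) => x /=.
by rewrite mulrDl mulrA.
Qed.

Lemma integrable_mulD (h : S -> R) (f : {linear V -> R^o}) : (forall v, `|f v| <= `|v|) ->
  dominated h -> mu.-integrable setT (EFin \o (fun x => h x * D f x)).
Proof.
move=> f1 dh; have [mh ih] := dh; have [mD leD] := DP f1.
apply: (le_integrable_real measurableT _ (integrable_real_norm measurableT ih)).
  exact: measurable_funM.
by move=> x _ /=; rewrite !normrM ler_wpM2l// (le_trans (leD x))// ler_norm.
Qed.

Lemma represented_le (h : S -> R) v : dominated h -> represented h v ->
  `|v| <= \int[mu]_x (`|h x| * G x).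
Proof.
move=> dh hv; apply: norm_le_functional => f f1; rewrite hv//.
have [mD leD] := DP f1; have [mh _] := dh.
have [_ ih] := dominated_normr dh.
apply: le_normr_Rintegral_dom => //; first exact: measurable_funM.
by move=> x _; rewrite normrM ler_wpM2l.
Qed.

Lemma representedMD (a : R) (h k : S -> R) v w : dominated h -> dominated k ->
  represented h v -> represented k w -> represented (fun x => a * h x + k x) (a *: v + w).
Proof.
move=> dh dk hv kw f f1; rewrite linearP/= hv// kw//.
rewrite /GRing.scale/= -RintegralZl//; last exact: integrable_mulD.
rewrite -RintegralD//; [|exact/integrable_realZ/integrable_mulD|exact: integrable_mulD].
by apply: eq_Rintegral => x _; rewrite mulrDl mulrA.
Qed.

(** The bound of [represented_le] holds in the norm of [V], so dominated convergence of the weights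
    makes the representing vectors Cauchy. Their limit lies in [V] by completeness and represents
    the limit weight. *)
Lemma represented_limit (h_ : nat -> S -> R) (h H : S -> R) : dominated H ->
  (forall k, measurable_fun setT (h_ k)) -> measurable_fun setT h ->
  (forall k x, `|h_ k x| <= H x) -> (forall x, `|h x| <= H x) ->
  {ae mu, forall x, h_ ^~ x @ \oo --> h x} ->
  (forall k, exists v, represented (h_ k) v) -> exists v, represented h v.
Proof.
move=> dH mh_ mh hH hleH hc /choice[v vP].
have dh k : dominated (h_ k) by exact: le_dominated dH _.
have [mH iH] := dH.
have i2H : mu.-integrable setT (EFin \o (fun x => 2 * (H x * G x))) by exact: integrable_realZ.
have H0 x : 0 <= H x by exact: le_trans (hH 0%N x).
have [||||_ cd] := @dominated_Rintegral _ _ _ mu setT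
    (fun k x => `|h_ k x - h x| * G x) (cst 0) (fun x => 2 * (H x * G x)) measurableT _ _ i2H.
- move=> k; apply: measurable_funM => //; apply: measurableT_comp => //.
  exact: measurable_funB.
- exact: measurable_cst.
- apply: filterS hc => x hx _; rewrite -[X in _ --> X](mul0r (G x)).
  apply: cvgM; last exact: cvg_cst.
  by rewrite -(normr0 R) -(subrr (h x)); apply: cvg_norm; apply: cvgB => //; exact: cvg_cst.
- apply: filterS hc => x hx _ k; rewrite normrM normr_id (ger0_norm (G0 x)) mulrA ler_wpM2r//.
  by rewrite (le_trans (ler_normB _ _))// mulr2n mulrDl mul1r lerD.
have /cvg_ex[V0 V0P] : cvgn v.
  apply: cauchy_sequence_cvg => e e0.
  move/cvgrPdist_lt : cd => /(_ (e / 2)); rewrite divr_gt0// => /(_ isT)[K _ HK].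
  exists K => k l /HK + /HK; rewrite Rintegral_cst// mul0r !sub0r !normrN => hk hl.
  have rkl : represented (fun x => -1 * h_ l x + h_ k x) (-1 *: v l + v k) by exact: representedMD.
  have := represented_le (dominatedMD (-1) (dh l) (dh k)) rkl.
  rewrite scaleN1r addrC => /le_lt_trans; apply.
  have iF i : mu.-integrable setT (EFin \o (fun x => `|h_ i x - h x| * G x)).
    have dd := dominatedMD (-1) (le_dominated mh dH hleH) (dh i).
    have [_ id] := dominated_normr dd.
    by apply: (eq_integrable_real _ id) => x /=; rewrite mulN1r addrC.
  apply: (@le_lt_trans _ _ (\int[mu]_x (`|h_ k x - h x| * G x + `|h_ l x - h x| * G x))).
    have [_ id] := dominated_normr (dominatedMD (-1) (dh l) (dh k)).
    apply: le_Rintegral => //; first exact: integrable_realD.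
    move=> x _; rewrite -mulrDl ler_wpM2r// mulN1r addrC.
    have -> : h_ k x - h_ l x = (h_ k x - h x) - (h_ l x - h x) by ring.
    exact: ler_normB.
  rewrite RintegralD//.
  have := le_lt_trans (ler_norm _) hk; have := le_lt_trans (ler_norm _) hl; lra.
exists V0 => f f1.
apply: (@cvg_unique _ (@Rhausdorff R) (f (v k) @[k --> \oo])).
  by apply: continuous_cvg => //; exact: le1_functional_continuous.
have -> : (fun k => f (v k)) = (fun k => \int[mu]_x (h_ k x * D f x)).
  by apply/funext => k; exact: vP.
have [mD leD] := DP f1.
have [] := @dominated_Rintegral _ _ _ mu setT
    (fun k x => h_ k x * D f x) (fun x => h x * D f x) (fun x => H x * G x) measurableT _ _ iH => //.
- by move=> k; exact: measurable_funM.
- exact: measurable_funM.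
- by apply: filterS hc => x hx _; apply: cvgM => //; exact: cvg_cst.
- by apply: aeW => x _ k; rewrite normrM ler_pM.
Qed.

(** [G] is integrable on each [B k] but perhaps not globally. The weight is given together with its
    partial sums because representing vectors are known only on the separate sets [B k], and weights
    on their union have to be reached as limits. *)
Lemma summable_weight (B : nat -> set S) : (forall k, measurable (B k)) ->
  (forall k, (\int[mu]_(x in B k) (G x)%:E < +oo)%E) ->
  exists (a : nat -> R) (rho : S -> R), [/\ dominated rho,
    forall N x, 0 <= \sum_(k < N) a k * \1_(B k) x <= rho x,
    forall x, \sum_(k < N) a k * \1_(B k) x @[N --> \oo] --> rho x &
    forall x k, B k x -> 0 < rho x].
Proof.
move=> mB iB.
pose c k := fine (\int[mu]_(x in B k) (G x)%:E).
have c0 k : 0 <= c k by apply: fine_ge0; apply: integral_ge0 => x _; rewrite lee_fin.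
have cE k : (\int[mu]_(x in B k) (G x)%:E = (c k)%:E)%E.
  by rewrite fineK// ge0_fin_numE//; apply: integral_ge0 => x _; rewrite lee_fin.
(* The factor 2^-(k+1) makes the weights sum to at most 1; the denominator bounds the contribution
   of [B k] to the integral of [rho] times [G] by 2^-(k+1). *)
pose a k : R := (1 / (2 ^ k.+1)%:R) / (1 + c k).
have a0 k : 0 < a k by rewrite !divr_gt0// ?ltr0n ?expn_gt0// ltr_pwDl.
have ale k : a k <= 1 / (2 ^ k.+1)%:R.
  by rewrite /a ler_pdivrMr ?ltr_pwDl// ler_peMr ?divr_ge0// lerDl.
pose s N x := \sum_(k < N) a k * \1_(B k) x.
have s0 N x : 0 <= s N x by apply: sumr_ge0 => k _; rewrite mulr_ge0// ltW.
have snd x : nondecreasing_seq (s ^~ x).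
  by apply/nondecreasing_seqP => N; rewrite /s big_ord_recr/= lerDl mulr_ge0// ltW.
have sle1 N x : s N x <= 1.
  apply: (@le_trans _ _ (\sum_(k < N) (1 / (2 ^ k.+1)%:R))).
    apply: ler_sum => k _; apply: le_trans (ale k).
    by rewrite ler_piMr// ?ltW// indicE lern1 leq_b1.
  have -> : \sum_(k < N) (1 / (2 ^ k.+1)%:R) = 1 - 1 / (2 ^ N)%:R :> R.
    elim: N => [|N ih]; first by rewrite big_ord0 expn0 divr1 subrr.
    rewrite big_ord_recr/= ih expnS natrM.
    by field; rewrite pnatr_eq0 expn_eq0.
  by rewrite gerBl divr_ge0.
pose rho x := sup (range (s ^~ x)).
have hub x : has_ubound (range (s ^~ x)) by exists 1 => _ [N _ <-].
have srho x : s N x @[N --> \oo] --> rho x by exact: nondecreasing_cvgn.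
have sle N x : s N x <= rho x by apply: ub_le_sup => //; exists N.
have ms N : measurable_fun setT (s N).
  apply: measurable_sum => k; apply: measurable_funM; first exact: measurable_cst.
  exact: measurable_indic.
have mrho : measurable_fun setT rho.
  by apply: (measurable_fun_cvg ms) => x _; exact: srho.
exists a, rho; split.
- split=> //; apply/integrable_realP; split; first exact: measurable_funM.
  have r0 x : 0 <= rho x by exact: le_trans (s0 0%N x) (sle _ x).
  under eq_integral do rewrite ger0_norm ?mulr_ge0//.
  pose F k x := (a k * \1_(B k) x * G x)%:E.
  have -> : (fun x => (rho x * G x)%:E) = (fun x => \sum_(0 <= k <oo) F k x)%E.
    apply/funext => x; apply/esym/cvg_lim => //.
    have -> : (fun N => \sum_(0 <= k < N) F k x)%E = (fun N => (s N x * G x)%:E).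
      by apply/funext => N; rewrite /F sumEFin /s big_mkord mulr_suml.
    by apply/fine_cvgP; split; [exact: nearW|apply: cvgM; [exact: srho|exact: cvg_cst]].
  rewrite integral_nneseries//; last 2 first.
    move=> k; apply/measurable_EFinP; apply: measurable_funM => //.
    by apply: measurable_funM; [exact: measurable_cst|exact: measurable_indic].
    by move=> k x _; rewrite /F lee_fin; apply: mulr_ge0 => //; apply: mulr_ge0 => //; exact: ltW.
  apply: (@le_lt_trans _ _ (1%:E)); last exact: ltry.
  apply: (@le_trans _ _ (\sum_(0 <= k <oo) (1 / (2 ^ k.+1)%:R)%:E)%E).
    apply: lee_nneseries => [k _ _|k _].
      by apply: integral_ge0 => x _; rewrite /F lee_fin; apply: mulr_ge0 => //; apply: mulr_ge0 => //; exact: ltW.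
    have -> : (\int[mu]_x F k x = (a k)%:E * \int[mu]_(x in B k) (G x)%:E)%E.
      rewrite -ge0_integralZl_EFin//; last 3 first.
        by move=> x _; rewrite lee_fin.
        by apply/measurable_EFinP; exact: measurable_funTS.
        exact: ltW.
      rewrite [RHS]integral_mkcond; apply: eq_integral => x _.
      rewrite patchE /F indicE; case: ifP => _; first by rewrite mulr1 EFinM.
      by rewrite mulr0 mul0r.
    rewrite cE -EFinM lee_fin /a.
    have p0 : 0 <= 1 / (2 ^ k.+1)%:R :> R by rewrite divr_ge0.
    move: (1 / (2 ^ k.+1)%:R) p0 => p p0; rewrite -mulrA; apply: ler_piMr => //.
    by rewrite mulrC ler_pdivrMr ?ltr_pwDl// mul1r lerDr.
  exact: epsilon_trick0.
- by move=> N x; rewrite s0 sle.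
- exact: srho.
- move=> x k Bk; apply: lt_le_trans (sle k.+1 x).
  rewrite /s big_ord_recr/= indicE mem_set// mulr1; apply: ltr_wpDl => //.
  exact: s0.
Qed.

(* The Radon-Nikodym density of [A |-> int_A rho D] is divided by the weight
   [rho], which only serves to make the vector measure finite. *)
Lemma represented_density (B : nat -> set S) : radon_nikodym_property V ->
  measure_is_complete mu -> sigma_finite setT mu ->
  (forall k, measurable (B k)) ->
  (forall k, (\int[mu]_(x in B k) (G x)%:E < +oo)%E) ->
  (forall x, ~ (\bigcup_k B k) x -> G x = 0) ->
  (forall k A, measurable A -> exists v, represented \1_(A `&` B k) v) ->
  exists w : S -> V, strongly_measurable mu setT w /\
    forall f : {linear V -> R^o}, (forall v, `|f v| <= `|v|) ->
      {ae mu, forall x, f (w x) = D f x}.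
Proof.
move=> rnp cmu sf mB iB GB rB.
have [a [rho [drho srho crho rho0]]] := summable_weight mB iB.
have [mrho irho] := drho.
have r0 x : 0 <= rho x.
  by have /andP[h1 h2] := srho 0%N x; exact: le_trans h1 h2.
have rle1 A x : `|rho x * \1_A x| <= rho x.
  by rewrite normrM !ger0_norm// ler_piMr// indicE lern1 leq_b1.
have mrA A : measurable A -> measurable_fun setT (fun x => rho x * \1_A x).
  by move=> mA; apply: measurable_funM => //; exact: measurable_indic.
have drA A : measurable A -> dominated (fun x => rho x * \1_A x).
  by move=> mA; exact: (le_dominated (mrA A mA) drho (rle1 A)).
have H A : exists v, measurable A -> represented (fun x => rho x * \1_A x) v.
  have [mA|] := pselect (measurable A); last by exists 0.
  (* The partial sums of the weight, cut down to [A]: finite combinations of represented indicators,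
     dominated by [rho]. *)
  pose h_ N x := \sum_(k < N) a k * \1_(A `&` B k) x.
  have hE N x : h_ N x = (\sum_(k < N) a k * \1_(B k) x) * \1_A x.
    rewrite /h_ mulr_suml; apply: eq_bigr => k _; rewrite -mulrA; congr (_ * _).
    by rewrite !indicE in_setI; case: (x \in A); case: (x \in B k); rewrite ?mulr1 ?mulr0.
  have mh N : measurable_fun setT (h_ N).
    apply: measurable_sum => k; apply: measurable_funM; first exact: measurable_cst.
    by apply: measurable_indic; exact: measurableI.
  have hle N x : `|h_ N x| <= rho x.
    have /andP[p1 p2] := srho N x.
    rewrite hE normrM !ger0_norm//; apply: le_trans p2.
    by rewrite ler_piMr// indicE lern1 leq_b1.
  have [v vP] : exists v, represented (fun x => rho x * \1_A x) v; last by exists v.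
  apply: (represented_limit drho mh (mrA A mA) hle (rle1 A)).
    apply: aeW => x; rewrite (_ : h_ ^~ x = fun N => (\sum_(k < N) a k * \1_(B k) x) * \1_A x).
      by apply: cvgM; [exact: crho|exact: cvg_cst].
    by apply/funext => N; exact: hE.
  elim=> [|N [v ih]].
    exists 0 => f f1; rewrite linear0; under eq_Rintegral do rewrite /h_ big_ord0 mul0r.
    by rewrite Rintegral_cst// mul0r.
  have [v' v'P] := rB N A mA.
  have dN : dominated (h_ N) by exact: (le_dominated (mh N) drho (hle N)).
  have mAB : measurable (A `&` B N) by exact: measurableI.
  have dA : dominated \1_(A `&` B N).
    split; first exact: measurable_indic.
    apply/integrable_realP; split.
      by apply: measurable_funM => //; exact: measurable_indic.
    apply: le_lt_trans (iB N); rewrite [leRHS]integral_mkcond.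
    apply: ge0_le_integral => //=.
    - apply/measurable_EFinP; apply: measurableT_comp => //.
      by apply: measurable_funM => //; exact: measurable_indic.
    - apply/(measurable_restrictT _ (mB N)); apply/measurable_EFinP; exact: measurable_funTS.
    - move=> x _; rewrite patchE normrM (ger0_norm (G0 x)) indicE in_setI.
      case: (x \in A); case: ifP => xB; rewrite /= ?normr1 ?normr0 ?mul1r ?mul0r ?lee_fin//.
  exists (a N *: v' + v).
  have := representedMD (a N) dA dN v'P ih; congr represented.
  by apply/funext => x; rewrite /h_ big_ord_recr/= addrC.
have [nu nuP] := choice H.
have rG0 x : 0 <= rho x * G x by exact: mulr_ge0.
have nuD A A' : measurable A -> measurable A' -> A `&` A' = set0 ->
    nu (A `|` A') = nu A + nu A'.
  move=> mA mA' AA'; apply: functional_sep => f f1.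
  rewrite linearD/= (nuP _ (measurableU _ _ mA mA') f f1) (nuP _ mA f f1) (nuP _ mA' f f1).
  rewrite -RintegralD//; [|exact: (integrable_mulD f1 (drA _ mA))|exact: (integrable_mulD f1 (drA _ mA'))].
  apply: eq_Rintegral => x _; rewrite -mulrDl -mulrDr; congr (_ * _ * _).
  rewrite !indicE in_setU; have := AA'; move=> /seteqP[/(_ x) h _].
  case: (boolP (x \in A)) => xA; case: (boolP (x \in A')) => xA'; rewrite ?addr0 ?add0r//.
  by exfalso; apply: h; split; apply/set_mem.
have nule A : measurable A -> `|nu A| <= \int[mu]_(x in A) (rho x * G x).
  move=> mA; apply: le_trans (represented_le (drA _ mA) (nuP _ mA)) _.
  rewrite [leRHS]Rintegral_mkcond le_eqVlt; apply/orP; left; apply/eqP.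
  apply: eq_Rintegral => x _; rewrite patchE normrM (ger0_norm (r0 x)) indicE.
  by case: ifP => _; rewrite ?normr1 ?mulr1// normr0 mulr0 mul0r.
have [vm var ac] := dominated_additive_measure rG0 irho nuD nule.
have [w [[sw _] hw]] := rnp _ _ mu nu sf cmu vm var ac.
exists (fun x => (rho x)^-1 *: w x); split.
  apply: strongly_measurableZ => //; apply: measurable_strongly_measurable => //.
  exact: ge0_measurable_fun_inv.
move=> f f1.
have [mD leD] := DP f1.
have iD := integrable_mulD f1 drho.
have mfw : measurable_fun setT (f \o w).
  exact: (@strongly_measurable_measurable_comp _ _ _ mu V setT w f cmu measurableT
    (le1_functional_continuous f1) sw).
have : ae_eq mu setT (EFin \o (fun x => rho x * D f x)) (EFin \o (f \o w)).
  apply: integral_ae_eq => //; first exact/measurable_EFinP.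
  move=> A _ mA.
  have [iw fw] := is_bochner_integral_functional cmu mA (hw A mA).
  have ifw : mu.-integrable A (EFin \o (f \o w)).
    apply/integrable_realP; split; first exact: measurable_funTS.
    apply: le_lt_trans iw; apply: ge0_le_integral => //=.
    - by apply/measurable_EFinP; apply: measurableT_comp => //; exact: measurable_funTS.
    - apply/measurable_EFinP; apply: (strongly_measurable_norm cmu mA).
      exact: strongly_measurableS sw.
    - by move=> x _; rewrite lee_fin; exact: f1.
  have iDA : mu.-integrable A (EFin \o (fun x => rho x * D f x)) by exact: integrableS iD.
  rewrite -[LHS]fineK; last exact: integrable_fin_num.
  rewrite -[RHS]fineK; last exact: integrable_fin_num.
  congr EFin; have := fw f f1; rewrite /Rintegral /= => <-.
  rewrite (nuP A mA f f1) -/(Rintegral _ _ _) [LHS]Rintegral_mkcond; apply: eq_Rintegral => x _.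
  by rewrite patchE indicE; case: ifP => _; rewrite ?mulr1// mulr0 mul0r.
apply: filterS => x /(_ I) /= [hx].
rewrite linearZ/= -hx /GRing.scale/=.
(* Where [rho] vanishes the point lies in no [B k], so [G] and with it every [D f] vanish, in
   agreement with the convention 1/0 = 0. *)
have [rx|rx] := eqVneq (rho x) 0; last by rewrite mulrA mulVf// mul1r.
rewrite rx invr0 mul0r; apply/esym/eqP; rewrite -normr_le0.
rewrite (le_trans (leD x))// GB// => -[k _ Bk].
by have := rho0 x k Bk; rewrite rx ltxx.
Qed.

End represented_functionals.

Section test_density.
Context {R : realType} {n : nat}.
Local Notation E := 'rV[R]_n.+1.
Local Notation L := (lebesgue_space R n).
Local Notation mu := (@lebesgue_Rn R n).

(** This is [obox_density] with its hypothesis on boxes derived from the smooth bumps, whose limits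
    are box indicators; a box with reversed or equal ends is empty, and there [P (fun=> 0)] is
    used. *)
Lemma test_density (Omega : set E) (p : E * E) (P : (E -> R) -> Prop) : cbox p `<=` Omega ->
  P (fun=> 0) ->
  (forall phi, test_function Omega phi -> (forall x, `|phi x| <= \1_(obox p) x) -> P phi) ->
  (forall (a : R) f g, P f -> P g -> P (fun x => a * f x + g x)) ->
  (forall (f_ : nat -> E -> R) f, (forall k, P (f_ k)) ->
    (forall k, measurable_fun setT (f_ k : L -> R)) -> measurable_fun setT (f : L -> R) ->
    (forall k x, `|f_ k x| <= \1_(obox p) x) -> (forall x, `|f x| <= \1_(obox p) x) ->
    {ae mu, forall x : L, f_ ^~ x @ \oo --> f x} -> P f) ->
  forall A, measurable (A : set L) -> P \1_(A `&` obox p).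
Proof.
move=> pO P0 Ptest Plin Plim; apply: obox_density => // q pq.
have [q12|] := pselect (forall i, q.1 ord0 i < q.2 ord0 i); last first.
  move=> /existsNP[i /negP]; rewrite -leNgt => qi.
  rewrite (_ : obox q = set0); first by rewrite indic0.
  apply/seteqP; split=> // x /(_ i) /andP[h1 h2].
  by have := lt_le_trans (lt_trans h1 h2) qi; rewrite ltxx.
have qp : obox q `<=` obox p.
  by move=> x qx i; have /andP[h1 h2] := qx i; have [h3 h4] := pq i;
    rewrite (le_lt_trans h3 h1) (lt_le_trans h2 h4).
have cqO : cbox q `<=` Omega.
  apply: subset_trans pO => x qx i; have /andP[h1 h2] := qx i; have [h3 h4] := pq i.
  by rewrite (le_trans h3 h1) (le_trans h2 h4).
have i1 x : (\1_(obox q) x : R) <= \1_(obox p) x.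
  rewrite !indicE; case: (boolP (x \in obox q)) => // /set_mem/qp xp.
  by rewrite mem_set.
have b1 k x : `|smooth_bump q k x| <= \1_(obox p) x.
  by have /andP[h1 h2] := smooth_bump_itv k x q12; rewrite ger0_norm//; exact: le_trans h2 (i1 x).
have Pb k : P (smooth_bump q k).
  by apply: Ptest (b1 k); exact: smooth_bump_test_function.
have mb k : measurable_fun setT (smooth_bump q k : L -> R).
  apply: continuous_lebesgue_measurable.
  exact: flat_product_continuous (smooth_bump_flat_product q k).
have mq : measurable_fun setT (\1_(obox q) : L -> R).
  by apply: measurable_indic; exact: measurable_obox.
apply: (Plim _ _ Pb mb mq b1) => [x|].
  by rewrite ger0_norm.
by apply: aeW => x; exact: smooth_bump_cvg.
Qed.

End test_density.

Section function_space_facts.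
Context {R : realType} {n : nat} {Omega : set 'rV[R]_n.+1} (X : banach_function_space Omega).
Local Notation E := 'rV[R]_n.+1.
Local Notation L := (lebesgue_space R n).
Local Notation mu := (@lebesgue_Rn R n).
Context (oO : open Omega).

Let mO : measurable (Omega : set L). Proof. exact: open_lebesgue_measurable. Qed.
Let cmu : measure_is_complete mu. Proof. exact: lebesgue_complete. Qed.

Lemma bfs_locally_integrable (g : E -> R) K : bfs_mem X g ->
  {ae mu, forall x, Omega x -> 0 <= g x} -> compact K -> K `<=` Omega ->
  (\int[mu]_(x in K) `|g x|%:E < +oo)%E.
Proof.
move=> Xg g0 cK KO.
have mK : measurable (K : set L) by exact: compact_lebesgue_measurable.
have [C C0 hC] := bfs_L1 X mK KO (lebesgue_compact_lty cK).
apply: le_lt_trans (hC g Xg) _.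
have [||[_ gK] _] := @bfs_ideal _ _ _ X (fun x => g x * \1_K x) g _ Xg.
- have [mg _] := Xg; apply: (measurable_funM mg); exact: measurable_indic.
- apply: (ae_imply g0) => x h Ox; rewrite normrM (ger0_norm (h Ox)) (ger0_norm (ler0n _ _)).
  by rewrite ler_piMr ?h// lern1 leq_b1.
by apply: lte_mul_pinfty => //; rewrite lee_fin ltW.
Qed.

Lemma bochner_bfs_L1_loc (V : normedModType R) (u : E -> V) : bochner_bfs X V u -> L1_loc Omega u.
Proof.
move=> [su Xu]; split=> // K cK KO.
have u0 : {ae mu, forall x : L, Omega x -> 0 <= `|u x|} by apply: aeW.
have := bfs_locally_integrable Xu u0 cK KO.
by under eq_integral do rewrite normr_id.
Qed.

Lemma bfs_mem0 : bfs_mem X (fun=> 0).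
Proof.
have := @bfs_indic _ _ _ X set0 measurable0 (@sub0set _ _); rewrite indic0; apply.
by rewrite measure0.
Qed.

Lemma bfs_memD (f g : E -> R) : bfs_mem X f -> bfs_mem X g -> bfs_mem X (fun x => f x + g x).
Proof.
move=> Xf Xg; have [mf nf] := Xf; have [mg ng] := Xg; split.
  exact: (measurable_funD mf mg).
by apply: le_lt_trans (bfs_normD Xf Xg) _; exact: lte_add_pinfty.
Qed.

Lemma bfs_mem_sum (I : Type) (r : seq I) (F : I -> E -> R) : (forall i, bfs_mem X (F i)) ->
  bfs_mem X (fun x => \sum_(i <- r) F i x).
Proof.
move=> XF; elim: r => [|i r ih].
  by under eq_fun do rewrite big_nil; exact: bfs_mem0.
by under eq_fun do rewrite big_cons; exact: bfs_memD.
Qed.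

Lemma bfs_memZ (c : R) (f : E -> R) : bfs_mem X f -> bfs_mem X (fun x => c * f x).
Proof.
move=> Xf; have [mf nf] := Xf; split.
  exact: (measurable_funM (measurable_cst c) mf).
by rewrite bfs_normZ//; apply: lte_mul_pinfty.
Qed.

Lemma bochner_bfs_le (V : normedModType R) (u : E -> V) (g : E -> R) : strongly_measurable mu Omega u ->
  bfs_mem X g -> {ae mu, forall x, Omega x -> `|u x| <= g x} -> bochner_bfs X V u.
Proof.
move=> su Xg ug; split=> //.
have [] := @bfs_ideal _ _ _ X (fun x => `|u x|) g _ Xg => //.
  exact: (strongly_measurable_norm cmu mO su).
by apply: (ae_imply ug) => x h Ox; rewrite normr_id; exact: h.
Qed.

Lemma grad_norm_le_sum (V : normedModType R) (w : 'I_n.+1 -> E -> V) x :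
  grad_norm w x <= \sum_j `|w j x|.
Proof.
have s0 : 0 <= \sum_j `|w j x| by apply: sumr_ge0.
rewrite -(ler_pXn2r (ltn0Sn 1)) ?nnegrE ?sqrtr_ge0// sqr_sqrtr; last first.
  by apply: sumr_ge0 => j _; exact: sqr_ge0.
elim: (index_enum _) => [|i r ih]; first by rewrite !big_nil expr0n.
rewrite !big_cons sqrrD -addrA lerD2l (le_trans ih)// lerDr mulrn_wge0// mulr_ge0//.
exact: sumr_ge0.
Qed.

Lemma le_grad_norm (V : normedModType R) (w : 'I_n.+1 -> E -> V) j x :
  `|w j x| <= grad_norm w x.
Proof.
rewrite -[leLHS]ger0_norm// -sqrtr_sqr; apply: ler_wsqrtr.
by rewrite (bigD1 j)//= lerDl; apply: sumr_ge0 => i _; exact: sqr_ge0.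
Qed.

Lemma functional_L1_loc (V : normedModType R) (u : E -> V) (f : {linear V -> R^o}) :
  (forall v, `|f v| <= `|v|) -> L1_loc Omega u -> L1_loc Omega (f \o u : E -> R^o).
Proof.
move=> f1 [su iu]; split.
  by apply: strongly_measurable_comp => //; exact: le1_functional_continuous.
move=> K cK KO; apply: (functional_L1 cmu) => //; first exact: compact_lebesgue_measurable.
  exact: strongly_measurableS su.
exact: iu.
Qed.

Lemma functional_weak_partial (V : completeNormedModType R) j (u w : E -> V) (f : {linear V -> R^o}) :
  (forall v, `|f v| <= `|v|) -> weak_partial Omega j u w ->
  weak_partial Omega j (f \o u : E -> R^o) (f \o w).
Proof.
move=> f1 /(weak_partialP _ _ _ oO)[lu lw h]; apply/weak_partial_realP => //; split.
- exact: functional_L1_loc.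
- exact: functional_L1_loc.
- by move=> phi tphi; exact: h.
Qed.

Lemma sobolev_sub_reshetnyak (V : completeNormedModType R) : sobolev X V `<=` reshetnyak_sobolev X V.
Proof.
move=> u [Xu du].
have /choice[w wP] : forall j, exists w, weak_partial Omega j u w /\ bochner_bfs X V w.
  by move=> j; have [w] := du j; exists w.
have Xf (v : E -> V) (f : {linear V -> R^o}) : (forall v, `|f v| <= `|v|) -> bochner_bfs X V v ->
    bochner_bfs X R^o (f \o v).
  move=> f1 [sv Xv]; apply: bochner_bfs_le Xv _.
    by apply: strongly_measurable_comp => //; exact: le1_functional_continuous.
  by apply: aeW => x _; exact: f1.
split=> //.
- move=> f cf /dual_norm_le1P f1; split; first exact: Xf.
  move=> j; have [wj Xwj] := wP j; exists (f \o w j); last exact: Xf.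
  exact: functional_weak_partial.
- exists (fun x => \sum_j `|w j x|); split.
  + by apply: bfs_mem_sum => j; have [_ []] := wP j.
  + by apply: aeW => x _; exact: sumr_ge0.
  move=> f cf /dual_norm_le1P f1; exists (fun j => f \o w j).
    by move=> j; apply: functional_weak_partial => //; have [] := wP j.
  apply: aeW => x _; apply: le_trans (grad_norm_le_sum _ _) _.
  by apply: ler_sum => j _; exact: f1.
Qed.

Lemma reshetnyak_sub_sobolev (V : completeNormedModType R) : radon_nikodym_property V ->
  reshetnyak_sobolev X V `<=` sobolev X V.
Proof.
move=> rnp u [Xu _ [g [Xg g0 hg]]]; split=> // j.
have lu := bochner_bfs_L1_loc Xu.
have [mg _] := Xg.
(* The majorant [g] is nonnegative only almost everywhere and matters only on [Omega]; the absolute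
   value extended by 0 is a bound valid at every point. *)
pose G : L -> R := (fun x => `|g x|) \_ Omega.
have mng : measurable_fun (Omega : set L) (fun x : L => `|g x|).
  exact: (measurableT_comp (@normr_measurable R setT) mg).
have mG : measurable_fun setT G by apply/(measurable_restrictT _ mO).
have G0 x : 0 <= G x by rewrite /G patchE; case: ifP.
have GE x : Omega x -> G x = `|g x| by move=> Ox; rewrite /G patchE mem_set.
have GO x : ~ Omega x -> G x = 0 by move=> Ox; rewrite /G patchE memNset.
have GK K : compact K -> K `<=` Omega -> (\int[mu]_(x in K) (G x)%:E < +oo)%E.
  move=> cK KO; have -> : (\int[mu]_(x in K) (G x)%:E = \int[mu]_(x in K) `|g x|%:E)%E.
    by apply: eq_integral => x /set_mem xK; rewrite GE//; exact: KO.
  exact: bfs_locally_integrable.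
have mtest phi : test_function Omega phi -> measurable_fun (Omega : set L) (phi : L -> R).
  move=> tphi; apply: measurable_funTS; apply: continuous_lebesgue_measurable.
  exact: test_function_continuous tphi.
have DPex (f : {linear V -> R^o}) : exists D : L -> R, (forall v, `|f v| <= `|v|) ->
    [/\ measurable_fun setT D, forall x, `|D x| <= G x & weak_partial Omega j (f \o u : E -> R^o) D].
  have [f1|] := pselect (forall v, `|f v| <= `|v|); last by exists (fun=> 0).
  have [w wp wg] := hg f (le1_functional_continuous f1) ((dual_norm_le1P f).2 f1).
  have /(weak_partial_realP _ _ _ oO)[lfu lw hw] := wp j.
  have cid : continuous (id : R^o -> R) by move=> x; exact: cvg_id.
  have mw : measurable_fun (Omega : set L) (w j : L -> R).
    exact: (strongly_measurable_measurable_comp cmu mO cid lw.1).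
  have mnw : measurable_fun (Omega : set L) (fun x : L => `|w j x|).
    exact: (measurableT_comp (@normr_measurable R setT) mw).
  (* The weak derivative is set to 0 off the set where it obeys the bound. This alters it on a null
     set of [Omega] and makes |D| <= G hold everywhere, as the representation argument requires. *)
  pose A : set L := Omega `&` (fun x => `|w j x| - `|g x|) @^-1` `]-oo, 0]%classic.
  have mA : measurable A by exact: (measurable_funB mnw mng mO (measurable_itv _)).
  have AO : A `<=` Omega by move=> x [].
  pose D : L -> R := (w j : L -> R) \_ A.
  have mD : measurable_fun setT D.
    by apply/(measurable_restrictT _ mA); exact: (measurable_funS mO AO mw).
  have DG x : `|D x| <= G x.
    rewrite /D patchE; case: ifPn => [/set_mem[Ox /=]|_]; last by rewrite normr0.
    by rewrite in_itv/= subr_le0 GE.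
  have Dw : {ae mu, forall x : L, Omega x -> w j x = D x}.
    apply: (ae_imply2 wg g0) => x h1 h2 Ox; rewrite /D patchE mem_set//; split=> //=.
    rewrite in_itv/= subr_le0 (le_trans (le_grad_norm w j x))// (le_trans (h1 Ox))//.
    exact: ler_norm.
  have lD : L1_loc Omega (D : E -> R^o).
    split; first exact: strongly_measurable_ae Dw lw.1.
    move=> K cK KO; apply: le_lt_trans (GK K cK KO).
    have mKD : measurable_fun (K : set L) (fun x : L => (`|D x|)%:E).
      apply/measurable_EFinP; apply: measurable_funTS.
      exact: (measurableT_comp (@normr_measurable R setT) mD).
    have mKG : measurable_fun (K : set L) (EFin \o G).
      by apply/measurable_EFinP; exact: measurable_funTS.
    apply: (ge0_le_integral mu (compact_lebesgue_measurable cK) _ mKD mKG) => x _.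
      by rewrite lee_fin.
    by rewrite lee_fin; exact: DG.
  exists D => _; split=> //; apply/weak_partial_realP => //; split=> // phi tphi.
  rewrite -(hw phi tphi).
  have mphi := mtest phi tphi.
  apply: (ae_eq_Rintegral mO (measurable_funM mphi (measurable_funTS mD)) (measurable_funM mphi mw)).
  by apply: (ae_imply Dw) => x h Ox; rewrite /= (h Ox).
have [D DP] := choice DPex.
have DP' (f : {linear V -> R^o}) : (forall v, `|f v| <= `|v|) ->
    measurable_fun setT (D f) /\ forall x, `|D f x| <= G x.
  by move=> /DP[].
(* The boxes have closures inside [Omega], so [G] is integrable on each of them and bumps supported
   in them are test functions. *)
have [B [OB cB]] := open_cover_obox oO.
have mB k : measurable (obox (B k) : set L) by exact: measurable_obox.
have oB k : obox (B k) `<=` Omega by apply: subset_trans (cB k); exact: obox_sub_cbox.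
have iB k : (\int[mu]_(x in obox (B k)) (G x)%:E < +oo)%E.
  apply: le_lt_trans (GK _ (@compact_cbox _ _ (B k)) (cB k)).
  have mcG : measurable_fun (cbox (B k) : set L) (EFin \o G).
    by apply/measurable_EFinP; exact: measurable_funTS.
  apply: (ge0_subset_integral mu (mB k) (@measurable_cbox _ _ (B k)) mcG) => [x _|].
    by rewrite lee_fin.
  exact: obox_sub_cbox.
have dB k : dominated mu G \1_(obox (B k)).
  split; first exact: measurable_indic.
  apply/integrable_realP; split; first by apply: measurable_funM => //; exact: measurable_indic.
  apply: le_lt_trans (iB k); rewrite [leRHS]integral_mkcond le_eqVlt; apply/orP; left; apply/eqP.
  apply: eq_integral => x _; rewrite patchE normrM (ger0_norm (G0 x)) indicE.
  by case: ifP => _; rewrite ?normr1 ?mul1r// normr0 mul0r.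
have rB k (A : set L) : measurable A -> exists v, represented mu D \1_(A `&` obox (B k)) v.
  move=> mA.
  suff [] : dominated mu G \1_(A `&` obox (B k)) /\ exists v, represented mu D \1_(A `&` obox (B k)) v by [].
  have le0 h : measurable_fun setT (h : L -> R) -> (forall x, `|h x| <= \1_(obox (B k)) x) -> dominated mu G h.
    by move=> mh hB; exact: (le_dominated mG G0 mh (dB k) hB).
  move: A mA; apply: (test_density (P := fun h => dominated mu G h /\ exists v, represented mu D h v) (cB k)).
  - split; first by apply: le0 => // x; rewrite normr0.
    exists 0 => f f1; rewrite linear0; under eq_Rintegral do rewrite mul0r.
    by rewrite Rintegral_cst// mul0r.
  - move=> phi tphi phiB; split.
      by apply: le0 => //; apply: continuous_lebesgue_measurable; exact: test_function_continuous tphi.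
    have [K [cK KO p0 dp0]] := test_function_support tphi.
    have cdp := @test_function_partial_continuous _ _ _ _ j tphi.
    have [M' M'0 dpM] := bounded_of_compact_support cK cdp (fun x => dp0 x j).
    have [s1 i1] := compact_integral_lty oO lu cK KO M'0 cdp dpM (fun x => dp0 x j).
    have [v bv] := bochner_L1_integral_ex cmu mO (conj s1 i1).
    (* Integration by parts puts the derivative on [phi]: [v] is the Bochner integral of
       [partial j phi x *: u x], an element of [V] because [u] is strongly measurable and locally
       integrable. *)
    exists (- v) => f f1.
    have [_ _ /(weak_partial_realP _ _ _ oO)[_ _ hD]] := DP f f1.
    have [_ hv] := is_bochner_integral_functional cmu mO bv.
    rewrite linearN/= hv//.
    under eq_Rintegral do rewrite linearZ.
    rewrite -[LHS](hD phi tphi) [LHS]Rintegral_mkcond; apply: eq_Rintegral => x _.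
    rewrite patchE; case: ifPn => // /negP; rewrite inE => nOx.
    have [_ /(_ x)] := DP' f f1; rewrite GO// => Dx.
    by apply/esym/eqP; rewrite -normr_le0 normrM mulr_ge0_le0.
  - move=> a h h' [dh [v hv]] [dh' [v' hv']]; split; first exact: (dominatedMD a dh dh').
    by exists (a *: v + v'); exact: (representedMD DP' a dh dh' hv hv').
  - move=> h_ h hh mh_ mh hB hB' hc; split; first exact: le0.
    exact: (represented_limit mG G0 DP' (dB k) mh_ mh hB hB' hc (fun k => (hh k).2)).
have GB x : ~ (\bigcup_k obox (B k)) x -> G x = 0 by rewrite -OB; exact: GO.
have [w [sw fw]] := represented_density mG G0 DP' rnp cmu lebesgue_sigma_finite mB iB GB rB.
have swO : strongly_measurable mu Omega w by apply: strongly_measurableS sw => x _.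
(* The common majorant of all [f \o w] bounds the norm of [w], so [w] inherits membership in [X]
   from [g] by the ideal property. *)
have wG : {ae mu, forall x : L, Omega x -> `|w x| <= G x}.
  apply: norm_functional_ae_le => // f f1.
  by apply: (ae_imply (fw f f1)) => x -> _; have [_] := DP' f f1.
have wg : {ae mu, forall x : L, Omega x -> `|w x| <= g x}.
  by apply: (ae_imply2 wG g0) => x h1 h2 Ox; rewrite (le_trans (h1 Ox))// GE// ger0_norm// h2.
have Xw : bochner_bfs X V w by exact: bochner_bfs_le Xg wg.
exists w => //; apply/weak_partialP => //; split=> //; first exact: bochner_bfs_L1_loc.
move=> f phi f1 tphi.
have [mD _ /(weak_partial_realP _ _ _ oO)[_ _ hD]] := DP f f1.
rewrite -[RHS](hD phi tphi).
have mphi := mtest phi tphi.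
have mfw := @strongly_measurable_measurable_comp _ _ _ mu V Omega w f cmu mO (le1_functional_continuous f1) swO.
apply: (ae_eq_Rintegral mO (measurable_funM mphi mfw) (measurable_funM mphi (measurable_funTS mD))).
by apply: (ae_imply (fw f f1)) => x fwx _; rewrite /= fwx.
Qed.

End function_space_facts.

(** * Real densities and variation *)

Section sigma_finite_copy.
Context d (S : measurableType d) (R : realType) (mu : {measure set S -> \bar R}).

(** An alias of [mu] indexed by the proof of sigma-finiteness, so that the bundled structure
    expected by the real Radon-Nikodym theorem can be attached to it. *)
Definition as_sigma_finite (_ : sigma_finite setT mu) : set S -> \bar R := mu.

Context (sf : sigma_finite setT mu).
HB.instance Definition _ := Measure.copy (as_sigma_finite sf) mu.
HB.instance Definition _ := @Measure_isSigmaFinite.Build d S R (as_sigma_finite sf) sf.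

End sigma_finite_copy.

Section finite_measure_of_real.
Context d (S : measurableType d) (R : realType) (m : set S -> R).

(** The maximum keeps the value nonnegative on nonmeasurable sets, about which the hypotheses say
    nothing; the proofs are arguments so that the measure structure can be attached to the term. *)
Definition measure_of_real (_ : forall A, measurable A -> 0 <= m A) (_ : m set0 = 0)
    (_ : vector_measure (m : set S -> R^o)) : set S -> \bar R := fun A => (Num.max 0 (m A))%:E.

Context (m_ge0 : forall A, measurable A -> 0 <= m A) (m0 : m set0 = 0)
  (vm : vector_measure (m : set S -> R^o)).
Local Notation m' := (measure_of_real m_ge0 m0 vm).

Lemma measure_of_realE A : measurable A -> m' A = (m A)%:E.
Proof. by move=> mA; rewrite /measure_of_real max_r// m_ge0. Qed.

Let m'0 : m' set0 = 0%E. Proof. by rewrite measure_of_realE// m0. Qed.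

Let m'ge0 A : (0 <= m' A)%E. Proof. by rewrite lee_fin le_max lexx. Qed.

Let m'sa : semi_sigma_additive m'.
Proof.
move=> F mF tF mU; rewrite measure_of_realE//.
have -> : (fun n => \sum_(0 <= i < n) m' (F i))%E = (fun n => (\sum_(i < n) m (F i))%:E).
  by apply/funext => n; rewrite big_mkord -sumEFin; apply: eq_bigr => i _; rewrite measure_of_realE.
by apply/fine_cvgP; split; [exact: nearW|exact: vm].
Qed.

HB.instance Definition _ := isMeasure.Build d S R m' m'0 m'ge0 m'sa.

Let m'fin : fin_num_fun m'. Proof. by []. Qed.

HB.instance Definition _ := @Measure_isFinite.Build d S R m' m'fin.

End finite_measure_of_real.

Section real_radon_nikodym.
Context d (S : measurableType d) (R : realType) (mu : {measure set S -> \bar R}).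
Context (sf : sigma_finite setT mu).

Lemma nonneg_radon_nikodym (m : set S -> R) : (forall A, measurable A -> 0 <= m A) ->
  vector_measure (m : set S -> R^o) -> abs_continuous (m : set S -> R^o) mu ->
  exists f : S -> R, [/\ forall x, 0 <= f x, mu.-integrable setT (EFin \o f) &
    forall A, measurable A -> m A = \int[mu]_(x in A) f x].
Proof.
move=> m_ge0 vm ac.
have m0 : m set0 = 0 by exact: ac (measure0 mu).
have mE := measure_of_realE m_ge0 m0 vm.
pose fm : {finite_measure set S -> \bar R} := measure_of_real m_ge0 m0 vm.
pose mu' : {sigma_finite_measure set S -> \bar R} := as_sigma_finite sf.
have dom : fm `<< mu'.
  apply/null_content_dominatesP => A mA A0.
  by rewrite [LHS]mE// (ac A mA A0).
have [f [f0 ff fi fE]] := radon_nikodym_sigma_finite dom.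
have fEfin x : f x = (fine (f x))%:E by rewrite fineK.
exists (fun x => fine (f x)); split.
- by move=> x; exact: fine_ge0.
- by rewrite (_ : EFin \o _ = f); [exact: fi|apply/funext => x /=; rewrite -fEfin].
- move=> A mA; apply: EFin_inj; rewrite -mE// [LHS]fE//.
  rewrite -[LHS]fineK; last by apply: integrable_fin_num => //; exact: integrableS fi.
  by congr (fine _)%:E; apply: eq_integral => x _; exact: fEfin.
Qed.

(** Adding the integral of [h] makes the set function nonnegative and dominated by 2h, so the
    nonnegative theorem applies; subtracting [h] from its density, truncated at 2h, leaves a
    function bounded by [h] at every point. *)
Lemma dominated_additive_density (nu : set S -> R) (h : S -> R) :
  (forall x, 0 <= h x) -> mu.-integrable setT (EFin \o h) ->
  (forall A B, measurable A -> measurable B -> A `&` B = set0 -> nu (A `|` B) = nu A + nu B) ->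
  (forall A, measurable A -> `|nu A| <= \int[mu]_(x in A) h x) ->
  exists f : S -> R, [/\ measurable_fun setT f, forall x, `|f x| <= h x &
    forall A, measurable A -> nu A = \int[mu]_(x in A) f x].
Proof.
move=> h0 ih nuD nuh.
have ihA A : measurable A -> mu.-integrable A (EFin \o h) by move=> mA; exact: integrableS ih.
have mh : measurable_fun setT h by have /integrable_realP[] := ih.
pose m A := nu A + \int[mu]_(x in A) h x.
have IhD A B : measurable A -> measurable B -> A `&` B = set0 ->
    \int[mu]_(x in A `|` B) h x = \int[mu]_(x in A) h x + \int[mu]_(x in B) h x.
  move=> mA mB AB; apply: Rintegral_setU => //; first by apply: ihA; exact: measurableU.
  by apply/disj_setPS; rewrite AB.
have mD A B : measurable A -> measurable B -> A `&` B = set0 -> m (A `|` B) = m A + m B.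
  by move=> mA mB AB; rewrite /m nuD// IhD// addrACA.
have m0 A : measurable A -> 0 <= m A.
  by move=> mA; have := nuh A mA; rewrite ler_norml /m => /andP[? _]; lra.
have h20 x : 0 <= 2 * h x by rewrite mulr_ge0.
have ih2 : mu.-integrable setT (EFin \o (fun x => 2 * h x)) by exact: integrable_realZ.
have mle A : measurable A -> `|m A : R^o| <= \int[mu]_(x in A) (2 * h x).
  move=> mA; rewrite ger0_norm ?m0// RintegralZl//; last exact: ihA.
  by have := nuh A mA; rewrite ler_norml /m => /andP[_ ?]; lra.
have [vm _ ac] := dominated_additive_measure (V := R^o) h20 ih2 mD mle.
have [f [f0 if_ fE]] := nonneg_radon_nikodym m0 vm ac.
have mf : measurable_fun setT f by have /integrable_realP[] := if_.
have if_A A : measurable A -> mu.-integrable A (EFin \o f) by move=> mA; exact: integrableS if_.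
have nuE A : measurable A -> nu A = \int[mu]_(x in A) (f x - h x).
  move=> mA; rewrite RintegralB//; [|exact: if_A|exact: ihA].
  by rewrite -fE// /m addrK.
(* the density is at most 2h off a null set, so truncating it changes nothing *)
pose g x := Num.min (f x) (2 * h x).
have ig : mu.-integrable setT (EFin \o g).
  have m2h : measurable_fun setT (fun x => 2 * h x) by have /integrable_realP[] := ih2.
  apply: (le_integrable_real measurableT (measurable_minr mf m2h) if_).
  by move=> x _; rewrite ger0_norm ?le_min ?f0 ?h20// ge_min lexx.
have fg : {ae mu, forall x, setT x -> (f x)%:E = (g x)%:E}.
  apply: integral_ae_eq => //; first by have /integrable_realP[/measurable_EFinP] := ig.
  move=> A _ mA; pose B := A `&` [set x | f x <= 2 * h x]; pose C := A `&` [set x | 2 * h x < f x].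
  have mf2 : measurable_fun setT (fun x => f x - 2 * h x).
    by apply: measurable_funB => //; exact: measurable_funM.
  have mB : measurable B.
    apply: measurableI => //.
    rewrite (_ : mkset _ = (fun x => f x - 2 * h x) @^-1` `]-oo, 0]%classic); last first.
      by apply/seteqP; split=> x /=; rewrite in_itv/= subr_le0.
    by rewrite -[X in measurable X]setTI; exact: mf2.
  have mC : measurable C.
    apply: measurableI => //.
    rewrite (_ : mkset _ = (fun x => f x - 2 * h x) @^-1` `]0, +oo[%classic); last first.
      by apply/seteqP; split=> x /=; rewrite in_itv/= andbT subr_gt0.
    by rewrite -[X in measurable X]setTI; exact: mf2.
  have ABC : A = B `|` C.
    apply/seteqP; split=> [x Ax|x [[]|[]]//].
    by case: (leP (f x) (2 * h x)) => fx; [left|right].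
  have BC0 : B `&` C = set0.
    by apply/seteqP; split=> // x [[_ /= h1] [_ /= h2]]; have := lt_le_trans h2 h1; rewrite ltxx.
  have igA D : measurable D -> mu.-integrable D (EFin \o g) by move=> mD'; exact: integrableS ig.
  have dBC : [disjoint B & C] by apply/disj_setPS; rewrite BC0.
  have eqI : \int[mu]_(x in A) f x = \int[mu]_(x in A) g x.
    rewrite ABC !Rintegral_setU//; try by rewrite -ABC; [exact: if_A|exact: igA].
    - congr (_ + _).
        by apply: eq_Rintegral => x /set_mem[_ /= fx]; rewrite /g min_l.
      have -> : \int[mu]_(x in C) g x = \int[mu]_(x in C) (2 * h x).
        by apply: eq_Rintegral => x /set_mem[_ /= fx]; rewrite /g min_r// ltW.
      apply/eqP; rewrite eq_le; apply/andP; split.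
        by rewrite -fE//; apply: le_trans (mle C mC); exact: ler_norm.
      apply: le_Rintegral => //; [exact: integrableS ih2|exact: if_A|].
      by move=> x [_ /= /ltW].
    - by rewrite -ABC; exact: igA.
    - by rewrite -ABC; exact: if_A.
  rewrite -[LHS]fineK; last by apply: integrable_fin_num => //; exact: if_A.
  by rewrite -[RHS]fineK; [congr EFin|apply: integrable_fin_num => //; exact: igA].
have mg : measurable_fun setT g by have /integrable_realP[] := ig.
exists (fun x => g x - h x); split.
- exact: measurable_funB.
- move=> x; rewrite ler_norml lerBrDl subrr le_min f0 h20/= lerBlDr.
  by rewrite ge_min; apply/orP; right; lra.
- move=> A mA; rewrite nuE//; apply: ae_eq_Rintegral => //.
  + by apply: measurable_funTS; exact: measurable_funB.
  + by apply: measurable_funTS; exact: measurable_funB.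
  + by apply: (ae_imply fg) => x /(_ I) [->].
Qed.

End real_radon_nikodym.

Section variation_measure.
Context d (S : measurableType d) (R : realType) (V : normedModType R).
Context (mu : {measure set S -> \bar R}) (nu : set S -> V).
Context (vm : vector_measure nu) (var : (Defs.variation nu < +oo)%E) (ac : abs_continuous nu mu).

(** Sums over finite disjoint families inside [A], not only over partitions of [A]: monotonicity and
    superadditivity of the supremum are then immediate. *)
Let partial_variations (A : set S) : set R := [set y | exists k (F : nat -> set S),
  [/\ forall i, measurable (F i), trivIset setT F, forall i, F i `<=` A &
      y = \sum_(i < k) `|nu (F i)|]].

Let v A := sup (partial_variations A).

Let nu0 : nu set0 = 0.
Proof. exact: ac (measure0 mu). Qed.

Lemma vector_measureU A B : measurable A -> measurable B -> A `&` B = set0 ->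
  nu (A `|` B) = nu A + nu B.
Proof.
move=> mA mB AB; pose F (i : nat) := if i == 0%N then A else if i == 1%N then B else set0.
have mF i : measurable (F i) by rewrite /F; case: (i == 0%N) => //; case: (i == 1%N).
have tF : trivIset setT F.
  apply/trivIsetP => -[|[|i]] [|[|j]] _ _ //= _; rewrite /F/= ?setI0 ?set0I//.
  by rewrite setIC.
have FU : \bigcup_i F i = A `|` B.
  apply/seteqP; split=> [x [[|[|i]] _]|x [Ax|Bx]]; rewrite /F/=; [by left|by right|by []| |].
    by exists 0%N.
  by exists 1%N.
have := vm mF tF; rewrite FU => h.
apply/esym; apply: (@cvg_unique _ (@norm_hausdorff _ V) _ _ _ _ _ h).
apply: cvg_near_cst; exists 2%N => // -[|[|k]] //= _.
by rewrite 2!big_ord_recl/= big1 ?addr0// => i _; rewrite /F/= nu0.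
Qed.

Let variation_bound : exists M, forall A, ubound (partial_variations A) M.
Proof.
pose M := fine (Defs.variation nu).
have varM : Defs.variation nu = M%:E.
  rewrite fineK// ge0_fin_numE//.
  apply: (@le_trans _ _ (\sum_(i < 1) `|nu setT|)%:E); first by rewrite lee_fin sumr_ge0.
  apply: ereal_sup_ubound; exists 1%N, (fun=> setT); split=> //.
    by move=> i j _ _ _; rewrite !ord1.
  by apply/seteqP; split=> // x _; exists ord0.
exists M => A _ [k [F [mF tF _ ->]]].
rewrite -lee_fin -varM.
(* [variation] speaks of partitions of the whole space, so the complement of the family is added as
   one more cell, with index [ord_max]. *)
pose C := ~` \bigcup_(i < k) F i.
pose G (i : 'I_k.+1) := if unlift ord_max i is Some j then F (j : 'I_k) else C.
apply: (@le_trans _ _ (\sum_(i < k.+1) `|nu (G i)|)%:E).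
  rewrite lee_fin big_ord_recr/=.
  have -> : \sum_(i < k) `|nu (G (widen_ord (leqnSn k) i))| = \sum_(i < k) `|nu (F i)|.
    apply: eq_bigr => i _; rewrite /G.
    have -> : widen_ord (leqnSn k) i = lift ord_max i.
      by apply: val_inj; rewrite /= /bump leqNgt ltn_ord.
    by rewrite liftK.
  by rewrite lerDl.
have mU : measurable (\bigcup_(i < k) F i) by apply: bigcup_measurable => i _; exact: mF.
apply: ereal_sup_ubound; exists k.+1, G; split=> //.
- by move=> i; rewrite /G; case: unlift => [j|]; [exact: mF|exact: measurableC].
- move=> i j _ _; rewrite /G; case: unliftP => [i' ->|->]; case: unliftP => [j' ->|->] //.
  + by move=> h; congr lift; apply: val_inj; exact: tF h.
  + by move=> [x [Fi nx]]; exfalso; apply: nx; exists i' => //=.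
  + by move=> [x [nx Fj]]; exfalso; apply: nx; exists j' => //=.
- apply/seteqP; split=> // x _; have [[i /= ik Fi]|nx] := pselect ((\bigcup_(i < k) F i) x).
    by exists (lift ord_max (Ordinal ik)) => //; rewrite /G liftK.
  by exists ord_max => //; rewrite /G unlift_none.
Qed.

Let pv_ubound A : has_ubound (partial_variations A).
Proof. by have [M h] := variation_bound; exists M; exact: h. Qed.

Let pv0 A : partial_variations A 0.
Proof.
exists 0%N, (fun=> set0); split.
- by [].
- by move=> i j _ _ [x []].
- by move=> i; exact: sub0set.
- by rewrite big_ord0.
Qed.

Let pv_le A y : partial_variations A y -> y <= v A.
Proof. by move=> Ay; apply: ub_le_sup. Qed.

Let v_le A M : ubound (partial_variations A) M -> v A <= M.
Proof. by move=> h; apply: ge_sup => //; exists 0; exact: pv0. Qed.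

Let v0 A : 0 <= v A. Proof. exact: pv_le (pv0 A). Qed.

Let nu_le_v A : measurable A -> `|nu A| <= v A.
Proof.
move=> mA; apply: pv_le; exists 1%N, (fun i => if i == 0%N then A else set0); split.
- by move=> i; case: ifP.
- by move=> i j _ _ [x []]; case: eqP => // ->; case: eqP => // ->.
- by move=> i x; case: eqP.
- by rewrite big_ord1.
Qed.

Let v_mono A B : A `<=` B -> v A <= v B.
Proof.
move=> AB; apply: v_le => _ [k [F [mF tF FA ->]]]; apply: pv_le; exists k, F; split=> // i.
exact: subset_trans (FA i) AB.
Qed.

Let v_super A B : A `&` B = set0 -> v A + v B <= v (A `|` B).
Proof.
move=> AB; rewrite -lerBrDr; apply: v_le => y Ay; rewrite lerBrDr -lerBrDl.
apply: v_le => y' By; rewrite lerBrDl.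
move: Ay By => [k [F [mF tF FA ->]]] [l [G [mG tG GB ->]]].
apply: pv_le; exists (k + l)%N, (fun i => if (i < k)%N then F i else G (i - k)%N); split.
- by move=> i; case: ifP.
- have disj i j : F i `&` G j !=set0 -> False.
    by move=> [x [/FA xA /GB xB]]; have : (A `&` B) x by []; rewrite AB.
  move=> i j _ _; case: ltnP => ik; case: ltnP => jk.
  + exact: tF.
  + by move=> /disj.
  + by rewrite setIC => /disj.
  + by move=> /(tG _ _ I I) /eqP; rewrite eqn_sub2rE// => /eqP.
- by move=> i; case: ifP => _; apply: subset_trans; [exact: FA|left|exact: GB|right].
- rewrite big_split_ord/=; congr (_ + _); apply: eq_bigr => i _; first by rewrite ltn_ord.
  by rewrite ltnNge leq_addr/= addKn.
Qed.

(** One inequality is superadditivity. For the other, a finite family nearly attaining the supremum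
    on the union is cut along the [G i]; countable additivity of [nu] shows that finitely many
    pieces already recover its sum up to an arbitrary error. *)
Let v_sigma_additive : vector_measure (v : set S -> R^o).
Proof.
move=> G mG tG.
have finU k : \sum_(i < k) v (G i) <= v (\bigcup_(i < k) G i).
  elim: k => [|k ih]; first by rewrite big_ord0 v0.
  rewrite big_ord_recr/= (le_trans (lerD ih (lexx _)))// (le_trans (v_super _))//.
    rewrite -subset0 => x [[i /= ik Gi] Gk].
    by have := tG i k I I (ex_intro _ x (conj Gi Gk)) => ik'; rewrite ik' ltnn in ik.
  by apply: v_mono => x [[i /= ik Gi]|Gk]; [exists i => //=; exact: ltnW|exists k => /=].
have leU k : \sum_(i < k) v (G i) <= v (\bigcup_i G i).
  by apply: le_trans (finU k) _; apply: v_mono => x [i _ Gi]; exists i.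
apply/cvgrPdist_lt => e e0.
have [_ [k [F [mF tF FU ->]]] ky] := sup_adherent e0 (conj (ex_intro _ 0 (pv0 (\bigcup_i G i))) (pv_ubound _)).
have aD n : \sum_(l < k) `|\sum_(i < n) nu (F l `&` G i)| <= \sum_(i < n) v (G i).
  apply: (@le_trans _ _ (\sum_(l < k) \sum_(i < n) `|nu (F l `&` G i)|)).
    by apply: ler_sum => l _; exact: ler_norm_sum.
  rewrite exchange_big/=; apply: ler_sum => i _; apply: pv_le.
  exists k, (fun l => F l `&` G i); split=> //.
  - by move=> l; exact: measurableI.
  - by move=> l l' _ _ [x [[Fl _] [Fl' _]]]; apply: (tF l l') => //; exists x.
have ca : \sum_(l < k) `|\sum_(i < n) nu (F l `&` G i)| @[n --> \oo] --> \sum_(l < k) `|nu (F l)|.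
  apply: cvg_big => [|l _].
    by move=> x; apply: cvgD; [exact: cvg_fst|exact: cvg_snd].
  apply: cvg_norm.
  have FE : F l = \bigcup_i (F l `&` G i) by rewrite -setI_bigcupr; apply/esym/setIidl/FU.
  rewrite [X in _ --> nu X]FE.
  apply: vm => [i|i j _ _ [x [[_ Gi] [_ Gj]]]]; first exact: measurableI.
  by apply: (tG i j) => //; exists x.
near=> n.
have hn : sup (partial_variations (\bigcup_i G i)) - e < \sum_(l < k) `|\sum_(i < n) nu (F l `&` G i)|.
  by near: n; exact: (cvgr_gt _ ca _ ky).
rewrite ger0_norm ?subr_ge0//.
have := aD n; have := hn; rewrite /v /=; lra.
Unshelve. all: by end_near. Qed.

(** The total variation is a finite measure, absolutely continuous because [nu] vanishes on
    measurable subsets of a null set; [h] is its real Radon-Nikodym density. *)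
Lemma variation_density : sigma_finite setT mu -> exists h : S -> R,
  [/\ forall x, 0 <= h x, mu.-integrable setT (EFin \o h) &
    forall A, measurable A -> `|nu A| <= \int[mu]_(x in A) h x].
Proof.
move=> sf.
have vac : abs_continuous (v : set S -> R^o) mu.
  move=> A mA A0; apply/eqP; rewrite eq_le v0 andbT; apply: v_le => _ [k [F [mF tF FA ->]]].
  rewrite big1// => i _; rewrite ac ?normr0//.
  by apply: (subset_measure0 (mF i) mA (FA i) A0).
have [h [h0 ih hE]] := nonneg_radon_nikodym sf (fun A _ => v0 A) v_sigma_additive vac.
by exists h; split=> // A mA; rewrite -hE//; exact: nu_le_v.
Qed.

End variation_measure.

(** * Approximation by step functions *)

Section finite_partitions.
Context d (S : measurableType d).

(** Coding a partition by its labelling allows empty cells and turns the cells into preimages. *)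
Definition finite_partition N (t : S -> nat) :=
  (forall r, measurable (t @^-1` [set r])) /\ forall x, (t x < N)%N.

Lemma finite_partition_additive (W : zmodType) (rho : set S -> W) N (t : S -> nat) A :
  (forall A B, measurable A -> measurable B -> A `&` B = set0 -> rho (A `|` B) = rho A + rho B) ->
  finite_partition N t -> measurable A ->
  \sum_(r < N) rho (A `&` t @^-1` [set val r]) = rho A.
Proof.
move=> rhoD [mt tN] mA.
have rho0 : rho set0 = 0.
  have := rhoD _ _ measurable0 measurable0 (set0I set0).
  by rewrite setU0 => /eqP; rewrite -subr_eq subrr eq_sym => /eqP.
have mlt k : measurable [set x | (t x < k)%N].
  have -> : [set x | (t x < k)%N] = \bigcup_(i < k) t @^-1` [set i].
    by apply/seteqP; split=> [x /= xk|x [i /= ik]]; [exists (t x)|rewrite /preimage/= => ->].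
  by apply: bigcup_measurable => i _; exact: mt.
suff h k : \sum_(r < k) rho (A `&` t @^-1` [set val r]) = rho (A `&` [set x | (t x < k)%N]).
  by rewrite h; congr rho; apply/setIidl => x _ /=.
elim: k => [|k ih].
  rewrite big_ord0; have -> : [set x | (t x < 0)%N] = set0 by apply/seteqP; split.
  by rewrite setI0.
rewrite big_ord_recr/= ih -rhoD; first last.
- apply/seteqP; split=> // x [[_ /= xk] [_ /= tk]]; by rewrite tk ltnn in xk.
- exact: measurableI.
- exact: measurableI.
congr rho; apply/seteqP; split=> x /=.
  by move=> [[Ax xk]|[Ax <-]]; split=> //; exact: ltnW.
by move=> [Ax]; rewrite ltnS leq_eqVlt => /orP[/eqP ?|?]; [right|left].
Qed.

End finite_partitions.

(** The majorant is the sum of the series. By monotone convergence its integral is at most [M], so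
    it is finite almost everywhere and [fine] changes it only on a null set. *)
Lemma summable_majorant d (S : measurableType d) (R : realType) (mu : {measure set S -> \bar R})
  (g : nat -> S -> R) (M : R) : (forall k x, 0 <= g k x) ->
  (forall k, mu.-integrable setT (EFin \o g k)) ->
  (forall n, \sum_(k < n) \int[mu]_x g k x <= M) ->
  exists D : S -> R, [/\ forall x, 0 <= D x, mu.-integrable setT (EFin \o D) &
    {ae mu, forall x n, \sum_(k < n) g k x <= D x}].
Proof.
move=> g0 ig gM.
have mg k : measurable_fun setT (fun x => (g k x)%:E) by have /integrableP[] := ig k.
pose G x := (\sum_(0 <= k <oo) (g k x)%:E)%E.
have G0 x : (0 <= G x)%E by apply: nneseries_ge0 => k _ _; rewrite lee_fin.
have mG : measurable_fun setT G by apply: ge0_emeasurable_sum => // k x _ _; rewrite lee_fin.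
have iG : mu.-integrable setT G.
  apply/integrableP; split=> //.
  under eq_integral do rewrite gee0_abs//.
  rewrite integral_nneseries//; last by move=> k x _; rewrite lee_fin.
  apply: (@le_lt_trans _ _ M%:E); last exact: ltry.
  apply: lime_le; first by apply: is_cvg_nneseries => k _ _; apply: integral_ge0 => x _; rewrite lee_fin.
  apply: nearW => n; rewrite big_mkord.
  have -> : (\sum_(k < n) \int[mu]_x (g k x)%:E)%E = (\sum_(k < n) \int[mu]_x g k x)%:E.
    rewrite -sumEFin; apply: eq_bigr => k _; rewrite /Rintegral fineK//.
    by apply: integrable_fin_num; [exact: measurableT|exact: ig].
  by rewrite lee_fin.
have aeG := integrable_ae measurableT iG.
exists (fun x => fine (G x)); split.
- by move=> x; exact: fine_ge0.
- apply: (le_integrable measurableT _ _ iG).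
    by apply/measurable_EFinP; exact: (measurableT_comp _ mG).
  move=> x _ /=; rewrite (gee0_abs (G0 x)) ger0_norm ?fine_ge0//.
  by case: (G x) (G0 x) => //= _; exact: leey.
- apply: (ae_imply aeG) => x /(_ I) Gx n.
  rewrite -lee_fin fineK// -sumEFin -(big_mkord xpredT (fun k => (g k x)%:E)).
  by apply: nneseries_lim_ge => k _ _; rewrite lee_fin.
Qed.

Section step_density.
Context d (S : measurableType d) (R : realType) (V : completeNormedModType R)
  (mu : {measure set S -> \bar R}) (nu : set S -> V) (h : S -> R).
Context (h0 : forall x, 0 <= h x) (ih : mu.-integrable setT (EFin \o h)).
Implicit Types (C : nat) (v : nat -> V) (T : nat -> set S).

Definition step_fun C v T x : V := \sum_(i < C) (\1_(T i) x : R) *: v i.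

Definition step_integral C v T A : V := \sum_(i < C) (\int[mu]_(x in A `&` T i) h x) *: v i.

(** The condition bounds by [e] the variation of [nu] minus the measure with density
    [step_fun C v T] with respect to h d(mu). *)
Definition step_approximable (e : R) := exists C v T, (forall i, measurable (T i)) /\
  forall N t, finite_partition N t ->
    \sum_(r < N) `|nu (t @^-1` [set val r]) - step_integral C v T (t @^-1` [set val r])| <= e.

Let mh : measurable_fun setT h.
Proof. by have /integrable_realP[] := ih. Qed.

Lemma simple_step C v T : (forall i, measurable (T i)) -> simple_function (step_fun C v T).
Proof.
move=> mT; elim: C => [|C ihC].
  rewrite (_ : step_fun 0 v T = cst 0); first exact: simple_cst.
  by apply/funext => x; rewrite /step_fun big_ord0.
rewrite (_ : step_fun C.+1 v T = fun x => step_fun C v T x + (\1_(T C) x : R) *: v C).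
  by apply: (simple_map2 +%R ihC); exact: simple_indic.
by apply/funext => x; rewrite /step_fun big_ord_recr.
Qed.

Let step_bound C v T x : `|step_fun C v T x| <= \sum_(i < C) `|v i|.
Proof.
apply: le_trans (ler_norm_sum _ _ _) _; apply: ler_sum => i _.
by rewrite normrZ indicE normr_nat ler_piMl// lern1 leq_b1.
Qed.

Let integrable_step (g : V -> R) C v T A : (forall z, `|g z| <= `|z|) ->
  (forall i, measurable (T i)) -> measurable A ->
  mu.-integrable A (EFin \o (fun x => g (step_fun C v T x) * h x)).
Proof.
move=> g1 mT mA; apply: (integrableS measurableT mA) => //.
apply: (le_integrable_real measurableT _ (integrable_realZ (\sum_(i < C) `|v i|) measurableT ih)).
  apply: measurable_funM mh; exact: (simple_measurable_comp g (simple_step C v mT)).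
move=> x _; rewrite normrM (ger0_norm (h0 x)) ler_wpM2r//.
exact: le_trans (g1 _) (step_bound _ _ _ _).
Qed.

Lemma functional_step_integral (f : {linear V -> R^o}) C v T A :
  (forall z, `|f z| <= `|z|) -> (forall i, measurable (T i)) -> measurable A ->
  f (step_integral C v T A) = \int[mu]_(x in A) (f (step_fun C v T x) * h x).
Proof.
move=> f1 mT mA.
pose F (i : 'I_C) x := f (v i) * (\1_(T i) x * h x).
have i1 (i : 'I_C) : mu.-integrable A (EFin \o (fun x => \1_(T i) x * h x)).
  apply: (le_integrable_real mA _ (integrableS measurableT mA (@subsetT _ _) ih)).
    by apply: measurable_funTS; apply: measurable_funM mh; exact: measurable_indic.
  by move=> x _; rewrite normrM (ger0_norm (h0 x)) ler_piMl// indicE normr_nat lern1 leq_b1.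
have iF i : mu.-integrable A (EFin \o F i) by exact: integrable_realZ.
have -> : (fun x => f (step_fun C v T x) * h x) = fun x => \sum_(i < C) F i x.
  apply/funext => x; rewrite /step_fun linear_sum mulr_suml; apply: eq_bigr => i _.
  by rewrite linearZ/= /F [in RHS]mulrCA mulrA.
have [_ ->] := Rintegral_sum (index_enum 'I_C) mA iF.
rewrite /step_integral linear_sum; apply: eq_bigr => i _.
rewrite linearZ/= RintegralZl// mulrC; congr (_ * _).
rewrite Rintegral_mkcondr; apply: eq_Rintegral => x _.
by rewrite patchE indicE; case: ifP => _; rewrite ?mul1r ?mul0r.
Qed.

Let integralU (g : S -> R) A B : mu.-integrable setT (EFin \o g) ->
  measurable A -> measurable B -> A `&` B = set0 ->
  \int[mu]_(x in A `|` B) g x = \int[mu]_(x in A) g x + \int[mu]_(x in B) g x.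
Proof.
move=> ig mA mB AB; apply: Rintegral_setU => //; last by apply/disj_setPS; rewrite AB.
by apply: (integrableS measurableT) => //; exact: measurableU.
Qed.

(* On a level set {s - s' = z} the two step integrals differ by z times the mass. *)
Lemma step_approximation_dist C v T C' v' T' e e' :
  (forall i, measurable (T i)) -> (forall i, measurable (T' i)) ->
  (forall N t, finite_partition N t ->
    \sum_(r < N) `|nu (t @^-1` [set val r]) - step_integral C v T (t @^-1` [set val r])| <= e) ->
  (forall N t, finite_partition N t ->
    \sum_(r < N) `|nu (t @^-1` [set val r]) - step_integral C' v' T' (t @^-1` [set val r])| <= e') ->
  mu.-integrable setT (EFin \o (fun x => `|step_fun C v T x - step_fun C' v' T' x| * h x)) /\
  \int[mu]_x (`|step_fun C v T x - step_fun C' v' T' x| * h x) <= e + e'.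
Proof.
move=> mT mT' ae ae'.
pose s x := step_fun C v T x - step_fun C' v' T' x.
have ss : simple_function s.
  by apply: (simple_map2 (fun a b => a - b)); exact: simple_step.
have is_ : mu.-integrable setT (EFin \o (fun x => `|s x| * h x)).
  apply: (le_integrable_real measurableT _
    (integrable_realZ (\sum_(i < C) `|v i| + \sum_(i < C') `|v' i|) measurableT ih)).
    have ms := simple_measurable_comp (D := setT) (fun z : V => `|z|) ss.
    exact: (measurable_funM ms mh).
  move=> x _; rewrite normrM normr_id (ger0_norm (h0 x)) ler_wpM2r//.
  by apply: le_trans (ler_normB _ _) _; apply: lerD; exact: step_bound.
split=> //.
pose q := finmap.enum_fset (fset_set (range s)).
have sq x : s x \in q.
  have xr : s x \in range s by rewrite inE; exists x.
  by move: xr; rewrite -(in_fset_set (proj1 ss)).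
pose t x := index (s x) q.
have st x r : t x = r -> s x = nth 0 q r by move=> <-; rewrite nth_index.
have pt : finite_partition (size q) t.
  split=> [r|x]; last by rewrite index_mem.
  rewrite (_ : t @^-1` [set r] = s @^-1` [set z | index z q = r])//.
  exact: simple_preimage.
have mt r : measurable (t @^-1` [set r]) by have [] := pt.
have iD A : measurable A -> mu.-integrable A (EFin \o (fun x => `|s x| * h x)).
  by move=> mA; exact: integrableS is_.
rewrite -(finite_partition_additive (fun A B => integralU is_ (A := A) (B := B)) pt measurableT).
apply: le_trans (lerD (ae _ _ pt) (ae' _ _ pt)); rewrite -big_split/=.
apply: ler_sum => r _; rewrite setTI; set A := _ @^-1` _.
have mA : measurable A by exact: mt.
pose z := nth 0 q r.
have [f [f1 fz]] := norming_functional z.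
have -> : \int[mu]_(x in A) (`|s x| * h x) =
    f (step_integral C v T A) - f (step_integral C' v' T' A).
  rewrite !functional_step_integral// -RintegralB//; try exact: integrable_step.
  apply: eq_Rintegral => x /set_mem Ax; rewrite -mulrBl -linearB/= -/(s x).
  by rewrite (st x r)// -/z fz.
rewrite -linearB/=; apply: le_trans (ler_norm _) _; apply: le_trans (f1 _) _.
by apply: le_trans (ler_distD (nu A) _ _) _; rewrite distrC.
Qed.

(** Step functions with errors 2^-n are Cauchy in L^1 of h d(mu) by [step_approximation_dist], and
    fast enough to converge almost everywhere where [h] is positive. Their limit is a density with
    respect to h d(mu), hence the factor [h] in [w]. *)
Lemma step_density : measure_is_complete mu -> (forall e, 0 < e -> step_approximable e) ->
  exists w : S -> V, bochner_L1 mu setT w /\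
    forall A, measurable A -> is_bochner_integral mu A w (nu A).
Proof.
move=> cmu happ.
have e0 n : 0 < 2^-1 ^+ n :> R by rewrite exprn_gt0.
have [D hD] := choice (fun n => (happ _ (e0 n))).
have [v {}hD] := choice hD; have [T {}hD] := choice hD.
pose s n := step_fun (D n) (v n) (T n).
have mT n i : measurable (T n i) by have [] := hD n.
have app n := (hD n).2.
pose g n x := `|s n x - s n.+1 x| * h x.
have dist n := step_approximation_dist (mT n) (mT n.+1) (app n) (app n.+1).
(* Consecutive step functions are at distance at most 2^-k + 2^-(k+1) <= 2 * 2^-k, and these bounds
   sum to 4. *)
have [|n|n|G [G0 iG sG]] := @summable_majorant _ _ _ mu g 4.
- by move=> n x; rewrite /g mulr_ge0.
- exact: (dist n).1.
- have hs : \sum_(k < n) \int[mu]_x g k x <= \sum_(k < n) (2 * 2^-1 ^+ k).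
    apply: ler_sum => k _; apply: le_trans (dist k).2 _.
    have := ltW (e0 k); rewrite exprS; lra.
  apply: le_trans hs _.
  have := @geometric_le_lim R n 2 2^-1; rewrite /series/= big_mkord => hg.
  apply: le_trans (hg _ _ _) _ => //; first by rewrite ger0_norm// invf_lt1// ltr1n.
  by rewrite ler_pdivrMr; lra.
(* The summable bound carries the factor [h] and says nothing where [h] is 0; there the step
   functions are replaced by 0. *)
pose P := [set x | 0 < h x].
have mP : measurable P.
  rewrite (_ : P = h @^-1` `]0, +oo[%classic); last by apply/seteqP; split=> x /=; rewrite in_itv/= andbT.
  by rewrite -[X in measurable X]setTI; exact: mh.
pose a n x := (\1_P x : R) *: s n x.
have sa n : simple_function (a n).
  have s1 : simple_function (\1_P : S -> R^o).
    have := simple_indic (V := R^o) 1 mP; congr simple_function.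
    by apply/funext => x; rewrite /GRing.scale/= mulr1.
  by apply: (simple_map2 (fun (c : R^o) w => c *: w) s1); exact: simple_step.
pose q x := lim (a ^~ x @ \oo).
have aq : {ae mu, forall x, setT x -> a ^~ x @ \oo --> q x}.
  apply: (ae_imply sG) => x Gx _.
  have [hx|hx] := ltP 0 (h x); last first.
    have ax : a ^~ x = fun=> 0.
      apply/funext => n; rewrite /a indicE memNset ?scale0r//= /P/=.
      by rewrite ltNge hx.
    by rewrite /q ax lim_cst//; exact: cvg_cst.
  have ax : a ^~ x = s ^~ x.
    by apply/funext => n; rewrite /a indicE mem_set ?scale1r.
  rewrite /q ax; suff : cvgn (s ^~ x) by [].
  have cs : cvgn (series (fun k => s k.+1 x - s k x)).
    apply: normed_cvg; apply: nondecreasing_is_cvgn.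
      by apply/nondecreasing_seqP => n; rewrite -subr_ge0 seriesSB normr_ge0.
    exists (G x / h x) => _ [n _ <-]; rewrite ler_pdivlMr//.
    rewrite -[X in X * _]/(\sum_(0 <= k < n) `|s k.+1 x - s k x|) big_mkord mulr_suml.
    by apply: le_trans (Gx n); apply: ler_sum => k _; rewrite /g distrC.
  have -> : s ^~ x = fun n => series (fun k => s k.+1 x - s k x) n + s 0%N x.
    by apply/funext => n; rewrite /series/= telescope_sumr// subrK.
  by apply: is_cvgD => //; exact: is_cvg_cst.
pose w x := (h x : R^o) *: q x.
have smw : strongly_measurable mu setT w.
  apply: strongly_measurableZ; first exact: measurable_strongly_measurable.
  by exists a; split.
have hs x n : h x *: a n x = h x *: s n x.
  have [hx|hx] := ltP 0 (h x); first by rewrite /a indicE mem_set ?scale1r.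
  by have -> : h x = 0 by [apply/eqP; rewrite eq_le hx h0]; rewrite !scale0r.
pose M x := (\sum_(i < D 0%N) `|v 0%N i|) * h x + G x.
have iM : mu.-integrable setT (EFin \o M) by apply: integrable_realD => //; exact: integrable_realZ.
have sM : {ae mu, forall x, setT x -> forall n, `|h x *: a n x| <= M x}.
  apply: (ae_imply sG) => x Gx _ n; rewrite hs normrZ (ger0_norm (h0 x)) /M.
  have -> : s n x = s 0%N x - \sum_(k < n) (s k x - s k.+1 x).
    rewrite -(big_mkord xpredT (fun k => s k x - s k.+1 x)) -[X in _ = _ - X]opprK -sumrN.
    under eq_bigr do rewrite opprB.
    by rewrite telescope_sumr// opprK addrC subrK.
  rewrite mulrC; apply: (@le_trans _ _ ((`|s 0%N x| + \sum_(k < n) `|s k x - s k.+1 x|) * h x)).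
    rewrite ler_wpM2r//; apply: le_trans (ler_normB _ _) _; rewrite lerD2l; exact: ler_norm_sum.
  rewrite mulrDl lerD//; first by rewrite ler_wpM2r//; exact: step_bound.
  by rewrite mulr_suml; exact: Gx.
have wM : {ae mu, forall x, setT x -> `|w x| <= M x}.
  apply: (ae_imply2 aq sM) => x ax aM _.
  have : `|h x *: a n x| @[n --> \oo] --> `|w x|.
    by apply: cvg_norm; apply: cvgZr; exact: ax.
  move=> /cvg_lim <-//; apply: limr_le; last by apply: nearW => n; exact: aM.
  by apply/cvg_ex; exists (`|w x|); apply: cvg_norm; apply: cvgZr; exact: ax.
have mnw : measurable_fun setT (fun x => `|w x|) by exact: (strongly_measurable_norm cmu measurableT smw).
have mM : measurable_fun setT M by have /integrable_realP[] := iM.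
have M0 x : 0 <= M x by rewrite addr_ge0// mulr_ge0// sumr_ge0.
have wL1 : (\int[mu]_x `|w x|%:E < +oo)%E.
  have -> : (\int[mu]_x `|w x|%:E = \int[mu]_x `| `|w x| |%:E)%E.
    by apply: eq_integral => x _; rewrite normr_id.
  apply: (ae_le_integral_lty measurableT mnw mM) => //.
    by apply: (ae_imply wM) => x h1 _; rewrite normr_id h1.
  have /integrable_realP[_] := iM.
  by under eq_integral do rewrite ger0_norm//.
exists w; split=> // A mA; apply/is_bochner_integralP => //; split.
- by apply: strongly_measurableS smw.
- apply: le_lt_trans wL1; apply: ge0_subset_integral => //.
  exact/measurable_EFinP.
- move=> f f1.
  have cf := le1_functional_continuous f1.
  have mfw : measurable_fun setT (f \o w) by exact: strongly_measurable_measurable_comp cmu measurableT cf smw.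
  have mfa n : measurable_fun setT (fun x => f (a n x) * h x).
    apply: measurable_funM mh; exact: (simple_measurable_comp f (sa n)).
  have [|||||_ h1] := @dominated_Rintegral _ _ _ mu A (fun n x => f (a n x) * h x) (f \o w) M mA.
  + by move=> n; exact: measurable_funTS.
  + exact: measurable_funTS.
  + exact: integrableS iM.
  + apply: (ae_imply aq) => x /(_ I) ax _ /=; rewrite /w linearZ/= [X in _ --> X]mulrC.
    by apply: cvgMl; apply: continuous_cvg => //; exact: cf.
  + apply: (ae_imply sM) => x /(_ I) ax _ n; rewrite mulrC.
    have -> : h x * f (a n x) = f (h x *: a n x) :> R by rewrite [RHS]linearZ.
    exact: le_trans (f1 _) (ax n).
  apply: (@cvg_unique _ (@norm_hausdorff _ R^o) _ _ _ _ _ h1).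
  have -> : (fun n => \int[mu]_(x in A) (f (a n x) * h x)) = fun n => f (step_integral (D n) (v n) (T n) A).
    apply/funext => n; rewrite (functional_step_integral _ _ f1 (mT n) mA).
    apply: eq_Rintegral => x _; rewrite mulrC [RHS]mulrC.
    by have := congr1 f (hs x n); rewrite !linearZ.
  apply: continuous_cvg; first exact: cf.
  apply/cvgrPdist_le => e e1.
  have := @cvg_geometric R 1 2^-1; rewrite ger0_norm// invf_lt1// ltr1n => /(_ isT) /cvgrPdist_le /(_ e e1).
  apply: filterS => n; rewrite sub0r normrN /geometric/= mul1r ger0_norm ?exprn_ge0// => hn.
  apply: le_trans hn.
  (* The partition into [A] and its complement turns the variation bound into a bound for the single
     set [A]. *)
  have pA : finite_partition 2 (fun x => if x \in A then 0%N else 1%N).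
    split=> [[|[|r]]|x]; last by case: ifP.
    - rewrite (_ : _ @^-1` _ = A)//; apply/seteqP; split=> x /=; first by case: ifP => // /set_mem.
      by move=> Ax; rewrite mem_set.
    - rewrite (_ : _ @^-1` _ = ~` A); first exact: measurableC.
      apply/seteqP; split=> x /=; first by case: ifP => // /negbT /negP nA _ Ax; apply: nA; rewrite inE.
      by move=> Ax; rewrite memNset.
    - by rewrite (_ : _ @^-1` _ = set0)//; apply/seteqP; split=> x //=; case: ifP.
  have := app n _ _ pA; rewrite big_ord_recl/= => h2; apply: le_trans h2.
  rewrite (_ : _ @^-1` [set 0%N] = A) ?lerDl ?sumr_ge0//.
  apply/seteqP; split=> x /=; first by case: ifP => // /set_mem.
  by move=> Ax; rewrite mem_set.
Qed.

End step_density.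

(** * The bush and its curve *)

Lemma sum_blocks (W : nmodType) (C B : nat) (F : nat -> W) :
  \sum_(j < C * B) F j = \sum_(i < C) \sum_(r < B) F (i * B + r)%N.
Proof.
elim: C => [|C ih]; first by rewrite mul0n !big_ord0.
by rewrite big_ord_recr/= -ih mulSnr big_split_ord.
Qed.

Section martingale_tree.
Context d (S : measurableType d) (R : realType) (V : normedModType R)
  (nu : set S -> V) (m : set S -> R).
Context
  (nuD : forall A B, measurable A -> measurable B -> A `&` B = set0 -> nu (A `|` B) = nu A + nu B)
  (mD : forall A B, measurable A -> measurable B -> A `&` B = set0 -> m (A `|` B) = m A + m B)
  (num : forall A, measurable A -> `|nu A| <= m A).

Let m_ge0 A : measurable A -> 0 <= m A.
Proof. by move=> mA; apply: le_trans (num mA). Qed.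

Let m_le A : measurable A -> m A <= m setT.
Proof.
move=> mA; rewrite -(setUv A) mD ?setICr//; last exact: measurableC.
by rewrite lerDl m_ge0//; exact: measurableC.
Qed.

Context (c e : R) (c0 : 0 < c) (bad : forall C (v : nat -> V) (T : nat -> set S), (forall i, measurable (T i)) ->
  exists N t, finite_partition N t /\
    e < \sum_(r < N) `|nu (t @^-1` [set val r]) - \sum_(i < C) m (t @^-1` [set val r] `&` T i) *: v i|).

(** Level k has [C k] nodes with [B k] children each; [L] and [G] are partial sums of the scaled
    masses and of the scaled values of [nu], so [G] as a function of [L] is the curve at the nodes.
    Each level is split by the partition that [bad] opposes to the current averages, which makes
    child slopes differ from parent slopes by a total of at least [c * e]. *)
Lemma martingale_tree : exists (C B : nat -> nat) (L : nat -> nat -> R) (G : nat -> nat -> V),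
  [/\ forall k, C k.+1 = (C k * B k)%N,
    forall k i, L k.+1 (i * B k)%N = L k i /\ G k.+1 (i * B k)%N = G k i,
    forall k i, `|G k i.+1 - G k i| <= L k i.+1 - L k i <= 2^-1 ^+ k * (c * m setT),
    forall k, L k 0%N = 0 /\ L k (C k) = c * m setT &
    forall k, c * e <= \sum_(i < C k) \sum_(j < B k)
      `|(G k.+1 (i * B k + j)%N.+1 - G k.+1 (i * B k + j)%N) -
        ((L k.+1 (i * B k + j)%N.+1 - L k.+1 (i * B k + j)%N) / (L k i.+1 - L k i)) *:
          (G k i.+1 - G k i)|].
Proof.
pose P (p : nat * (nat -> V) * (nat -> set S)) (q : nat * (S -> nat)) :=
  (forall i, measurable (p.2 i)) -> finite_partition q.1 q.2 /\
    e < \sum_(r < q.1) `|nu (q.2 @^-1` [set val r]) -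
      \sum_(i < p.1.1) m (q.2 @^-1` [set val r] `&` p.2 i) *: p.1.2 i|.
have hP p : exists q, P p q.
  have [mT|nT] := pselect (forall i, measurable (p.2 i)).
    by have [N [t ht]] := bad p.1.1 p.1.2 mT; exists (N, t).
  by exists (0%N, fun=> 0%N).
have [pick hpick] := choice hP.
(* Averages of [nu] over the nodes. Level k covers the space 2^k times because of the repetitions;
   the factor 2^-k makes the resulting step function a conditional mean. *)
pose w k (T : nat -> set S) i := (2^-1 ^+ k / m (T i)) *: nu (T i).
(* Child j of node i gets index i B + j, where B is twice the number of cells; halving j selects the
   cell, so each cell occurs twice in a row. *)
pose next k (s : nat * (nat -> set S)) := let q := pick (s.1, w k s.2, s.2) in
  ((s.1 * (q.1 * 2))%N, fun j => s.2 (j %/ (q.1 * 2))%N `&`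
    q.2 @^-1` [set ((j %% (q.1 * 2)) %/ 2)%N]).
pose st := fix st k := if k is k'.+1 then next k' (st k') else (1%N, fun _ : nat => setT : set S).
pose C k := (st k).1; pose T k := (st k).2.
pose q k := pick (C k, w k (T k), T k).
pose N k := (q k).1; pose t k := (q k).2; pose B k := (N k * 2)%N.
have TS k i j : (j < B k)%N -> T k.+1 (i * B k + j)%N = T k i `&` t k @^-1` [set (j %/ 2)%N].
  move=> jB; have B0 : (0 < B k)%N by exact: leq_ltn_trans jB.
  rewrite {1}/T /st -/st /next /= -/(C k) -/(T k) -/(q k) -/(N k) -/(B k).
  by rewrite divnMDl// modnMDl divn_small// modn_small// addn0.
have mT0 k : (forall i, measurable (T k i)) -> finite_partition (N k) (t k).
  by move=> mT; have [] := hpick (C k, w k (T k), T k) mT.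
have mT k : forall i, measurable (T k i).
  elim: k => [|k ih] i; first exact: measurableT.
  rewrite /T /st -/st /next /=; apply: measurableI; first exact: ih.
  by have [h _] := mT0 k ih; exact: h.
have pt k : finite_partition (N k) (t k) by exact: mT0 (mT k).
have mt k r : measurable (t k @^-1` [set r]) by have [h _] := pt k; exact: h.
(* the factor 2 accounts for every child being listed twice *)
have half (W : zmodType) (g : nat -> W) n : \sum_(j < n * 2) g (j %/ 2)%N = (\sum_(r < n) g r) *+ 2.
  rewrite (sum_blocks _ _ (fun j => g (j %/ 2)%N)) -sumrMnl; apply: eq_bigr => i _.
  by rewrite 2!big_ord_recl big_ord0 addr0/= !divnMDl// !addn0 mulr2n.
have child (W : zmodType) (rho : set S -> W) k i :
    (forall A B, measurable A -> measurable B -> A `&` B = set0 -> rho (A `|` B) = rho A + rho B) ->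
    \sum_(j < B k) rho (T k.+1 (i * B k + j)%N) = rho (T k i) *+ 2.
  move=> rhoD; rewrite -(finite_partition_additive rhoD (pt k) (mT k i)).
  rewrite -(half _ (fun r => rho (T k i `&` t k @^-1` [set r]))).
  by apply: eq_bigr => j _; rewrite TS.
have inv (W : zmodType) (rho : set S -> W) k A :
    (forall A B, measurable A -> measurable B -> A `&` B = set0 -> rho (A `|` B) = rho A + rho B) ->
    measurable A -> \sum_(i < C k) rho (A `&` T k i) = rho A *+ (2 ^ k).
  move=> rhoD mA; elim: k => [|k ih]; first by rewrite big_ord1 setIT expn0.
  have rhoAD A' B' : measurable A' -> measurable B' -> A' `&` B' = set0 ->
      rho (A `&` (A' `|` B')) = rho (A `&` A') + rho (A `&` B').
    move=> mA' mB' AB; rewrite setIUr rhoD//; [exact: measurableI|exact: measurableI|].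
    by rewrite setIACA AB setI0.
  rewrite (_ : C k.+1 = (C k * B k)%N)// (sum_blocks _ _ (fun j => rho (A `&` T k.+1 j))).
  under eq_bigr do rewrite (child _ (fun A' => rho (A `&` A')) _ _ rhoAD).
  by rewrite sumrMnl ih -mulrnA expnSr.
(* Listing children twice doubles their sum and the weight 2^-k undoes it, so the increments of the
   children add up to that of the parent and the total length is the same on all levels. *)
pose a k i := c * 2^-1 ^+ k * m (T k i); pose b k i := (c * 2^-1 ^+ k) *: nu (T k i).
have ck k : 0 < c * 2^-1 ^+ k by rewrite mulr_gt0// exprn_gt0// invr_gt0.
have ckS k : c * 2^-1 ^+ k = (c * 2^-1 ^+ k.+1) *+ 2 by rewrite exprS -mulr_natr; set x := _ ^+ k; field.
pose L k i := \sum_(j < i) a k j; pose G k i := \sum_(j < i) b k j.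
have LS k i : L k i.+1 - L k i = a k i by rewrite /L big_ord_recr/= addrAC subrr add0r.
have GS k i : G k i.+1 - G k i = b k i by rewrite /G big_ord_recr/= addrAC subrr add0r.
have cons k i : L k.+1 (i * B k)%N = L k i /\ G k.+1 (i * B k)%N = G k i.
  rewrite /L /G !sum_blocks; split; apply: eq_bigr => j _.
    by rewrite /a -mulr_sumr (child _ m _ _ mD) (ckS k) mulrnAr mulrnAl.
  by rewrite /b -scaler_sumr (child _ nu _ _ nuD) (ckS k) -scalerMnr scalerMnl.
exists C, B, L, G; split=> //.
- move=> k i; rewrite LS GS /a /b normrZ gtr0_norm// ler_pM2l// num//=.
  by rewrite mulrAC mulrC ler_wpM2l ?exprn_ge0// ler_pM2l// m_le.
- move=> k; split; first by rewrite /L big_ord0.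
  elim: k => [|k ih]; first by rewrite /L big_ord1 /a expr0 mulr1.
  by rewrite (_ : C k.+1 = (C k * B k)%N)// (cons k _).1.
- move=> k; have [_ ek] := hpick (C k, w k (T k), T k) (mT k).
  move: ek; rewrite /= -/(q k) -/(N k) -/(t k) => /ltW ek.
  pose g i r := `|nu (T k i `&` t k @^-1` [set r]) -
    (m (T k i `&` t k @^-1` [set r]) / m (T k i)) *: nu (T k i)|.
  have gE (i : 'I_(C k)) (j : 'I_(B k)) :
      `|b k.+1 (i * B k + j)%N - (a k.+1 (i * B k + j)%N / a k i) *: b k i| =
      (c * 2^-1 ^+ k.+1) * g i (j %/ 2)%N.
    rewrite /b /a /g TS// scalerA.
    set x := m (_ `&` _); set y := m _; set z := nu (_ `&` _); set u := nu _.
    rewrite -(gtr0_norm (ck k.+1)) -normrZ gtr0_norm// scalerBr scalerA; congr (`| _ - _ *: _|).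
    have := lt0r_neq0 (ck k); set p := c * 2^-1 ^+ k.+1; set p' := c * 2^-1 ^+ k => p'0.
    clearbody p p' x y; by rewrite invfM [p'^-1 * _]mulrC !mulrA mulfVK.
  under eq_bigr do under eq_bigr do rewrite !LS !GS.
  under eq_bigr => i _ do (under eq_bigr => j _ do rewrite gE).
  under eq_bigr do rewrite -mulr_sumr half mulrnAr -mulrnAl -(ckS k).
  rewrite -mulr_sumr -mulrA ler_pM2l//; apply: le_trans ek _.
  rewrite exchange_big/= mulr_sumr; apply: ler_sum => r _.
  rewrite mulr_sumr.
  (* The value on a cell is 2^-k times the sum of its traces on the nodes; the triangle inequality
     then bounds the defect of the cell by the weighted defects inside the nodes. *)
  have -> : nu (t k @^-1` [set val r]) = \sum_(i < C k) 2^-1 ^+ k *: nu (t k @^-1` [set val r] `&` T k i).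
    rewrite -scaler_sumr (inv _ nu k _ nuD (mt k r)).
    by rewrite -scalerMnr scalerMnl -mulr_natr natrX -exprMn mulVf ?expr1n ?scale1r.
  rewrite -sumrB; apply: le_trans (ler_norm_sum _ _ _) _; apply: ler_sum => i _.
  rewrite /g /w (setIC (T k i)).
  set X := _ `&` _.
  have -> : m X *: ((2^-1 ^+ k / m (T k i)) *: nu (T k i)) =
      2^-1 ^+ k *: ((m X / m (T k i)) *: nu (T k i)) by rewrite !scalerA mulrCA.
  by rewrite -scalerBr normrZ ger0_norm// exprn_ge0.
Qed.

End martingale_tree.

Lemma clamp_lipschitz (R : realType) (a b s t : R) :
  `|Num.max a (Num.min s b) - Num.max a (Num.min t b)| <= `|s - t|.
Proof.
wlog st : s t / s <= t.
  by move=> h; case: (leP s t) => [/h//|/ltW /h]; rewrite distrC [in X in _ <= X]distrC.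
rewrite distrC [X in _ <= X]distrC [X in _ <= X]ger0_norm ?subr_ge0// ler_norml; apply/andP.
by case: (leP t b) => ?; case: (leP s b) => ?; case: (leP a t) => ?; case: (leP a s) => ?;
  case: (leP a b) => ?; split; lra.
Qed.

Section lipschitz_extension.
Context (R : realType) (V : completeNormedModType R).

(** Choosing points of the graph within 2^-n of [t] gives Cauchy values by the Lipschitz bound.
    Clamping [t] to [a, b] first extends the curve to the whole line with the same constant. *)
Lemma lipschitz_extension (G : R -> V -> Prop) (a b : R) : a <= b ->
  (forall s t v w, G s v -> G t w -> `|v - w| <= `|s - t|) ->
  (forall t e, a <= t <= b -> 0 < e -> exists s v, G s v /\ `|s - t| < e) ->
  exists g : R -> V, (forall s t, `|g s - g t| <= `|s - t|) /\
    forall s v, G s v -> a <= s <= b -> g s = v.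
Proof.
move=> ab lipG dG.
pose cl t := Num.max a (Num.min t b).
have clab t : a <= cl t <= b by rewrite /cl le_max lexx/= ge_max ab ge_min lexx orbT.
have clE t : a <= t <= b -> cl t = t.
  by move=> /andP[ta tb]; rewrite /cl min_l// max_r.
have lipcl s t : `|cl s - cl t| <= `|s - t| by exact: clamp_lipschitz.
have e0 n : 0 < 2^-1 ^+ n :> R by rewrite exprn_gt0.
have hp0 (tn : R * nat) : exists sv, G sv.1 sv.2 /\ `|sv.1 - cl tn.1| < 2^-1 ^+ tn.2.
  by have [s [v h]] := dG _ _ (clab tn.1) (e0 tn.2); exists (s, v).
have [p hp] := choice hp0.
have dist s m t n : `|(p (s, m)).2 - (p (t, n)).2| <= `|cl s - cl t| + (2^-1 ^+ m + 2^-1 ^+ n).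
  have [g1 h1] := hp (s, m); have [g2 h2] := hp (t, n).
  apply: le_trans (lipG _ _ _ _ g1 g2) _; rewrite /= in h1 h2.
  have := ler_normD ((p (s, m)).1 - cl s) (cl s - cl t + (cl t - (p (t, n)).1)).
  have := ler_normD (cl s - cl t) (cl t - (p (t, n)).1).
  rewrite [`|cl t - _|]distrC.
  rewrite (_ : (p (s, m)).1 - cl s + _ = (p (s, m)).1 - (p (t, n)).1); last by ring.
  lra.
have c0 : 2^-1 ^+ n @[n --> \oo] --> (0 : R).
  have := @cvg_geometric R 1 2^-1; rewrite ger0_norm// invf_lt1// ltr1n => /(_ isT).
  by apply: cvg_trans; apply: near_eq_cvg; apply: nearW => n; rewrite /geometric/= mul1r.
pose g t := lim ((fun n => (p (t, n)).2) @ \oo).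
have cg t : (fun n => (p (t, n)).2) @ \oo --> g t.
  apply: cauchy_sequence_cvg => e e1.
  have /cvgrPdist_lt/(_ (e / 2)) := c0; rewrite divr_gt0// => /(_ isT) [K _ hK].
  exists K => i j Ki Kj; apply: le_lt_trans (dist t i t j) _.
  rewrite subrr normr0 add0r.
  have := hK i Ki; have := hK j Kj; rewrite /= !sub0r !normrN !(ger0_norm (ltW (e0 _))); lra.
have gE s v : G s v -> a <= s <= b -> g s = v.
  move=> Gsv sab; apply: (@cvg_unique _ (@norm_hausdorff _ V) _ _ _ _ (cg s)).
  apply/cvgrPdist_lt => e e1; have /cvgrPdist_lt/(_ e e1) := c0; apply: filterS => n.
  rewrite sub0r normrN (ger0_norm (ltW (e0 _))); apply: le_lt_trans.
  have [g1 h1] := hp (s, n); rewrite /= clE// in h1.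
  by apply: le_trans (lipG _ _ _ _ Gsv g1) _; rewrite distrC ltW.
exists g; split=> // s t; apply: le_trans (lipcl s t).
have cd : `|(p (s, n)).2 - (p (t, n)).2| @[n --> \oo] --> `|g s - g t|.
  by apply: cvg_norm; apply: cvgB; exact: cg.
have cr : `|cl s - cl t| + (2^-1 ^+ n + 2^-1 ^+ n) @[n --> \oo] --> `|cl s - cl t|.
  rewrite -[X in _ --> X]addr0 -[X in _ --> _ + X]addr0.
  by apply: cvgD; [exact: cvg_cst|apply: cvgD].
apply: (@ler_cvg_to _ _ _ _ _ _ _ _ cd cr); apply: nearW => n; exact: dist.
Qed.

End lipschitz_extension.

Section tree_curve.
Context (R : realType) (V : completeNormedModType R) (M : R)
  (C B : nat -> nat) (L : nat -> nat -> R) (G : nat -> nat -> V).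
Context (CS : forall k, C k.+1 = (C k * B k)%N)
  (cons : forall k i, L k.+1 (i * B k)%N = L k i /\ G k.+1 (i * B k)%N = G k i)
  (lip : forall k i, `|G k i.+1 - G k i| <= L k i.+1 - L k i <= 2^-1 ^+ k * M)
  (ends : forall k, L k 0%N = 0 /\ L k (C k) = M).

Lemma tree_nondecreasing k i j : (i <= j)%N -> L k i <= L k j.
Proof.
move=> ij; rewrite -(subnKC ij); elim: (j - i)%N => [|n ih]; first by rewrite addn0.
apply: le_trans ih _; rewrite addnS -subr_ge0.
by have /andP[h _] := lip k (i + n); apply: le_trans h.
Qed.

Let lip_level k i j : (i <= j)%N -> `|G k j - G k i| <= L k j - L k i.
Proof.
move=> ij; rewrite -(subnKC ij); elim: (j - i)%N => [|n ih].
  by rewrite addn0 !subrr normr0.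
rewrite addnS; have /andP[h _] := lip k (i + n).
have := ler_normD (G k (i + n).+1 - G k (i + n)) (G k (i + n) - G k i).
by rewrite addrA subrK; lra.
Qed.

(** An endpoint of index i persists on the next level with index i times [B]. Endpoints of two
    different levels can thus be compared on a common one. *)
Let refine k l i : (i <= C k)%N ->
  exists j, [/\ (j <= C (k + l))%N, L (k + l) j = L k i & G (k + l) j = G k i].
Proof.
move=> iC; elim: l => [|l [j [jC <- <-]]]; first by exists i; rewrite addn0.
have [h1 h2] := cons (k + l) j.
by exists (j * B (k + l))%N; rewrite addnS CS leq_mul2r jC orbT.
Qed.

Lemma tree_curve : 0 <= M -> exists g : R -> V, (forall s t, `|g s - g t| <= `|s - t|) /\
  forall k i, (i <= C k)%N -> g (L k i) = G k i.
Proof.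
move=> M0.
pose P s v := exists k i, [/\ (i <= C k)%N, s = L k i & v = G k i].
have [||g [lg gE]] := @lipschitz_extension R V P 0 M M0.
- move=> _ _ _ _ [k [i [iC -> ->]]] [l [j [jC -> ->]]].
  have [i' [_ <- <-]] := refine l iC; have [j' [_ <- <-]] := refine k jC.
  rewrite addnC; have [ij|/ltnW ij] := leqP i' j'; last first.
    by apply: le_trans (lip_level _ ij) _; exact: ler_norm.
  by rewrite distrC [in X in _ <= X]distrC; apply: le_trans (lip_level _ ij) _; exact: ler_norm.
- move=> t e /andP[t0 tM] e0.
  have c0 : 2^-1 ^+ n * M @[n --> \oo] --> (0 : R).
    have := @cvg_geometric R M 2^-1; rewrite ger0_norm// invf_lt1// ltr1n => /(_ isT).
    by apply: cvg_trans; apply: near_eq_cvg; apply: nearW => n; rewrite /geometric/= mulrC.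
  have /cvgrPdist_lt/(_ e e0) [k _ /(_ k (leqnn k))] := c0.
  rewrite /= sub0r normrN => hk.
  (* Intervals of level k have length at most 2^-k M, so the left end of the one containing [t] is
     close enough. *)
  suff [i iC hi] : exists2 i, (i <= C k)%N & `|L k i - t| <= 2^-1 ^+ k * M.
    exists (L k i), (G k i); split; first by exists k, i.
    by apply: le_lt_trans hi _; apply: le_lt_trans hk; exact: ler_norm.
  have : t <= L k (C k) by rewrite (ends k).2.
  elim: (C k) => [|n ih] tn.
    exists 0%N => //; have := (ends k).1 => h; rewrite h in tn *.
    by rewrite (_ : t = 0) ?subrr ?normr0 ?mulr_ge0 ?exprn_ge0//; apply/eqP; rewrite eq_le tn t0.
  have [tL|tL] := leP t (L k n).
    by have [i iC hi] := ih tL; exists i => //; exact: leqW.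
  exists n => //; have /andP[_ h] := lip k n; rewrite ler0_norm; lra.
exists g; split=> // k i iC; apply: gE; first by exists k, i.
have [h1 h2] := ends k; by rewrite -h1 -h2 !tree_nondecreasing.
Qed.

End tree_curve.

(** * Martingale oscillation *)

Section tree_oscillation.
Context {R : realType} (M : R) (C B : nat -> nat) (L : nat -> nat -> R).
Context (CS : forall k, C k.+1 = (C k * B k)%N)
  (consL : forall k i, L k.+1 (i * B k)%N = L k i)
  (monoL : forall k i, L k i <= L k i.+1)
  (ends : forall k, L k 0%N = 0 /\ L k (C k) = M).
Implicit Types (V : normedModType R).

(** The L^1 distance between consecutive terms of the martingale of mean slopes of [F]: child length
    times the difference of child and parent slope, summed in norm. Multiplying the length in avoids
    a division by a child of length 0. *)
Definition tree_oscillation V (F : R -> V) k := \sum_(i < C k) \sum_(j < B k)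
  `|(F (L k.+1 (i * B k + j)%N.+1) - F (L k.+1 (i * B k + j)%N)) -
    ((L k.+1 (i * B k + j)%N.+1 - L k.+1 (i * B k + j)%N) / (L k i.+1 - L k i)) *:
      (F (L k i.+1) - F (L k i))|.
Local Notation osc := tree_oscillation.

Let L_le k i j : (i <= j)%N -> L k i <= L k j.
Proof.
move=> ij; rewrite -(subnKC ij); elim: (j - i)%N => [|n ih]; first by rewrite addn0.
by rewrite addnS; exact: le_trans ih (monoL _ _).
Qed.

Let L_itv k i : (i <= C k)%N -> 0 <= L k i <= M.
Proof. by move=> iC; have [<- <-] := ends k; rewrite !L_le. Qed.

Let child_bound k i j : (i < C k)%N -> (j < B k)%N -> (i * B k + j < C k.+1)%N.
Proof.
move=> iC jB; rewrite CS; apply: (@leq_trans (i.+1 * B k)); last by rewrite leq_mul2r iC orbT.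
by rewrite mulSnr ltn_add2l.
Qed.

Let children (W : zmodType) (F : R -> W) k i :
  \sum_(j < B k) (F (L k.+1 (i * B k + j)%N.+1) - F (L k.+1 (i * B k + j)%N)) =
  F (L k i.+1) - F (L k i).
Proof.
rewrite -(big_mkord xpredT (fun j => F (L k.+1 (i * B k + j)%N.+1) - F (L k.+1 (i * B k + j)%N))).
under eq_bigr do rewrite -addnS.
rewrite (telescope_sumr (fun j => F (L k.+1 (i * B k + j)%N)))// addn0.
by rewrite -mulSnr !consL.
Qed.

Let leaves (W : zmodType) (F : R -> W) k :
  \sum_(i < C k) (F (L k i.+1) - F (L k i)) = F M - F 0.
Proof.
rewrite -(big_mkord xpredT (fun i => F (L k i.+1) - F (L k i))).
by rewrite (telescope_sumr (fun i => F (L k i)))//; have [-> ->] := ends k.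
Qed.

Let theta_ge0 k i j :
  0 <= (L k.+1 (i * B k + j)%N.+1 - L k.+1 (i * B k + j)%N) / (L k i.+1 - L k i).
Proof. by rewrite divr_ge0// subr_ge0. Qed.

Lemma tree_oscillationD V (F H : R -> V) k : osc (fun t => F t + H t) k <= osc F k + osc H k.
Proof.
rewrite /osc -big_split/=; apply: ler_sum => i _; rewrite -big_split/=; apply: ler_sum => j _.
have D (x y z t : V) : (x + y) - (z + t) = (x - z) + (y - t) by rewrite opprD addrACA.
by rewrite D [F _ + _ - _]D scalerDr D ler_normD.
Qed.

Lemma tree_oscillationZ V (c : R) (F : R -> V) k : osc (fun t => c *: F t) k = `|c| * osc F k.
Proof.
rewrite /osc mulr_sumr; apply: eq_bigr => i _; rewrite mulr_sumr; apply: eq_bigr => j _.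
by rewrite -!scalerBr (scalerA _ c) (mulrC _ c) -(scalerA c) -scalerBr normrZ.
Qed.

Lemma tree_oscillation_scale V (F : R -> R^o) (v : V) k :
  osc (fun t => F t *: v) k = osc F k * `|v|.
Proof.
rewrite /osc mulr_suml; apply: eq_bigr => i _; rewrite mulr_suml; apply: eq_bigr => j _.
by rewrite -!scalerBl scalerA -scalerBl normrZ.
Qed.

Lemma tree_oscillation_sum V (I : Type) (r : seq I) (F : I -> R -> V) k :
  osc (fun t => \sum_(x <- r) F x t) k <= \sum_(x <- r) osc (F x) k.
Proof.
elim: r => [|x r ih].
  rewrite big_nil /osc big1// => i _; rewrite big1// => j _.
  by rewrite !big_nil !subrr scaler0 subrr normr0.
rewrite big_cons (_ : (fun t => _) = fun t => F x t + \sum_(y <- r) F y t).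
  by apply: le_trans (tree_oscillationD _ _ _) _; rewrite lerD2l.
by apply/funext => t; rewrite big_cons.
Qed.

(** The increments of the children and the shares of the parents each contribute at most the total
    increment of [E], hence the factor 2. *)
Lemma tree_oscillation_le V (F : R -> V) (E : R -> R) k :
  (forall s t, 0 <= s -> s <= t -> t <= M -> `|F t - F s| <= E t - E s) ->
  osc F k <= 2 * (E M - E 0).
Proof.
move=> FE.
have FE' l i : (i < C l)%N -> `|F (L l i.+1) - F (L l i)| <= E (L l i.+1) - E (L l i).
  move=> iC; have /andP[h1 _] := L_itv (ltnW iC); have /andP[_ h2] := L_itv iC.
  exact: FE.
rewrite -(leaves E k) mulr_sumr; apply: ler_sum => i _.
set x := E _ - E _; have x0 : 0 <= x by apply: le_trans (FE' k i (ltn_ord i)).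
apply: (@le_trans _ _ (\sum_(j < B k) ((E (L k.+1 (i * B k + j)%N.+1) - E (L k.+1 (i * B k + j)%N)) +
    (L k.+1 (i * B k + j)%N.+1 - L k.+1 (i * B k + j)%N) / (L k i.+1 - L k i) * x))).
  apply: ler_sum => j _; apply: le_trans (ler_normB _ _) _; apply: lerD.
    by apply: FE'; exact: child_bound.
  by rewrite normrZ ger0_norm// ler_wpM2l// FE'.
rewrite big_split/= children -/x mulr2n mulrDl mul1r lerD2l -mulr_suml -mulr_suml (children id).
have [->|h] := eqVneq (L k i.+1 - L k i) 0; first by rewrite mul0r mul0r.
by rewrite divff// mul1r.
Qed.

(** Summed over the children y, q of a parent x, p, the last two terms collapse to -x^2/p: this is
    the orthogonality of martingale increments. The two implications settle intervals of length 0
    under the convention 1/0 = 0. *)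
Let energy_identity (x y p q : R) (pi := q / p) : (p = 0 -> x = 0) -> (q = 0 -> y = 0) ->
  (y - pi * x) ^+ 2 / q = y ^+ 2 / q - 2 * (x / p) * y + q * (x ^+ 2 / p ^+ 2).
Proof.
rewrite /pi => px qy; have [p0|p0] := eqVneq p 0.
  by rewrite (px p0) p0 invr0 !(mulr0, mul0r, subr0, addr0) expr0n/= !(mulr0, mul0r, addr0).
have [q0|q0] := eqVneq q 0; last by field; rewrite p0 q0.
by rewrite (qy q0) q0 invr0 !(mulr0, mul0r, subr0, addr0).
Qed.

(* The energies [\sum_i (dF_i)^2 / dL_i] increase with the level, are bounded, and their
   increments control the oscillation. *)
Lemma tree_oscillation_cvg (F : R -> R^o) (K : R) :
  (forall s t, 0 <= s -> s <= t -> t <= M -> `|F t - F s| <= K * (t - s)) ->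
  osc F k @[k --> \oo] --> (0 : R).
Proof.
move=> FK.
have FK' l i : (i < C l)%N -> `|F (L l i.+1) - F (L l i)| <= K * (L l i.+1 - L l i).
  move=> iC; have /andP[h1 _] := L_itv (ltnW iC); have /andP[_ h2] := L_itv iC.
  exact: FK.
have F0 l i : (i < C l)%N -> L l i.+1 - L l i = 0 -> F (L l i.+1) - F (L l i) = 0.
  by move=> iC l0; apply/eqP; rewrite -normr_le0; apply: le_trans (FK' _ _ iC) _; rewrite l0 mulr0.
pose a k := \sum_(i < C k) ((F (L k i.+1) - F (L k i)) ^+ 2 / (L k i.+1 - L k i)).
pose z k i j := ((F (L k.+1 (i * B k + j)%N.+1) - F (L k.+1 (i * B k + j)%N)) -
    ((L k.+1 (i * B k + j)%N.+1 - L k.+1 (i * B k + j)%N) / (L k i.+1 - L k i)) *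
      (F (L k i.+1) - F (L k i))) ^+ 2 / (L k.+1 (i * B k + j)%N.+1 - L k.+1 (i * B k + j)%N).
have z0 k i j : 0 <= z k i j by rewrite /z divr_ge0 ?sqr_ge0// subr_ge0.
have zE k : \sum_(i < C k) \sum_(j < B k) z k i j = a k.+1 - a k.
  rewrite /a [in RHS]CS (sum_blocks _ _ (fun i => (F (L k.+1 i.+1) - F (L k.+1 i)) ^+ 2 / (L k.+1 i.+1 - L k.+1 i))).
  rewrite -sumrB; apply: eq_bigr => i _.
  have zi (j : 'I_(B k)) := energy_identity (F0 k i (ltn_ord i)) (F0 _ _ (child_bound (ltn_ord i) (ltn_ord j))).
  rewrite /z; under eq_bigr do rewrite zi.
  rewrite big_split/= sumrB -mulr_sumr -mulr_suml (children F) (children id).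
  set x := F _ - F _; set p := L _ _ - L _ _.
  have [p0|p0] := eqVneq p 0; first by rewrite p0 invr0 !(mul0r, mulr0, addr0).
  by rewrite -addrA; congr (_ + _); field.
have aS k : a k <= a k.+1.
  by rewrite -subr_ge0 -zE; apply: sumr_ge0 => i _; exact: sumr_ge0.
have aM k : a k <= K ^+ 2 * M.
  have -> : M = \sum_(i < C k) (L k i.+1 - L k i) by rewrite (leaves id) subr0.
  rewrite mulr_sumr; apply: ler_sum => i _.
  have h := FK' k i (ltn_ord i); have p0 : 0 <= L k i.+1 - L k i by rewrite subr_ge0.
  move: h p0; set x := F _ - F _; set p := L _ _ - L _ _ => h p0.
  have [->|p1] := eqVneq p 0; first by rewrite invr0 !mulr0.
  rewrite ler_pdivrMr ?lt0r ?p1// -mulrA -expr2 -exprMn -real_normK ?num_real//.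
  by rewrite lerXn2r// nnegrE// (le_trans _ h).
have ca : cvgn a.
  apply: nondecreasing_is_cvgn; first exact/nondecreasing_seqP.
  by exists (K ^+ 2 * M) => _ [k _ <-].
have da : a k.+1 - a k @[k --> \oo] --> (0 : R).
  by rewrite -(subrr (limn a)); apply: cvgB => //; rewrite (cvg_shiftS a).
have M0 : 0 <= M by have /andP[h1 h2] := L_itv (leq0n (C 0%N)); exact: le_trans h1 h2.
(* A weighted arithmetic-geometric inequality |t| <= t^2/(eta q) + eta q for each child of length q
   replaces the Cauchy-Schwarz inequality; the lengths sum to [M]. *)
have oscle (eta : R) k : 0 < eta -> osc F k <= eta^-1 * (a k.+1 - a k) + eta * M.
  move=> eta0; rewrite -zE -[M]subr0 -(leaves id k) !mulr_sumr -big_split/=.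
  apply: ler_sum => i _; rewrite -[X in _ + eta * X](children id k i) !mulr_sumr -big_split/=.
  apply: ler_sum => j _; rewrite /z.
  have q0 : 0 <= L k.+1 (i * B k + j)%N.+1 - L k.+1 (i * B k + j)%N by rewrite subr_ge0.
  have y0 := F0 _ _ (child_bound (ltn_ord i) (ltn_ord j)).
  move: q0 y0; set q := L _ _ - L _ _; set y := F _ - F _ => q0 y0.
  have [qq|qq] := eqVneq q 0.
    by rewrite (y0 qq) qq mul0r scale0r subrr normr0 invr0 !mulr0 addr0.
  set t := y - _.
  have q1 : 0 < q by rewrite lt0r qq.
  rewrite (_ : (y - _) ^+ 2 = `|t| ^+ 2); last by rewrite real_normK ?num_real.
  set n := `|t|; have n0 : 0 <= n by rewrite /n.
  rewrite -(ler_pM2r (mulr_gt0 eta0 q1)).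
  have -> : (eta^-1 * (n ^+ 2 / q) + eta * q) * (eta * q) = n ^+ 2 + (eta * q) ^+ 2.
    by field; rewrite lt0r_neq0//= lt0r_neq0.
  have := mulr_gt0 eta0 q1; move: (eta * q) => r r0.
  have := sqr_ge0 (n - r); rewrite sqrrB.
  have := mulr_ge0 n0 (ltW r0); lra.
have osc0 k : 0 <= osc F k by apply: sumr_ge0 => i _; exact: sumr_ge0.
apply/cvgrPdist_lt => e e0.
pose eta := e / (2 * (M + 1)).
have eta0 : 0 < eta by rewrite divr_gt0// mulr_gt0//; lra.
have etaM : eta * M <= e / 2.
  rewrite /eta mulrAC ler_pdivrMr; last by rewrite mulr_gt0//; lra.
  have -> : e / 2 * (2 * (M + 1)) = e * (M + 1) by field.
  by rewrite ler_pM2l//; lra.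
have e20 : 0 < e / 2 by rewrite divr_gt0.
have /cvgrPdist_lt/(_ _ (mulr_gt0 eta0 e20)) := da.
apply: filterS => k; rewrite sub0r normrN ger0_norm ?subr_ge0// => hk.
rewrite sub0r normrN ger0_norm//; apply: le_lt_trans (oscle _ k eta0) _.
have : eta^-1 * (a k.+1 - a k) < e / 2 by rewrite mulrC ltr_pdivrMr// mulrC.
lra.
Qed.

End tree_oscillation.

Section tree_density.
Context d (S : measurableType d) (R : realType) (V : completeNormedModType R)
  (mu : {measure set S -> \bar R}) (cmu : measure_is_complete mu).
Context (M : R) (C B : nat -> nat) (L : nat -> nat -> R).
Context (CS : forall k, C k.+1 = (C k * B k)%N)
  (consL : forall k i, L k.+1 (i * B k)%N = L k i)
  (monoL : forall k i, L k i <= L k i.+1)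
  (ends : forall k, L k 0%N = 0 /\ L k (C k) = M).
Context (slab : R -> R -> set S) (c0 : R) (c0_gt0 : 0 < c0)
  (mslab : forall a b, measurable (slab a b))
  (slabU : forall a m b, a <= m -> m <= b ->
    slab a b = slab a m `|` slab m b /\ slab a m `&` slab m b = set0)
  (slab_mu : forall a b, a <= b -> mu (slab a b) = (c0 * (b - a))%:E).
Local Notation osc := (tree_oscillation C B L).

Let slab_int (g : S -> R) s t : 0 <= s -> s <= t -> t <= M ->
  mu.-integrable (slab 0 M) (EFin \o g) ->
  \int[mu]_(x in slab 0 t) g x - \int[mu]_(x in slab 0 s) g x = \int[mu]_(x in slab s t) g x.
Proof.
move=> s0 st tM ig; have [U1 I1] := slabU s0 st; have [U2 I2] := slabU (le_trans s0 st) tM.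
have i1 : mu.-integrable (slab 0 t) (EFin \o g).
  by apply: integrableS ig => //; rewrite U2; exact: subsetUl.
rewrite U1 Rintegral_setU//; [by rewrite addrAC subrr add0r|by rewrite -U1|].
by apply/disj_setPS; rewrite I1.
Qed.

(** Up to a constant, [c0 *: g] is the primitive of [w] along the slabs. With [w] split into a
    simple function and a remainder small in L^1, the primitive of the former has vanishing
    oscillation by the real case, and that of the latter at most twice the L^1 norm. *)
Lemma tree_density_oscillation (w : S -> V) (g : R -> V) : 0 <= M ->
  bochner_L1 mu (slab 0 M) w ->
  (forall (f : {linear V -> R^o}) s t, (forall x, `|f x| <= `|x|) -> 0 <= s -> s <= t -> t <= M ->
    \int[mu]_(x in slab s t) f (w x) = c0 * f (g t - g s)) ->
  osc g k @[k --> \oo] --> (0 : R).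
Proof.
move=> M0 L1w wg; pose Q := slab 0 M; have mQ : measurable Q by exact: mslab.
have subQ s t : 0 <= s -> s <= t -> t <= M -> slab s t `<=` Q.
  move=> s0 st tM; have [U1 _] := slabU s0 st; have [U2 _] := slabU (le_trans s0 st) tM.
  by rewrite /Q U2 U1 => x h; left; right.
have osc0 k F : 0 <= osc (F : R -> V) k by apply: sumr_ge0 => i _; exact: sumr_ge0.
have [v [smw [s_ [ss sw _]]]] := bochner_L1_integral_ex cmu mQ L1w.
apply/cvgrPdist_le => e e0.
(* [tree_oscillation_le] doubles this error, which leaves c0 (e/2) for the simple part; the factor
   [c0] is divided out at the end. *)
have e8 : 0 < c0 * (e / 4) by rewrite mulr_gt0// divr_gt0.
have /fine_cvgP[fin cfin] := sw.
have /cvgrPdist_le/(_ _ e8) hfin := cfin.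
have [K [finK hK]] : exists K, (\int[mu]_(x in Q) `|w x - s_ K x|%:E)%E \is a fin_num /\
    `|0 - fine (\int[mu]_(x in Q) `|w x - s_ K x|%:E)%E| <= c0 * (e / 4).
  have [K1 _ h1] := fin; have [K2 _ h2] := hfin.
  by exists (maxn K1 K2); split; [apply: h1|apply: h2]; rewrite /= leq_max leqnn ?orbT.
pose s := s_ K; have sK : simple_function s by have [] := ss K.
have sfin z : z != 0 -> (mu (Q `&` s @^-1` [set z]) < +oo)%E by have [_] := ss K; exact.
pose r x := `|w x - s x|.
have smr : strongly_measurable mu Q (fun x => w x - s x).
  by apply: strongly_measurableB => //; exact: simple_strongly_measurable.
have ir : mu.-integrable Q (EFin \o r).
  apply/integrable_realP; split; first exact: (strongly_measurable_norm cmu mQ smr).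
  by under eq_integral do rewrite normr_id; rewrite ltey_eq finK.
have ifw (f : {linear V -> R^o}) : (forall x, `|f x| <= `|x|) ->
    mu.-integrable Q (EFin \o (fun x => f (w x))).
  move=> f1; apply/integrable_realP; split.
    by apply: (strongly_measurable_measurable_comp cmu mQ (le1_functional_continuous f1)).
  by have [sm L1] := L1w; exact: (functional_L1 cmu mQ f1 sm L1).
have ifws (f : {linear V -> R^o}) : (forall x, `|f x| <= `|x|) ->
    mu.-integrable Q (EFin \o (fun x => f (w x - s x))).
  move=> f1; apply: (le_integrable_real mQ _ ir) => [|x _]; last exact: f1.
  by apply: (strongly_measurable_measurable_comp cmu mQ (le1_functional_continuous f1)).
pose A z := s @^-1` [set z]; pose q := finmap.enum_fset (fset_set (range s)).
have mA z : measurable (A z) by have [_] := sK; exact.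
pose F z t := \int[mu]_(x in slab 0 t) (\1_(A z) x : R).
have i1 : mu.-integrable Q (EFin \o cst 1).
  apply/integrable_realP; split; first exact: measurable_cst.
  rewrite (eq_integral (cst 1%E)); last by move=> x _ /=; rewrite normr1.
  by rewrite integral_cst// mul1e slab_mu// ltry.
have iA z : mu.-integrable Q (EFin \o (\1_(A z) : S -> R)).
  apply: (le_integrable_real mQ _ i1) => [|x _]; first exact: measurable_indic.
  by rewrite indicE normr_nat lern1 leq_b1.
(* The primitive of [s] along the slabs: finitely many vectors with real Lipschitz coefficients, to
   which [tree_oscillation_cvg] applies one by one. *)
pose P t := \sum_(z <- q) F z t *: z.
have FE z t t' : 0 <= t -> t <= t' -> t' <= M -> `|F z t' - F z t| <= c0 * (t' - t).
  move=> t0 tt' tM; rewrite /F slab_int//.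
  have -> : c0 * (t' - t) = \int[mu]_(x in slab t t') 1.
    by rewrite Rintegral_cst//= slab_mu//= mul1r.
  apply: le_normr_Rintegral_dom => //.
  - by apply: (integrableS mQ) => //; exact: subQ.
  - by move=> x _; rewrite indicE normr_nat lern1 leq_b1.
have cP : osc P k @[k --> \oo] --> (0 : R).
  apply: (@squeeze_cvgr _ _ _ _ (fun=> 0) (fun k => \sum_(z <- q) osc (F z : R -> R^o) k * `|z|)).
  - apply: nearW => k; rewrite osc0/=.
    apply: le_trans (tree_oscillation_sum _ _ _ _ _ _) _.
    by apply: ler_sum => z _; rewrite tree_oscillation_scale.
  - exact: cvg_cst.
  - rewrite [X in _ --> X](_ : 0 = \sum_(z <- q) 0 * `|z|); last by rewrite big1// => z _; rewrite mul0r.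
    apply: cvg_big => [|z _]; first by move=> x; apply: cvgD; [exact: cvg_fst|exact: cvg_snd].
    apply: cvgMl; exact: (tree_oscillation_cvg CS consL monoL ends (FE z)).
have PE (f : {linear V -> R^o}) t t' : (forall x, `|f x| <= `|x|) -> 0 <= t -> t <= t' -> t' <= M ->
    f (P t' - P t) = \int[mu]_(x in slab t t') f (s x).
  move=> f1 t0 tt' tM.
  have mt : measurable (slab t t') by exact: mslab.
  have iAt z : mu.-integrable (slab t t') (EFin \o (\1_(A z) : S -> R)).
    by apply: integrableS (iA z) => //; exact: subQ.
  have [_ hs] := Rintegral_sum q mt (fun z => integrable_realZ (f z) mt (iAt z)).
  under [RHS]eq_Rintegral do rewrite (simple_expand f _ sK).
  rewrite hs /P -sumrB linear_sum; apply: eq_bigr => z _.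
  by rewrite -scalerBl linearZ/= /F slab_int// RintegralZl// mulrC.
pose E t := \int[mu]_(x in slab 0 t) r x.
have oH k : osc (fun t => c0 *: g t - P t) k <= 2 * (E M - E 0).
  apply: (tree_oscillation_le CS consL monoL ends) => t t' t0 tt' tM.
  rewrite /E slab_int//; apply: norm_le_functional => f f1.
  rewrite (_ : _ - _ = c0 *: (g t' - g t) - (P t' - P t)); last first.
    by rewrite scalerBr !opprB [LHS]addrACA [RHS]addrACA; congr (_ + _); exact: addrC.
  have -> : f (c0 *: (g t' - g t) - (P t' - P t)) = c0 * f (g t' - g t) - f (P t' - P t) :> R.
    by rewrite linearB [f (c0 *: _)]linearZ.
  rewrite -wg// PE// -RintegralB//; first last.
  - apply: (integrableS mQ) => //; first exact: subQ.
    have := integrable_realB mQ (ifw f f1) (ifws f f1); apply: eq_integrable_real => x.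
    by rewrite linearB/= opprB addrC subrK.
  - by apply: (integrableS mQ) => //; [exact: subQ|exact: ifw].
  apply: (le_normr_Rintegral_dom (g := r)) => //.
  - have /integrable_realP[h _] := ifws f f1.
    rewrite (_ : (fun x => _) = fun x => f (w x - s x)); last by apply/funext => x; rewrite linearB.
    by apply: measurable_funS h => //; exact: subQ.
  - by apply: (integrableS mQ) => //; exact: subQ.
  - by move=> x _; rewrite -linearB; exact: f1.
have EM : E M - E 0 <= c0 * (e / 4).
  rewrite /E slab_int//; move: hK; rewrite sub0r normrN; apply: le_trans; exact: ler_norm.
have /cvgrPdist_le/(_ (c0 * (e / 2))) := cP.
rewrite mulr_gt0 ?divr_gt0// => /(_ isT); apply: filterS => k.
rewrite !sub0r !normrN !ger0_norm// => hP.
rewrite -(ler_pM2l c0_gt0) -[X in X * osc g k](gtr0_norm c0_gt0) -tree_oscillationZ.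
rewrite (_ : (fun t => c0 *: g t) = fun t => (c0 *: g t - P t) + P t); last first.
  by apply/funext => t; rewrite subrK.
apply: le_trans (tree_oscillationD _ _ _ _ _ _) _.
have := oH k; have := EM; have := hP; lra.
Qed.

End tree_density.

(** * Weak limits of bounded kernels *)

Lemma norm_clip_le (R : realType) (c t : R) : 0 <= c -> `|Num.max (- c) (Num.min t c)| <= c.
Proof.
move=> c0; rewrite ler_norml; apply/andP.
by case: (leP t c) => ?; case: (leP (- c) t) => ?; case: (leP (- c) c) => ?; split; lra.
Qed.

Lemma uniform_double_limit (R : realType) (x : nat -> R) (y : nat -> nat -> R) (e : nat -> R) :
  e @ \oo --> 0 -> (forall k i, `|x i - y k i| <= e k) -> (forall k, cvgn (y k)) ->
  cvgn x /\ limn (y k) @[k --> \oo] --> limn x.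
Proof.
move=> e0 xy cy.
have cx : cvgn x.
  apply: (@cauchy_sequence_cvg R R^o) => eps eps0.
  have e30 : 0 < eps / 3 by rewrite divr_gt0.
  have /cvgrPdist_lt/(_ _ e30) [k _ /(_ k (leqnn k))] := e0; rewrite /= sub0r normrN => ek.
  have ek' := le_lt_trans (ler_norm _) ek.
  have e60 : 0 < eps / 6 by rewrite divr_gt0.
  have /cvgrPdist_lt/(_ _ e60) [N _ hN] := cy k.
  exists N => i j Ni Nj.
  have hi := hN i Ni; have hj := hN j Nj; rewrite /= in hi hj.
  have xi := xy k i; have xj := xy k j.
  have h1 := ler_normD (x i - y k i) (y k i - x j).
  have h2 := ler_normD (y k i - limn (y k)) (limn (y k) - x j).
  have h3 := ler_normD (limn (y k) - y k j) (y k j - x j).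
  rewrite !addrA !subrK in h1 h2 h3; rewrite (distrC (y k i) (limn _)) in h2.
  rewrite (distrC (y k j) (x j)) in h3; lra.
split=> //; apply/cvgrPdist_le => eps eps0.
have /cvgrPdist_le/(_ eps eps0) := e0; apply: filterS => k; rewrite sub0r normrN => ek.
apply: le_trans ek; apply: le_trans (ler_norm _).
have c : `|x i - y k i| @[i --> \oo] --> `|limn x - limn (y k)|.
  by apply: cvg_norm; apply: cvgB => //; exact: cy.
rewrite -(cvg_lim (@norm_hausdorff _ R^o) c); apply: limr_le; first by apply/cvg_ex; eexists; exact: c.
by apply: nearW => i; exact: xy.
Qed.

Section weak_limits.
Context d (S : measurableType d) (R : realType) (mu : {measure set S -> \bar R})
  (K : nat -> S -> R) (M : R).
Context (M0 : 0 <= M) (mK : forall i, measurable_fun setT (K i)) (KM : forall i x, `|K i x| <= M).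

Lemma integrable_kernel (f : S -> R) i : mu.-integrable setT (EFin \o f) ->
  mu.-integrable setT (EFin \o (fun x => f x * K i x)).
Proof.
move=> if_; have [mf _] := (integrable_realP mu setT f).1 if_.
apply: (le_integrable_real measurableT _ (integrable_realZ M measurableT (integrable_real_norm measurableT if_))).
  exact: (measurable_funM mf (mK i)).
by move=> x _; rewrite normrM mulrC ler_wpM2r.
Qed.

Lemma weak_limit_linear (a lf lg : R) (f g : S -> R) : mu.-integrable setT (EFin \o f) ->
  mu.-integrable setT (EFin \o g) ->
  \int[mu]_x (f x * K i x) @[i --> \oo] --> lf -> \int[mu]_x (g x * K i x) @[i --> \oo] --> lg ->
  \int[mu]_x ((a * f x + g x) * K i x) @[i --> \oo] --> a * lf + lg.
Proof.
move=> if_ ig cf cg.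
have -> : (fun i => \int[mu]_x ((a * f x + g x) * K i x)) =
    fun i => a * \int[mu]_x (f x * K i x) + \int[mu]_x (g x * K i x).
  apply/funext => i; rewrite -RintegralZl//; last exact: integrable_kernel.
  rewrite -RintegralD//; [|exact: (integrable_realZ a measurableT (integrable_kernel i if_))|exact: integrable_kernel].
  by apply: eq_Rintegral => x _; rewrite mulrDl mulrA.
by apply: cvgD => //; apply: cvgMr.
Qed.

(** The kernels share the bound [M], so replacing [f] by [f_ k] costs at most [M] times their L^1
    distance for all i at once, and the two limits may be exchanged. *)
Lemma weak_limit_dominated (f_ : nat -> S -> R) (f G : S -> R) :
  (forall k, measurable_fun setT (f_ k)) -> measurable_fun setT f ->
  mu.-integrable setT (EFin \o G) -> (forall k x, `|f_ k x| <= G x) -> (forall x, `|f x| <= G x) ->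
  {ae mu, forall x, f_ ^~ x @ \oo --> f x} ->
  (forall k, cvgn (fun i => \int[mu]_x (f_ k x * K i x))) ->
  cvgn (fun i => \int[mu]_x (f x * K i x)) /\
  limn (fun i => \int[mu]_x (f_ k x * K i x)) @[k --> \oo] --> limn (fun i => \int[mu]_x (f x * K i x)).
Proof.
move=> mf_ mf iG fG_ fG ff cf.
have if_ := le_integrable_real measurableT mf iG (fun x _ => fG x).
have ifk k := le_integrable_real measurableT (mf_ k) iG (fun x _ => fG_ k x).
have mdiff k : measurable_fun setT (fun x => `|f x - f_ k x|).
  by apply: measurableT_comp => //; exact: measurable_funB.
have idiff k : mu.-integrable setT (EFin \o (fun x => `|f x - f_ k x|)).
  exact: (integrable_real_norm measurableT (integrable_realB measurableT if_ (ifk k))).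
have lim0 : M * \int[mu]_x `|f x - f_ k x| @[k --> \oo] --> (0 : R).
  rewrite -(mulr0 M); apply: cvgMr.
  have [|||||_] := @dominated_Rintegral _ _ _ mu setT (fun k x => `|f x - f_ k x|) (cst 0) (fun x => 2 * G x) measurableT.
  - exact: mdiff.
  - exact: measurable_cst.
  - exact: integrable_realZ.
  - apply: (ae_imply ff) => x fx _.
    have : `|f x - f_ k x| @[k --> \oo] --> `|f x - f x|.
      by apply: cvg_norm; apply: cvgB => //; exact: cvg_cst.
    by rewrite subrr normr0.
  - apply: aeW => x _ k; rewrite normr_id; apply: le_trans (ler_normB _ _) _.
    by have := fG x; have := fG_ k x; lra.
  by rewrite Rintegral_cst// mul0r.
apply: (uniform_double_limit lim0) => // k i.
rewrite -RintegralB//; [|exact: integrable_kernel|exact: integrable_kernel].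
rewrite -RintegralZl//.
apply: (le_normr_Rintegral_dom measurableT _ (integrable_realZ M measurableT (idiff k))).
  by apply: measurable_funB; exact: measurable_funM.
by move=> x _; rewrite -mulrBl normrM mulrC ler_wpM2r.
Qed.

Context (O : set S) (mO : measurable O) (muO : (mu O < +oo)%E).

Let iO (c : R) : mu.-integrable setT (EFin \o (fun x => c * \1_O x)).
Proof.
apply: integrable_realZ => //; apply/integrable_realP; split; first exact: measurable_indic.
under eq_integral do rewrite ger0_norm//.
by rewrite integral_indic// setIT.
Qed.

Let iI (A : set S) : measurable A -> mu.-integrable setT (EFin \o (\1_(A `&` O) : S -> R)).
Proof.
move=> mA; apply: (le_integrable_real measurableT _ (iO 1)).
  by apply: measurable_indic; exact: measurableI.
by move=> x _; rewrite mul1r indicI ger0_norm ?mulr_ge0//= ler_piMl// indicE lern1 leq_b1.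
Qed.

(** The limits on sets are additive and dominated by [M] times the measure of the part in [O], hence
    have a real density [D]; finite combinations and an exchange of limits extend the convergence to
    bounded functions. *)
Lemma weak_density : sigma_finite setT mu ->
  (forall A, measurable A -> cvgn (fun i => \int[mu]_x (\1_(A `&` O) x * K i x))) ->
  exists D : S -> R, [/\ measurable_fun setT D, forall x, `|D x| <= M * \1_O x &
    forall (f : S -> R) c, measurable_fun setT f -> (forall x, `|f x| <= c) ->
      \int[mu]_x ((f x * \1_O x) * K i x) @[i --> \oo] --> \int[mu]_x (f x * D x)].
Proof.
move=> sf cA.
pose nu A := limn (fun i => \int[mu]_x (\1_(A `&` O) x * K i x)).
have [|||D [mD DM nuE]] := @dominated_additive_density _ _ _ mu sf nu (fun x => M * \1_O x) _ (iO M).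
- by move=> x; rewrite mulr_ge0.
- move=> A B mA mB AB.
  have cc := weak_limit_linear (a := 1) (iI mA) (iI mB) (cA A mA) (cA B mB).
  rewrite mul1r in cc; rewrite -(cvg_lim (@norm_hausdorff _ R^o) cc).
  rewrite /nu (_ : (fun i => \int[mu]_x (\1_((A `|` B) `&` O) x * K i x)) =
    fun i => \int[mu]_x ((1 * \1_(A `&` O) x + \1_(B `&` O) x) * K i x))//.
  apply/funext => i; apply: eq_Rintegral => x _; congr (_ * _).
  rewrite mul1r !indicI /= !indicE in_setU.
  have : ~~ ((x \in A) && (x \in B)) by rewrite -in_setI AB in_set0.
  by case: (x \in A) => //=; case: (x \in B) => //= _; rewrite ?mul0r ?addr0 ?add0r.
- move=> A mA; have ca : `|\int[mu]_x (\1_(A `&` O) x * K i x)| @[i --> \oo] --> `|nu A|.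
    by apply: cvg_norm; exact: cA.
  rewrite -(cvg_lim (@norm_hausdorff _ R^o) ca); apply: limr_le; first by apply/cvg_ex; eexists; exact: ca.
  apply: nearW => i.
  rewrite [X in _ <= X]Rintegral_mkcond.
  apply: le_normr_Rintegral_dom => //.
  + by apply: measurable_funM => //; apply: measurable_indic; exact: measurableI.
  + have := integrable_realZ M measurableT (iI mA); apply: eq_integrable_real => x.
    by rewrite patchE indicI/= !indicE; case: (x \in A); rewrite ?mul1r ?mul0r ?mulr0.
  + move=> x _; rewrite normrM patchE indicI/= !indicE.
    case: (x \in A); last by rewrite mul0r normr0 mul0r.
    by rewrite mul1r mulrC normr_nat ler_wpM2r.
exists D; split=> // f c mf fc.
have c0 (x : S) : 0 <= c by apply: le_trans (fc x).
pose Q (g : S -> R) := \int[mu]_x (g x * K i x) @[i --> \oo] --> \int[mu]_x (g x * D x).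
have iD : mu.-integrable setT (EFin \o D).
  by apply: (le_integrable_real measurableT mD (iO M)).
have QI A : measurable A -> Q \1_(A `&` O).
  move=> mA; rewrite /Q (_ : \int[mu]_x _ = nu A); first exact: cA.
  rewrite nuE// [RHS]Rintegral_mkcond; apply: eq_Rintegral => x _.
  rewrite patchE indicI/= !indicE; case: (x \in A); rewrite ?mul0r// mul1r.
  have := DM x; rewrite indicE; case: (x \in O); rewrite ?mul1r// mulr0 normr_le0 => /eqP ->.
  by rewrite mulr0.
have iDb (g : S -> R) b : measurable_fun setT g -> (forall x, `|g x| <= b) ->
    mu.-integrable setT (EFin \o (fun x => g x * D x)).
  move=> mg gb; apply: (le_integrable_real measurableT _ (integrable_realZ b measurableT (integrable_real_norm measurableT iD))).
    exact: measurable_funM.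
  by move=> x _; rewrite normrM ler_wpM2r.
(* clipped simple approximations of [f], supported in [O] *)
have [s_ [ss sf_]] := measurable_strongly_measurable mu measurableT mf.
pose cl t := Num.max (- c) (Num.min t c).
have clc (x : S) t : `|cl t| <= c.
  exact: norm_clip_le (c0 x).
have clf x : cl (f x) = f x.
  by have := fc x; rewrite ler_norml /cl => /andP[h1 h2]; rewrite min_l// max_r.
have ccl : continuous (cl : R -> R).
  move=> t; rewrite /cl; apply: (@continuous_max _ _ (fun=> - c) (fun t => Num.min t c)); first exact: cvg_cst.
  by apply: continuous_min; [exact: cvg_id|exact: cvg_cst].
pose A k v := s_ k @^-1` [set v]; pose q k := finmap.enum_fset (fset_set (range (s_ k))).
have mA k v : measurable (A k v) by have [_] := ss k; exact.
have iA k v := iI (mA k v).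
pose g k x := \sum_(v <- q k) cl v * \1_(A k v `&` O) x.
have gE k x : g k x = cl (s_ k x) * \1_O x.
  rewrite (simple_expand cl x (ss k)) mulr_suml; apply: eq_bigr => v _.
  by rewrite indicI/= mulrA.
have Qs k (r : seq R^o) : mu.-integrable setT (EFin \o (fun x => \sum_(v <- r) cl v * \1_(A k v `&` O) x)) /\
    Q (fun x => \sum_(v <- r) cl v * \1_(A k v `&` O) x).
  elim: r => [|v r [ih1 ih2]].
    split; first by under eq_fun do rewrite big_nil; exact: integrable0.
    have z (h : S -> R) : \int[mu]_x ((\sum_(v <- [::]) cl v * \1_(A k v `&` O) x) * h x) = 0.
      by under eq_Rintegral do rewrite big_nil mul0r; rewrite Rintegral_cst// mul0r.
    by rewrite /Q z (_ : (fun i => _) = fun=> 0); [exact: cvg_cst|apply/funext => i; rewrite z].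
  have E x : \sum_(w <- v :: r) cl w * \1_(A k w `&` O) x =
      cl v * \1_(A k v `&` O) x + \sum_(w <- r) cl w * \1_(A k w `&` O) x by rewrite big_cons.
  split.
    apply: (eq_integrable_real (fun x => esym (E x))).
    by apply: integrable_realD => //; exact: integrable_realZ.
  have := weak_limit_linear (a := cl v) (iA k v) ih1 (QI _ (mA k v)) ih2.
  rewrite /Q (_ : _ + _ = \int[mu]_x ((\sum_(w <- v :: r) cl w * \1_(A k w `&` O) x) * D x)).
    apply: cvg_trans; apply: near_eq_cvg; apply: nearW => i.
    by apply: eq_Rintegral => x _; congr (_ * _); exact: esym (E x).
  have b1 x : `|\1_(A k v `&` O) x : R| <= 1 by rewrite indicE normr_nat lern1 leq_b1.
  have mAO : measurable_fun setT (\1_(A k v `&` O) : S -> R).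
    by apply: measurable_indic; exact: measurableI.
  have i1 := iDb _ 1 mAO b1.
  rewrite -RintegralZl//.
  rewrite -RintegralD//; first last.
  - apply: (iDb _ (\sum_(w <- r) `|cl w|)); first by have /integrable_realP[] := ih1.
    move=> x; apply: le_trans (ler_norm_sum _ _ _) _; apply: ler_sum => w _.
    by rewrite normrM ler_piMr// indicE normr_nat lern1 leq_b1.
  - by apply: integrable_realZ => //; exact: i1.
  by apply: eq_Rintegral => x _; rewrite E mulrDl mulrA.
have mg k : measurable_fun setT (g k) by have /integrable_realP[] := (Qs k (q k)).1.
have mfO : measurable_fun setT (fun x => f x * \1_O x) by apply: measurable_funM => //; exact: measurable_indic.
have O0 x : `|\1_O x : R| = \1_O x by rewrite ger0_norm.
have gc k x : `|g k x| <= c * \1_O x by rewrite gE normrM O0 ler_wpM2r//; exact: clc x _.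
have fOc x : `|f x * \1_O x| <= c * \1_O x by rewrite normrM O0 ler_wpM2r.
have gf : {ae mu, forall x, g ^~ x @ \oo --> f x * \1_O x}.
  apply: (ae_imply sf_) => x /(_ I) sx; rewrite -(clf x).
  rewrite (_ : g ^~ x = fun k => cl (s_ k x) * \1_O x); last by apply/funext => k; rewrite gE.
  by apply: cvgMl; apply: continuous_cvg; [exact: ccl|exact: sx].
have [cf lf] := weak_limit_dominated mg mfO (iO c) gc fOc gf
  (fun k => cvgP _ (Qs k (q k)).2).
have lE k : limn (fun i => \int[mu]_x (g k x * K i x)) = \int[mu]_x (g k x * D x).
  exact: cvg_lim (Qs k (q k)).2.
have [|||||_ h] := @dominated_Rintegral _ _ _ mu setT (fun k x => g k x * D x)
  (fun x => (f x * \1_O x) * D x) (fun x => c * `|D x|) measurableT.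
- by move=> k; exact: measurable_funM.
- exact: measurable_funM.
- by apply: integrable_realZ => //; exact: integrable_real_norm.
- by apply: (ae_imply gf) => x gx _; apply: cvgMl; exact: gx.
- apply: aeW => x _ k; rewrite normrM ler_wpM2r//; apply: le_trans (gc k x) _.
  by rewrite indicE ler_piMr ?lern1 ?leq_b1// (c0 x).
have <- : limn (fun i => \int[mu]_x ((f x * \1_O x) * K i x)) = \int[mu]_x (f x * D x).
  have -> : \int[mu]_x (f x * D x) = \int[mu]_x (f x * \1_O x * D x).
    apply: eq_Rintegral => x _; have := DM x; rewrite indicE.
    by case: (x \in O); rewrite ?mulr1// mulr0 normr_le0 => /eqP ->; rewrite !mulr0.
  apply: (@cvg_unique _ (@norm_hausdorff _ R^o) _ _ _ _ lf).
  by apply: cvg_trans h; apply: near_eq_cvg; apply: nearW => k; rewrite lE.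
exact: cf.
Qed.

End weak_limits.

(** * Difference quotients of Lipschitz functions *)

Section difference_quotients.
Context {R : realType} {n : nat}.
Local Notation E := 'rV[R]_n.+1.
Local Notation L := (lebesgue_space R n).
Local Notation mu := (@lebesgue_Rn R n).
Implicit Types (phi c : E -> R) (Omega : set E) (j : 'I_n.+1).
Local Notation e_ j := (delta_mx ord0 j : E).

Lemma norm_line_le (t : R) j : `|t *: e_ j| <= `|t|.
Proof.
apply: norm_le_coord => // i; rewrite !mxE normrM eqxx/=.
by case: (i == j); rewrite ?normr1 ?mulr1// normr0 mulr0.
Qed.

Let is_derive_line phi j y s : derivable phi (y + s *: e_ j) (e_ j) ->
  is_derive s 1 (fun t : R => phi (y + t *: e_ j)) (partial j phi (y + s *: e_ j)).
Proof.
move=> dphi.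
have eq : (fun h : R => h^-1 *: (((fun t : R => phi (y + t *: e_ j)) \o shift s) (h *: (1 : R)) - phi (y + s *: e_ j))) =
    (fun h : R => h^-1 *: ((phi \o shift (y + s *: e_ j)) (h *: e_ j) - phi (y + s *: e_ j))).
  apply/funext => h /=; congr (_ *: (phi _ - _)).
  by rewrite [h *: 1]mulr1 scalerDl addrCA.
by apply: DeriveDef; [rewrite /derivable eq|rewrite /partial /derive eq].
Qed.

Lemma line_increment_le phi j (M : R) x t : (forall x, derivable phi x (e_ j)) ->
  (forall x, `|partial j phi x| <= M) -> 0 <= t -> `|phi x - phi (x - t *: e_ j)| <= M * t.
Proof.
move=> dphi pM t0; pose F (s : R) := phi ((x - t *: e_ j) + s *: e_ j).
have dF (s : R) : is_derive s 1 F (partial j phi ((x - t *: e_ j) + s *: e_ j)).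
  exact: is_derive_line.
have [|s _] := MVT_segment t0 (fun s _ => dF s).
  apply: continuous_subspaceT => s; apply: differentiable_continuous.
  by apply/derivable1_diffP; have [] := dF s.
rewrite /F subrK scale0r addr0 subr0 => ->.
by rewrite normrM (ger0_norm t0) ler_wpM2r.
Qed.

(** The quotient goes backwards because translating the integration variable turns a forward
    quotient of [c] into minus a backward quotient of the test function. *)
Lemma line_quotient_cvg phi j x (h_ : nat -> R) : derivable phi x (e_ j) ->
  (forall i, 0 < h_ i) -> h_ @ \oo --> 0 ->
  (phi x - phi (x - h_ i *: e_ j)) / h_ i @[i --> \oo] --> partial j phi x.
Proof.
move=> dphi h0 hc.
have /cvgr_dnbhsP/(_ (fun i => - h_ i)) : (fun h : R => h^-1 *: ((phi \o shift x) (h *: e_ j) - phi x) : R) @ 0^' --> partial j phi x by exact: dphi.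
have hh : (forall i, - h_ i != 0) /\ (fun i => - h_ i) @ \oo --> 0.
  split; first by move=> i; rewrite oppr_eq0 lt0r_neq0.
  by rewrite -oppr0; apply: cvgN.
move=> /(_ hh); apply: cvg_trans; apply: near_eq_cvg; apply: nearW => i /=.
rewrite scaleNr [- _ + x]addrC invrN scaleNr -scalerN opprB.
by rewrite [LHS]mulrC.
Qed.

Context (c : E -> R) (Lam : R) (x0 : E) (rho : R) (j : 'I_n.+1).
Context (Lam0 : 0 <= Lam) (rho0 : 0 < rho)
  (lip : forall x y, `|c x - c y| <= Lam * `|x - y|)
  (supp : forall x, 2 * rho <= `|x - x0| -> c x = 0).

Definition step_size i : R := rho / i.+1%:R.

Definition diff_quot i x := (c (x + step_size i *: e_ j) - c x) / step_size i.

(** [c] vanishes at distance 2 rho and steps are at most [rho], so all difference quotients vanish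
    outside this box of half-side 3 rho. *)
Definition support_box : E * E := (\row_i (x0 ord0 i - 3 * rho), \row_i (x0 ord0 i + 3 * rho)).
Local Notation O := (obox support_box).

Lemma step_size_gt0 i : 0 < step_size i.
Proof. by rewrite divr_gt0. Qed.

Lemma step_size_cvg : step_size @ \oo --> (0 : R).
Proof.
rewrite -(mulr0 rho); apply: cvgMr; exact: cvg_harmonic.
Qed.

Let step_size_le i : step_size i <= rho.
Proof. by rewrite ler_pdivrMr// ler_pMr// ler1n. Qed.

Lemma support_boxP x : ~ O x -> 3 * rho <= `|x - x0|.
Proof.
move=> Ox; rewrite leNgt; apply/negP => xx; apply: Ox => i.
rewrite !mxE; have := coord_le_norm (x - x0) i; rewrite !mxE => /le_lt_trans/(_ xx).
rewrite ltr_norml => /andP[h1 h2]; apply/andP; split; lra.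
Qed.

Lemma lipschitz_continuous : continuous c.
Proof.
move=> x U /nbhs_ballP[eps /= eps0 hU].
have L1 : 0 < Lam + 1 by have := Lam0; lra.
apply/nbhs_ballP; exists (eps / (Lam + 1)); first by rewrite /= divr_gt0.
move=> y; rewrite -ball_normE/= ltr_pdivlMr// => xy; apply: hU; rewrite -ball_normE/=.
apply: le_lt_trans (lip x y) _; apply: le_lt_trans xy.
by rewrite mulrC; apply: ler_wpM2l => //; lra.
Qed.

Let shift_continuous (f : E -> R) (a : E) : continuous f -> continuous (fun x : E => f (x + a)).
Proof.
move=> cf x U /(cf (x + a)) /nbhs_ballP[r r0 h]; apply/nbhs_ballP; exists r => // y.
by rewrite -ball_normE/= => xy; apply: h; rewrite -ball_normE/= opprD addrACA subrr addr0.
Qed.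

Lemma diff_quot_le i x : `|diff_quot i x| <= Lam.
Proof.
rewrite normrM normfV (gtr0_norm (step_size_gt0 i)) ler_pdivrMr ?step_size_gt0//.
apply: le_trans (lip _ _) _; rewrite addrAC subrr add0r ler_wpM2l//.
by apply: le_trans (norm_line_le _ _) _; rewrite gtr0_norm// step_size_gt0.
Qed.

Lemma diff_quot_support i x : ~ O x -> diff_quot i x = 0.
Proof.
move=> /support_boxP xx; rewrite /diff_quot (supp (x := x)); last by have := rho0; lra.
rewrite supp ?subrr ?mul0r//.
have := ler_normB (x + step_size i *: e_ j - x0) (step_size i *: e_ j).
rewrite (_ : _ - _ - _ = x - x0); last by rewrite addrAC addrK.
have := norm_line_le (step_size i) j; rewrite (gtr0_norm (step_size_gt0 i)).
have := step_size_le i; lra.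
Qed.

Let cO x : ~ O x -> c x = 0.
Proof. by move=> /support_boxP xx; apply: supp; have := rho0; lra. Qed.

Lemma lipschitz_bounded : exists2 M, 0 <= M & forall x, `|c x| <= M.
Proof.
apply: (bounded_of_compact_support (@compact_cbox _ _ support_box) lipschitz_continuous) => x nx.
by apply: cO => Ox; apply: nx; exact: obox_sub_cbox Ox.
Qed.

Let mc : measurable_fun setT (c : L -> R).
Proof. exact: continuous_lebesgue_measurable lipschitz_continuous. Qed.

Lemma diff_quot_measurable i : measurable_fun setT (diff_quot i : L -> R).
Proof.
have ms : measurable_fun setT ((fun x : E => c (x + step_size i *: e_ j)) : L -> R).
  by apply: continuous_lebesgue_measurable; apply: shift_continuous; exact: lipschitz_continuous.
exact: (measurable_funM (measurable_funB ms mc) (measurable_cst _)).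
Qed.

Lemma lipschitz_integrable : mu.-integrable setT (EFin \o (c : L -> R)).
Proof.
have [M M0 cM] := lipschitz_bounded.
have i1 : mu.-integrable setT (EFin \o (\1_O : L -> R)).
  apply/integrable_realP; split; first by apply: measurable_indic; exact: measurable_obox.
  under eq_integral do rewrite ger0_norm//.
  by rewrite integral_indic ?setIT; [exact: lebesgue_obox_lty| |exact: measurable_obox].
apply: (le_integrable_real measurableT mc (integrable_realZ M measurableT i1)) => x _.
rewrite indicE; have [/set_mem Ox|/negP nx] := boolP ((x : E) \in O); first by rewrite mulr1.
by rewrite cO ?normr0 ?mulr0//; apply: contra_not nx => ?; rewrite inE.
Qed.

(* Summation by parts: the difference quotient is moved to the test function. *)
Lemma diff_quot_test Omega phi : test_function Omega phi ->
  \int[mu]_x (phi x * diff_quot i x) @[i --> \oo] --> - \int[mu]_x (partial j phi x * c x).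
Proof.
move=> tphi; have cphi := test_function_continuous tphi.
have cdphi := test_function_partial_continuous (j := j) tphi.
have [sm _ _] := tphi; have dphi x : derivable phi x (e_ j) by have [_] := sm [::]; exact.
have [K [cK _ Kphi Kdphi]] := test_function_support tphi.
have [N N0 phiN] := bounded_of_compact_support cK cphi Kphi.
have [M M0 dphiM] := bounded_of_compact_support cK cdphi (fun x => Kdphi x j).
have mphi : measurable_fun setT (phi : L -> R) by exact: continuous_lebesgue_measurable.
have ic := lipschitz_integrable.
pose q i x := (phi x - phi (x - step_size i *: e_ j)) / step_size i * c x.
have cphis a : continuous (fun x : E => phi (x - a)) by exact: shift_continuous.
have mphis a : measurable_fun setT ((fun x : E => phi (x - a)) : L -> R).
  exact: continuous_lebesgue_measurable.
have mq i : measurable_fun setT (q i : L -> R).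
  exact: (measurable_funM (measurable_funM (measurable_funB mphi (mphis _)) (measurable_cst _)) mc).
have mdc : measurable_fun setT ((fun x => partial j phi x * c x) : L -> R).
  by apply: (measurable_funM _ mc); exact: continuous_lebesgue_measurable.
have bint (a : E -> R) b : measurable_fun setT (a : L -> R) -> (forall x, `|a x| <= b) ->
    mu.-integrable setT (EFin \o ((fun x => a x * c x) : L -> R)).
  move=> ma ab; apply: (le_integrable_real measurableT (measurable_funM ma mc)
    (integrable_realZ b measurableT (integrable_real_norm measurableT ic))) => x _.
  by rewrite normrM ler_wpM2r.
have [|||||_ h] := @dominated_Rintegral _ _ _ mu setT (q : nat -> L -> R)
  ((fun x => partial j phi x * c x) : L -> R) ((fun x => M * `|c x|) : L -> R) measurableT.
- exact: mq.
- exact: mdc.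
- exact: (integrable_realZ M measurableT (integrable_real_norm measurableT ic)).
- apply: aeW => x _; apply: cvgMl.
  exact: (line_quotient_cvg (dphi x) step_size_gt0 step_size_cvg).
- apply: aeW => x _ i; rewrite /q !normrM normfV (gtr0_norm (step_size_gt0 i)) ler_wpM2r//.
  rewrite ler_pdivrMr ?step_size_gt0//.
  exact: (line_increment_le x dphi dphiM (ltW (step_size_gt0 i))).
rewrite (_ : (fun i => _) = fun i => - \int[mu]_x q i x); first exact: cvgN.
apply/funext => i.
set s := step_size i; have s0 : s != 0 by rewrite lt0r_neq0// step_size_gt0.
have shiftE : \int[mu]_x (phi x * c (x + s *: e_ j)) = \int[mu]_x (phi (x - s *: e_ j) * c x).
  congr fine; have := integral_lebesgue_shift (s *: e_ j) (f := fun x : L => (phi ((x : E) - s *: e_ j) * c x)%:E).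
  move=> <-; last by apply/measurable_EFinP; exact: (measurable_funM (mphis _) mc).
  by apply: eq_integral => x _; rewrite addrK.
have i1 : mu.-integrable setT (EFin \o ((fun x : E => phi x * c (x + s *: e_ j)) : L -> R)).
  have [M' M'0 cM] := lipschitz_bounded.
  have iphi : mu.-integrable setT (EFin \o (phi : L -> R)).
    apply/integrable_realP; split=> //.
    have mK : measurable (K : set L) by exact: compact_lebesgue_measurable.
    apply: (@le_lt_trans _ _ (\int[mu]_x (N * \1_K x)%:E)%E).
      apply: ge0_le_integral => //; first by apply/measurable_EFinP; exact: measurableT_comp.
        by apply/measurable_EFinP; apply: measurable_funM => //; exact: measurable_indic.
      move=> x _; rewrite lee_fin indicE; have [_|/negP nx] := boolP ((x : E) \in K); first by rewrite mulr1.
      by rewrite Kphi ?normr0 ?mulr0//; apply: contra_not nx => ?; rewrite inE.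
    under eq_integral do rewrite EFinM.
    rewrite ge0_integralZl//; last first.
      by apply/measurable_EFinP; exact: measurable_indic.
    by rewrite integral_indic// setIT lte_mul_pinfty// lebesgue_compact_lty.
  have mcs : measurable_fun setT ((fun x : E => c (x + s *: e_ j)) : L -> R).
    by apply: continuous_lebesgue_measurable; apply: shift_continuous; exact: lipschitz_continuous.
  apply: (le_integrable_real measurableT (measurable_funM mphi mcs)
    (integrable_realZ M' measurableT (integrable_real_norm measurableT iphi))) => x _.
  by rewrite normrM mulrC ler_wpM2r.
have i2 := bint _ N mphi phiN.
have i3 := bint _ N (mphis (s *: e_ j)) (fun x => phiN _).
rewrite (_ : \int[mu]_x (phi x * diff_quot i x) =
    s^-1 * (\int[mu]_x (phi x * c (x + s *: e_ j)) - \int[mu]_x (phi x * c x))); last first.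
  rewrite -RintegralB// -RintegralZl//; last exact: (integrable_realB measurableT i1 i2).
  by apply: eq_Rintegral => x _; rewrite /diff_quot -/s; ring.
rewrite shiftE (_ : \int[mu]_x q i x =
    s^-1 * (\int[mu]_x (phi x * c x) - \int[mu]_x (phi (x - s *: e_ j) * c x))).
  by rewrite -mulrN opprB.
rewrite -RintegralB// -RintegralZl//; last exact: (integrable_realB measurableT i2 i3).
by apply: eq_Rintegral => x _; rewrite /q -/s; ring.
Qed.

End difference_quotients.

Section lipschitz_functions.
Context {R : realType} {n : nat}.
Local Notation E := 'rV[R]_n.+1.
Local Notation L := (lebesgue_space R n).
Local Notation mu := (@lebesgue_Rn R n).
Implicit Types (phi c : E -> R) (Omega : set E) (j : 'I_n.+1).

Let indic_integrable p (b : R) : mu.-integrable setT (EFin \o ((fun x => b * \1_(obox p) x) : L -> R)).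
Proof.
apply: (integrable_realZ b measurableT); apply/integrable_realP; split.
  by apply: measurable_indic; exact: measurable_obox.
under eq_integral do rewrite ger0_norm//.
by rewrite integral_indic ?setIT; [exact: lebesgue_obox_lty| |exact: measurable_obox].
Qed.

Let bounded_on p (h : E -> R) := measurable_fun setT (h : L -> R) /\
  exists b, forall x, `|h x| <= b * \1_(obox p) x.

Let bounded_integrable p h : bounded_on p h -> mu.-integrable setT (EFin \o (h : L -> R)).
Proof.
by move=> [mh [b hb]]; exact: (le_integrable_real measurableT mh (indic_integrable p b) (fun x _ => hb x)).
Qed.

Let bounded_on0 p : bounded_on p (fun=> 0).
Proof. by split; [exact: measurable_cst|exists 0 => x; rewrite normr0 mul0r]. Qed.

Let bounded_on1 p (h : E -> R) : measurable_fun setT (h : L -> R) ->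
  (forall x, `|h x| <= \1_(obox p) x) -> bounded_on p h.
Proof. by move=> mh h1; split=> //; exists 1 => x; rewrite mul1r. Qed.

Let bounded_on_linear p (a : R) (h g : E -> R) : bounded_on p h -> bounded_on p g ->
  bounded_on p (fun x => a * h x + g x).
Proof.
move=> [mh [b hb]] [mg [b' gb]]; split.
  exact: (measurable_funD (measurable_funM (measurable_cst a) mh) mg).
exists (`|a| * b + b') => x; apply: le_trans (ler_normD _ _) _.
by rewrite normrM mulrDl -mulrA; apply: lerD => //; exact: ler_wpM2l.
Qed.

(** The integrals of the quotients converge against test functions by [diff_quot_test], then against
    indicators by [test_density], and [weak_density] provides [d]. The last clause records the
    convergence on sets: it is how integrals of [d] over slabs are evaluated later. *)
Lemma lipschitz_weak_partial Omega c (Lam : R) (x0 : E) (rho : R) j : open Omega ->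
  0 <= Lam -> 0 < rho -> (forall x y, `|c x - c y| <= Lam * `|x - y|) ->
  (forall x, 2 * rho <= `|x - x0| -> c x = 0) -> cbox (support_box x0 rho) `<=` Omega ->
  exists d : E -> R, [/\ measurable_fun setT (d : L -> R),
    forall x, `|d x| <= Lam * \1_(obox (support_box x0 rho)) x,
    weak_partial Omega j (c : E -> R^o) (d : E -> R^o) &
    forall A : set L, measurable A ->
      \int[mu]_x (\1_A x * \1_(obox (support_box x0 rho)) x * diff_quot c rho j i x) @[i --> \oo] -->
      \int[mu]_x (\1_A x * d x)].
Proof.
move=> oO Lam0 rho0 lip supp pO; pose p := support_box x0 rho.
have mO : measurable (Omega : set L) by exact: open_lebesgue_measurable.
pose K i : L -> R := diff_quot c rho j i.
have mK i : measurable_fun setT (K i) by exact: (diff_quot_measurable rho j Lam0 lip i).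
have KL i x : `|K i x| <= Lam by exact: (diff_quot_le j Lam0 rho0 lip).
have K0 i x : ~ obox p x -> K i x = 0 by exact: (diff_quot_support j rho0 supp).
have mp : measurable (obox p : set L) by exact: measurable_obox.
pose P (h : E -> R) := bounded_on p h /\ cvgn (fun i => \int[mu]_x (h x * K i x)).
have Ptest phi : test_function Omega phi -> (forall x, `|phi x| <= \1_(obox p) x) -> P phi.
  move=> tphi phi1; split.
    apply: bounded_on1 => //; apply: continuous_lebesgue_measurable.
    exact: (test_function_continuous tphi).
  exact: cvgP (diff_quot_test (j := j) Lam0 rho0 lip supp tphi).
have P0 : P (fun=> 0).
  split; first exact: bounded_on0.
  rewrite (_ : (fun i => _) = fun=> 0); first exact: is_cvg_cst.
  by apply/funext => i; under eq_Rintegral do rewrite mul0r; rewrite Rintegral_cst// mul0r.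
have Plin (a : R) f g : P f -> P g -> P (fun x => a * f x + g x).
  move=> [bf cf] [bg cg]; split; first exact: bounded_on_linear.
  exact: cvgP (weak_limit_linear mK KL (a := a) (bounded_integrable bf) (bounded_integrable bg) cf cg).
have Plim (f_ : nat -> E -> R) f : (forall k, P (f_ k)) ->
    (forall k, measurable_fun setT (f_ k : L -> R)) -> measurable_fun setT (f : L -> R) ->
    (forall k x, `|f_ k x| <= \1_(obox p) x) -> (forall x, `|f x| <= \1_(obox p) x) ->
    {ae mu, forall x : L, f_ ^~ x @ \oo --> f x} -> P f.
  move=> Pf mf_ mf f1_ f1 ff; split; first exact: bounded_on1.
  have i1 : mu.-integrable setT (EFin \o (\1_(obox p) : L -> R)).
    apply: (@bounded_integrable p); apply: bounded_on1; first exact: measurable_indic.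
    by move=> x; rewrite ger0_norm.
  exact: (weak_limit_dominated mK KL mf_ mf i1 f1_ f1 ff (fun k => (Pf k).2)).1.
have cA (A : set L) : measurable A -> cvgn (fun i => \int[mu]_x (\1_(A `&` obox p) x * K i x)).
  by move=> mA; have [] := test_density pO P0 Ptest Plin Plim mA.
have [d [md dL wd]] := weak_density Lam0 mK KL mp (lebesgue_obox_lty p) (@lebesgue_sigma_finite R n) cA.
have d0 x : ~ obox p x -> d x = 0.
  move=> nx; have := dL x; rewrite indicE memNset// mulr0 normr_le0 => /eqP; exact.
have mc : measurable_fun setT (c : L -> R).
  exact: continuous_lebesgue_measurable (lipschitz_continuous Lam0 lip).
have [Mc Mc0 cM] := lipschitz_bounded Lam0 rho0 lip supp.
have L1b (a : E -> R) b : measurable_fun setT (a : L -> R) -> (forall x, `|a x| <= b) ->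
    L1_loc Omega (a : E -> R^o).
  move=> ma ab; split; first by apply: measurable_strongly_measurable => //; exact: measurable_funTS.
  move=> k ck kO; have mk : measurable (k : set L) by exact: compact_lebesgue_measurable.
  apply: (@le_lt_trans _ _ (\int[mu]_(x in k) (cst b%:E x))%E).
    apply: (ge0_le_integral mu mk (f1 := fun x => `|a x|%:E)) => //.
    - apply/measurable_EFinP; apply: measurableT_comp => //; exact: measurable_funTS.
    - by move=> x _; rewrite lee_fin; exact: ab.
  rewrite integral_cst//; have := lebesgue_compact_lty ck => kf.
  have b0 : 0 <= b by apply: le_trans (ab x0).
  by rewrite lte_mul_pinfty.
exists d; split=> //.
- apply/weak_partial_realP => //; split.
  + exact: L1b mc cM.
  + apply: (L1b _ Lam md) => x; apply: le_trans (dL x) _.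
    by rewrite ler_piMr// indicE lern1 leq_b1.
  move=> phi tphi; have [k [ck kO phik dphik]] := test_function_support tphi.
  have cphi := test_function_continuous tphi.
  have [N N0 phiN] := bounded_of_compact_support ck cphi phik.
  have mphi : measurable_fun setT (phi : L -> R) by exact: continuous_lebesgue_measurable.
  have h1 := diff_quot_test (j := j) Lam0 rho0 lip supp tphi.
  have h2 := wd phi N mphi phiN.
  have off (a b : E -> R) : (forall x, ~ Omega x -> a x = 0) ->
      \int[mu]_(x in Omega) (a x * b x) = \int[mu]_x (a x * b x).
    move=> a0; rewrite Rintegral_mkcond; apply: eq_Rintegral => x _; rewrite patchE.
    by case: ifPn => // /negP nx; rewrite a0 ?mul0r//; apply: contra_not nx => ?; rewrite inE.
  rewrite off; last by move=> x nx; apply: phik; apply: contra_not nx; exact: kO.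
  rewrite off; last by move=> x nx; apply: dphik; apply: contra_not nx; exact: kO.
  apply: (@cvg_unique _ (@norm_hausdorff _ R^o) _ _ _ _ h2).
  apply: cvg_trans h1; apply: near_eq_cvg; apply: nearW => i.
  apply: eq_Rintegral => x _; rewrite indicE; have [_|/negP nx] := boolP (x \in obox p).
    by rewrite mulr1.
  by rewrite -/(K i x) K0 ?mulr0//; apply: contra_not nx => ?; rewrite inE.
- move=> A mA; apply: (wd \1_A 1); first exact: measurable_indic.
  by move=> x; rewrite indicE normr_nat lern1 leq_b1.
Qed.

(** Both derivatives have equal integrals against test functions, and [test_density] passes this
    equality on to indicators: the fundamental lemma of the calculus of variations in integrated
    form. *)
Lemma weak_partial_unique_integral Omega j (c d w : E -> R) p : open Omega -> cbox p `<=` Omega ->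
  weak_partial Omega j (c : E -> R^o) (d : E -> R^o) ->
  weak_partial Omega j (c : E -> R^o) (w : E -> R^o) ->
  forall A : set L, measurable A ->
    \int[mu]_(x in A `&` obox p) d x = \int[mu]_(x in A `&` obox p) w x.
Proof.
move=> oO pO /(weak_partial_realP _ _ _ oO)[_ Ld hd] /(weak_partial_realP _ _ _ oO)[_ Lw hw].
have mO : measurable (Omega : set L) by exact: open_lebesgue_measurable.
have mp : measurable (cbox p : set L) by exact: measurable_cbox.
have ir (v : E -> R) : L1_loc Omega (v : E -> R^o) ->
    mu.-integrable setT (EFin \o ((v \_ (cbox p)) : L -> R)).
  move=> [sv lv].
  have mv : measurable_fun (Omega : set L) (v : L -> R).
    by have := strongly_measurable_measurable_comp (g := idfun) (@lebesgue_complete R n) mO (fun x => cvg_id) sv.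
  rewrite -restrict_EFin; apply/(integrable_mkcond _ mp)/integrable_realP; split.
    exact: (measurable_funS mO pO mv).
  exact: (lv _ (@compact_cbox _ _ p) pO).
have id_ := ir _ Ld; have iw_ := ir _ Lw.
pose d' : L -> R := d \_ (cbox p); pose w' : L -> R := w \_ (cbox p).
have md' : measurable_fun setT d' by have /integrable_realP[] := id_.
have mw' : measurable_fun setT w' by have /integrable_realP[] := iw_.
pose P (h : E -> R) := bounded_on p h /\ \int[mu]_x (h x * d' x) = \int[mu]_x (h x * w' x).
have ib (h : E -> R) (v : L -> R) : bounded_on p h -> measurable_fun setT v ->
    mu.-integrable setT (EFin \o v) -> mu.-integrable setT (EFin \o (fun x : L => h x * v x)).
  move=> [mh [b hb]] mv iv; apply: (le_integrable_real measurableT (measurable_funM mh mv)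
    (integrable_realZ `|b| measurableT (integrable_real_norm measurableT iv))) => x _.
  rewrite normrM ler_wpM2r//; apply: le_trans (hb x) _; apply: le_trans (ler_norm _) _.
  by rewrite normrM ler_piMr// indicE normr_nat lern1 leq_b1.
have box0 (h v : E -> R) : (forall x, `|h x| <= \1_(obox p) x) ->
    \int[mu]_(x in Omega) (h x * v x) = \int[mu]_x (h x * (v \_ (cbox p)) x).
  move=> h1; rewrite Rintegral_mkcond; apply: eq_Rintegral => x _; rewrite !patchE.
  have h0 : ~ obox p x -> h x = 0.
    by move=> nx; have := h1 x; rewrite indicE memNset// normr_le0 => /eqP.
  have [Ox|nx] := pselect (obox p x); last by rewrite (h0 nx) !mul0r; case: ifP.
  have Cx := obox_sub_cbox Ox.
  by rewrite !mem_set//; exact: pO.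
have Ptest phi : test_function Omega phi -> (forall x, `|phi x| <= \1_(obox p) x) -> P phi.
  move=> tphi phi1; split.
    apply: bounded_on1 => //; apply: continuous_lebesgue_measurable.
    exact: (test_function_continuous tphi).
  by rewrite -!box0// hd// hw.
have P0 : P (fun=> 0).
  split; first exact: bounded_on0.
  by apply: eq_Rintegral => x _; rewrite !mul0r.
have Plin (a : R) f g : P f -> P g -> P (fun x => a * f x + g x).
  move=> [bf ef] [bg eg]; split; first exact: bounded_on_linear.
  have lin (v : L -> R) : measurable_fun setT v -> mu.-integrable setT (EFin \o v) ->
      \int[mu]_x ((a * f x + g x) * v x) = a * \int[mu]_x (f x * v x) + \int[mu]_x (g x * v x).
    move=> mv iv; have i1 := ib f v bf mv iv; have i2 := ib g v bg mv iv.
    rewrite -(RintegralZl a measurableT i1) -(RintegralD measurableT (integrable_realZ a measurableT i1) i2).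
    by apply: eq_Rintegral => x _; rewrite mulrDl mulrA.
  by rewrite (lin d' md' id_) (lin w' mw' iw_) ef eg.
have Plim (f_ : nat -> E -> R) f : (forall k, P (f_ k)) ->
    (forall k, measurable_fun setT (f_ k : L -> R)) -> measurable_fun setT (f : L -> R) ->
    (forall k x, `|f_ k x| <= \1_(obox p) x) -> (forall x, `|f x| <= \1_(obox p) x) ->
    {ae mu, forall x : L, f_ ^~ x @ \oo --> f x} -> P f.
  move=> Pf mf_ mf f1_ f1 ff; split; first exact: bounded_on1.
  have lim (v : L -> R) : measurable_fun setT v -> mu.-integrable setT (EFin \o v) ->
      \int[mu]_x (f_ k x * v x) @[k --> \oo] --> \int[mu]_x (f x * v x).
    move=> mv iv; have [|||||_ //] := @dominated_Rintegral _ _ _ mu setT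
      (fun k (x : L) => f_ k x * v x) (fun x : L => f x * v x) (fun x => `|v x|) measurableT.
    - by move=> k; exact: (measurable_funM (mf_ k) mv).
    - exact: (measurable_funM mf mv).
    - exact: integrable_real_norm.
    - by apply: (ae_imply ff) => x fx _; apply: cvgMl; exact: fx.
    - apply: aeW => x _ k; rewrite normrM ler_piMl//; apply: le_trans (f1_ k x) _.
      by rewrite indicE lern1 leq_b1.
  apply: (@cvg_unique _ (@norm_hausdorff _ R^o) _ _ _ _ (lim d' md' id_)).
  apply: cvg_trans (lim w' mw' iw_); apply: near_eq_cvg; apply: nearW => k.
  by have [_ ->] := Pf k.
move=> A mA; have [_ hA] := test_density pO P0 Ptest Plin Plim mA.
have fin (v : E -> R) : \int[mu]_(x in A `&` obox p) v x = \int[mu]_x (\1_(A `&` obox p) x * (v \_ (cbox p)) x).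
  rewrite Rintegral_mkcond; apply: eq_Rintegral => x _; rewrite !patchE indicE.
  case: ifPn => [/set_mem[_ Ox]|_]; last by rewrite mul0r.
  by rewrite mul1r mem_set//; exact: obox_sub_cbox.
by rewrite !fin.
Qed.

End lipschitz_functions.

(** * Curves as Sobolev functions *)

Section slabs.
Context {R : realType} {n : nat}.
Local Notation E := 'rV[R]_n.+1.
Local Notation L := (lebesgue_space R n).
Local Notation mu := (@lebesgue_Rn R n).
Local Notation e0 := (delta_mx ord0 ord0 : E).
Context (x0 : E) (rho : R) (rho0 : 0 < rho).

(** Between [a] and [b] in the first coordinate relative to [x0], with side [rho] in the other n
    coordinates; this gives the factor [rho ^+ n]. *)
Definition slab (a b : R) : set E :=
  box (\row_i (if i == ord0 then x0 ord0 i + a else x0 ord0 i - rho / 2),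
       \row_i (if i == ord0 then x0 ord0 i + b else x0 ord0 i + rho / 2)).

Let slabP a b x : slab a b x <-> (a < x ord0 ord0 - x0 ord0 ord0 <= b /\
  forall i, i != ord0 -> - (rho / 2) < x ord0 i - x0 ord0 i <= rho / 2).
Proof.
split=> [h|[h0 h] i].
  split=> [|i i0].
    by have := h ord0; rewrite !mxE eqxx => /andP[h1 h2]; apply/andP; split; lra.
  by have := h i; rewrite !mxE (negbTE i0) => /andP[h1 h2]; apply/andP; split; lra.
rewrite !mxE; have [->|i0] := eqVneq i ord0.
  by move: h0 => /andP[h1 h2]; apply/andP; split; lra.
by move: (h i i0) => /andP[h1 h2]; apply/andP; split; lra.
Qed.

Lemma measurable_slab a b : measurable (slab a b : set L).
Proof. exact: measurable_box. Qed.

Lemma slabU a m b : a <= m -> m <= b ->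
  slab a b = slab a m `|` slab m b /\ slab a m `&` slab m b = set0.
Proof.
move=> am mb; split; apply/seteqP; split=> x.
- move=> /slabP[/andP[h1 h2] h]; case: (leP (x ord0 ord0 - x0 ord0 ord0) m) => hm.
    by left; apply/slabP; rewrite h1 hm.
  by right; apply/slabP; rewrite hm h2.
- move=> [/slabP[/andP[h1 h2] h]|/slabP[/andP[h1 h2] h]]; apply/slabP.
    by rewrite h1 (le_trans h2 mb).
  by rewrite (le_lt_trans am h1) h2.
- move=> [/slabP[/andP[_ h2] _] /slabP[/andP[h1 _] _]].
  by have := le_lt_trans h2 h1; rewrite ltxx.
- by [].
Qed.

Lemma slab_measure a b : a <= b -> mu (slab a b) = (rho ^+ n * (b - a))%:E.
Proof.
move=> ab; rewrite lebesgue_box; congr EFin; rewrite /box_volume big_ord_recl !mxE eqxx mulrC.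
rewrite opprD addrACA subrr add0r max_r ?subr_ge0//; congr (_ * _).
rewrite (eq_bigr (fun=> rho)) ?prodr_const ?card_ord// => i _.
rewrite !mxE /=; set y := x0 _ _.
have -> : y + rho / 2 - (y - rho / 2) = rho by field.
by rewrite max_r// ltW.
Qed.

Lemma slab_norm a b x : - (rho / 2) <= a -> b <= rho / 2 -> slab a b x -> `|x - x0| <= rho / 2.
Proof.
move=> a0 b0 /slabP[/andP[h1 h2] h]; apply: norm_le_coord => [|i]; first by have := rho0; lra.
rewrite !mxE ler_norml; have [->|i0] := eqVneq i ord0; first by apply/andP; split; lra.
by move: (h i i0) => /andP[h3 h4]; apply/andP; split; lra.
Qed.

Lemma slab_shift a b h x : slab (a + h) (b + h) (x + h *: e0) <-> slab a b x.
Proof.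
have E0 : (x + h *: e0) ord0 ord0 = x ord0 ord0 + h by rewrite !mxE !eqxx mulr1.
have Ei i : i != ord0 -> (x + h *: e0) ord0 i = x ord0 i.
  by move=> i0; rewrite !mxE (negbTE i0) andbF mulr0 addr0.
split=> /slabP[h0 hi]; apply/slabP.
  rewrite E0 in h0; move: h0 => /andP[h1 h2]; split; first by apply/andP; split; lra.
  by move=> i i0; have := hi i i0; rewrite Ei.
rewrite E0; move: h0 => /andP[h1 h2]; split; first by apply/andP; split; lra.
by move=> i i0; rewrite Ei//; exact: hi.
Qed.

Context (G : R -> R) (B : R) (lipG : forall s t, `|G s - G t| <= `|s - t|)
  (GB : forall t, `|G t| <= B).
Let F (x : E) : R := G (x ord0 ord0 - x0 ord0 ord0).

Let lipF (x y : E) : `|F x - F y| <= 1 * `|x - y|.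
Proof.
rewrite mul1r; apply: le_trans (lipG _ _) _.
by rewrite opprB addrA subrK; have := coord_le_norm (x - y) ord0; rewrite !mxE.
Qed.

Let mF : measurable_fun setT (F : L -> R).
Proof. exact: continuous_lebesgue_measurable (lipschitz_continuous ler01 lipF). Qed.

Let slab_fin a b : (mu (slab a b) < +oo)%E.
Proof. by rewrite lebesgue_box ltry. Qed.

Let iB a b (c : R) : mu.-integrable (slab a b) (EFin \o (cst c : L -> R)).
Proof.
apply/integrable_realP; split; first exact: measurable_cst.
rewrite (eq_integral (cst `|c|%:E)); last by move=> x _.
rewrite integral_cst; last exact: measurable_slab.
by apply: lte_mul_pinfty => //; exact: slab_fin.
Qed.

Let iF a b : mu.-integrable (slab a b) (EFin \o (F : L -> R)).
Proof.
apply: (le_integrable_real (measurable_slab a b) (measurable_funTS mF) (iB a b B)) => x _.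
exact: GB.
Qed.

Let Phi a b := \int[mu]_(x in slab a b) F x.

Let PhiU a m b : a <= m -> m <= b -> Phi a b = Phi a m + Phi m b.
Proof.
move=> am mb; have [U I] := slabU am mb; rewrite /Phi U.
apply: Rintegral_setU; [exact: measurable_slab|exact: measurable_slab|by rewrite -U; exact: iF|].
by apply/disj_setPS; rewrite I.
Qed.

Let Phi_shift a b h : \int[mu]_(x in slab a b) F (x + h *: e0) = Phi (a + h) (b + h).
Proof.
rewrite /Phi [LHS]Rintegral_mkcond [RHS]Rintegral_mkcond; congr fine.
have mr : measurable_fun setT ((F \_ (slab (a + h) (b + h))) : L -> R).
  apply/(measurable_restrictT (F : L -> R) (measurable_slab _ _)).
  exact: measurable_funTS.
have := integral_lebesgue_shift (h *: e0) ((measurable_EFinP _ _).2 mr) => <-.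
apply: eq_integral => x _; rewrite /= !patchE; congr EFin.
have -> : ((x : E) + h *: e0 \in slab (a + h) (b + h)) = ((x : E) \in slab a b).
  by apply/idP/idP; rewrite !inE => /slab_shift.
by [].
Qed.

Let Phi_end b h : 0 <= h -> `|Phi b (b + h) - rho ^+ n * h * G b| <= rho ^+ n * h * h.
Proof.
move=> h0; have bh : b <= b + h by lra.
have cE (c : R) : \int[mu]_(x in slab b (b + h)) c = rho ^+ n * h * c.
  rewrite Rintegral_cst; last exact: measurable_slab.
  by rewrite [X in fine X](slab_measure bh) /= addrAC subrr add0r mulrC.
rewrite -!cE -(RintegralB (measurable_slab _ _) (iF _ _) (iB _ _ _)).
apply: (le_normr_Rintegral_dom (measurable_slab _ _)).
- exact: (measurable_funB (measurable_funTS mF) (measurable_cst _)).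
- exact: iB.
- move=> x /slabP[/andP[h1 h2] _]; apply: le_trans (lipG _ _) _.
  by rewrite ger0_norm; lra.
Qed.

(** Translation reduces the integral of the quotient to the integrals of [F] over two thin slabs
    just beyond [b] and [a], divided by h. On each, [F] is within h of its value at the face, whence
    the error 2 rho^n h. *)
Lemma slab_quotient_cvg a b (h_ : nat -> R) : a <= b -> (forall i, 0 < h_ i) -> h_ @ \oo --> 0 ->
  \int[mu]_(x in slab a b) ((F (x + h_ i *: e0) - F x) / h_ i) @[i --> \oo] -->
  rho ^+ n * (G b - G a).
Proof.
move=> ab h0 hc; have r0 : 0 <= rho ^+ n by rewrite exprn_ge0// ltW.
have key i : `|rho ^+ n * (G b - G a) - \int[mu]_(x in slab a b) ((F (x + h_ i *: e0) - F x) / h_ i)| <=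
    2 * rho ^+ n * h_ i.
  have hi := h0 i; set h := h_ i in hi *.
  have ms : measurable_fun (slab a b : set L) ((fun x : E => F (x + h *: e0)) : L -> R).
    apply: measurable_funTS; apply: continuous_lebesgue_measurable.
    apply: (lipschitz_continuous ler01) => x y; have := lipF (x + h *: e0) (y + h *: e0).
    by rewrite opprD addrACA subrr addr0.
  have is_ : mu.-integrable (slab a b) (EFin \o ((fun x : E => F (x + h *: e0)) : L -> R)).
    apply: (le_integrable_real (measurable_slab a b) ms (iB a b B)) => x _; exact: GB.
  have -> : \int[mu]_(x in slab a b) ((F (x + h *: e0) - F x) / h) =
      h^-1 * (Phi b (b + h) - Phi a (a + h)).
    transitivity (h^-1 * (\int[mu]_(x in slab a b) F (x + h *: e0) - \int[mu]_(x in slab a b) F x)).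
      rewrite -(RintegralB (measurable_slab _ _) is_ (iF _ _)).
      rewrite -(RintegralZl _ (measurable_slab _ _) (integrable_realB (measurable_slab _ _) is_ (iF _ _))).
      by apply: eq_Rintegral => x _; rewrite mulrC.
    rewrite Phi_shift -/(Phi a b); congr (_ * _).
    have p1 : Phi a (b + h) = Phi a b + Phi b (b + h) by apply: PhiU; lra.
    have p2 : Phi a (b + h) = Phi a (a + h) + Phi (a + h) (b + h) by apply: PhiU; lra.
    lra.
  have e1 := Phi_end b (ltW hi); have e2 := Phi_end a (ltW hi).
  rewrite -(ler_pM2l hi) -{1}(gtr0_norm hi) -normrM mulrBr mulVKf ?lt0r_neq0//.
  have := ler_normB (Phi a (a + h) - rho ^+ n * h * G a) (Phi b (b + h) - rho ^+ n * h * G b).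
  rewrite (_ : _ - _ - (_ - _) = h * (rho ^+ n * (G b - G a)) - (Phi b (b + h) - Phi a (a + h))); last by ring.
  have -> : h * (2 * rho ^+ n * h) = rho ^+ n * h * h + rho ^+ n * h * h by ring.
  lra.
apply/cvgrPdist_le => eps eps0.
have h2 : 2 * rho ^+ n * h_ i @[i --> \oo] --> (0 : R).
  by rewrite -(mulr0 (2 * rho ^+ n)); apply: cvgMr.
have /cvgrPdist_le/(_ eps eps0) := h2; apply: filterS => i.
rewrite sub0r normrN => h3; apply: le_trans (key i) _; apply: le_trans h3; exact: ler_norm.
Qed.

End slabs.

Section curve_fields.
Context {R : realType} {n : nat} {Omega : set 'rV[R]_n.+1} (X : banach_function_space Omega)
  (V : completeNormedModType R).
Local Notation E := 'rV[R]_n.+1.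
Local Notation L := (lebesgue_space R n).
Local Notation mu := (@lebesgue_Rn R n).
Context (oO : open Omega) (x0 : E) (rho : R) (rho0 : 0 < rho)
  (pO : cbox (support_box x0 rho) `<=` Omega).
Context (g : R -> V) (B : R) (lipg : forall s t, `|g s - g t| <= `|s - t|)
  (gB : forall t, `|g t| <= B).
Local Notation O := (obox (support_box x0 rho)).

(** Equal to 1 within distance [rho] of [x0] and to 0 beyond 2 rho, so it localises the curve
    without changing it near the slabs. *)
Definition tent (x : E) : R := Num.max 0 (Num.min (2 - `|x - x0| / rho) 1).

Definition curve_field (x : E) : V := tent x *: g (x ord0 ord0 - x0 ord0 ord0).

(** Product estimate: slope 1/rho of the tent times the bound [B] of the curve, plus height 1 of the
    tent times slope 1 of the curve. *)
Let Lam := B / rho + 1.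

Let mO : measurable (Omega : set L). Proof. exact: open_lebesgue_measurable. Qed.

Let B0 : 0 <= B. Proof. exact: le_trans (gB 0). Qed.

Let Lam0 : 0 <= Lam. Proof. by rewrite addr_ge0// divr_ge0// ltW. Qed.

Let tent_lip x y : `|tent x - tent y| <= `|x - y| / rho.
Proof.
apply: le_trans (clamp_lipschitz _ _ _ _) _.
rewrite (_ : _ - _ = (`|y - x0| - `|x - x0|) / rho); last by ring.
rewrite normrM normfV (gtr0_norm rho0) ler_pM2r ?invr_gt0//.
apply: le_trans (ler_dist_dist _ _) _.
by rewrite opprB addrA subrK distrC.
Qed.

Let tent_itv x : 0 <= tent x <= 1.
Proof. by rewrite /tent le_max lexx/= ge_max ler01 ge_min lexx orbT. Qed.

Let tent0 x : 2 * rho <= `|x - x0| -> tent x = 0.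
Proof.
move=> h; rewrite /tent max_l// ge_min subr_le0 ler_pdivlMr// h//.
Qed.

Let tent1 x : `|x - x0| <= rho -> tent x = 1.
Proof.
move=> h; have h1 : `|x - x0| / rho <= 1 by rewrite ler_pdivrMr// mul1r.
by rewrite /tent min_r ?max_r//; lra.
Qed.

Let field_lip x y : `|curve_field x - curve_field y| <= Lam * `|x - y|.
Proof.
rewrite /curve_field; set a := g _; set b := g _.
rewrite (_ : _ - _ = (tent x - tent y) *: a + tent y *: (a - b)); last first.
  by rewrite scalerBl scalerBr addrA subrK.
apply: le_trans (ler_normD _ _) _; rewrite !normrZ /Lam mulrDl mul1r; apply: lerD.
  rewrite (_ : B / rho * _ = `|x - y| / rho * B); last by ring.
  by apply: ler_pM => //; exact: gB.
have /andP[t0 t1] := tent_itv y; rewrite (ger0_norm t0).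
apply: (@le_trans _ _ `|a - b|); first by rewrite ler_piMl.
apply: le_trans (lipg _ _) _; rewrite opprB addrA subrK.
by have := coord_le_norm (x - y) ord0; rewrite !mxE.
Qed.

Let field_supp x : 2 * rho <= `|x - x0| -> curve_field x = 0.
Proof. by move=> h; rewrite /curve_field tent0// scale0r. Qed.

Let field_bound x : `|curve_field x| <= B * \1_O x.
Proof.
rewrite indicE; have [_|/negP nx] := boolP (x \in O).
  rewrite mulr1 normrZ; have /andP[t0 t1] := tent_itv x; rewrite (ger0_norm t0).
  by apply: le_trans (gB (x ord0 ord0 - x0 ord0 ord0)); rewrite ler_piMl.
rewrite field_supp ?normr0 ?mulr0//.
have := support_boxP (x0 := x0) (rho := rho) (x := x); rewrite -[~ O x]/(O x -> False) => h.
have : 3 * rho <= `|x - x0| by apply: h => Ox; apply: nx; rewrite inE.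
by have := rho0; lra.
Qed.

Let field_measurable : strongly_measurable mu Omega curve_field.
Proof.
apply: strongly_measurableZ.
  apply: (measurable_strongly_measurable _ mO); apply: measurable_funTS.
  apply: continuous_lebesgue_measurable; apply: (lipschitz_continuous (Lam := rho^-1)).
    by rewrite invr_ge0 ltW.
  by move=> x y; rewrite mulrC; exact: tent_lip.
apply: (@strongly_measurable_comp _ _ _ mu R^o V g Omega (fun x : E => x ord0 ord0 - x0 ord0 ord0 : R^o)).
  move=> t; apply/(@cvgrPdist_lt _ V) => eps eps0.
  have : \forall s \near t, `|t - s| < eps by exact: (@cvgr_dist_lt _ R^o _ _ _ id t cvg_id eps eps0).
  by apply: filterS => s; exact: le_lt_trans (lipg t s).
apply: (measurable_strongly_measurable _ mO); apply: measurable_funTS.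
apply: continuous_lebesgue_measurable; apply: (lipschitz_continuous ler01) => x y.
rewrite mul1r opprB addrA subrK.
by have := coord_le_norm (x - y) ord0; rewrite !mxE.
Qed.

Let XO : bfs_mem X \1_O.
Proof.
apply: bfs_indic; [exact: measurable_obox| |exact: lebesgue_obox_lty].
by apply: subset_trans pO; exact: obox_sub_cbox.
Qed.

Let functional_lip (f : {linear V -> R^o}) x y : (forall v, `|f v| <= `|v|) ->
  `|f (curve_field x) - f (curve_field y)| <= Lam * `|x - y|.
Proof. by move=> f1; rewrite -linearB; apply: le_trans (f1 _) (field_lip x y). Qed.

Let functional_supp (f : {linear V -> R^o}) x : 2 * rho <= `|x - x0| -> f (curve_field x) = 0.
Proof. by move=> /field_supp ->; rewrite linear0. Qed.

Let functional_partial (f : {linear V -> R^o}) j (f1 : forall v, `|f v| <= `|v|) :=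
  lipschitz_weak_partial j oO Lam0 rho0 (fun x y => functional_lip x y f1) (functional_supp f) pO.

(** All functions [f \o curve_field] are Lipschitz with the same constant and the same support, so
    one multiple of the indicator of the box dominates every gradient; the factor n+1 comes from
    bounding the Euclidean norm by a sum. *)
Lemma curve_field_reshetnyak : reshetnyak_sobolev X V curve_field.
Proof.
have sf (f : {linear V -> R^o}) : continuous f -> strongly_measurable mu Omega (f \o curve_field : E -> R^o).
  by move=> cf; exact: (strongly_measurable_comp cf field_measurable).
split.
- apply: (bochner_bfs_le oO field_measurable (bfs_memZ B XO)).
  by apply: aeW => x _; exact: field_bound.
- move=> f cf /dual_norm_le1P f1; split.
    apply: (bochner_bfs_le oO (sf f cf) (bfs_memZ B XO)).
    by apply: aeW => x _; apply: le_trans (f1 _) (field_bound x).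
  move=> j; have [w [mw wL ww _]] := functional_partial j f1; exists w => //.
  apply: (bochner_bfs_le oO _ (bfs_memZ Lam XO)).
    by apply: (measurable_strongly_measurable _ mO); exact: measurable_funTS.
  by apply: aeW => x _; exact: wL.
- exists (fun x => n.+1%:R * (Lam * \1_O x)); split.
  + exact: (bfs_memZ _ (bfs_memZ _ XO)).
  + by apply: aeW => x _; rewrite !mulr_ge0.
  + move=> f cf /dual_norm_le1P f1.
    have [w hw] := choice (fun j => functional_partial j f1).
    exists w; first by move=> j; have [_ _ ? _] := hw j.
    apply: aeW => x _; apply: le_trans (grad_norm_le_sum _ _) _.
    have -> : n.+1%:R * (Lam * \1_O x) = \sum_(j < n.+1) (Lam * \1_O x) :> R.
      by rewrite sumr_const card_ord mulr_natl.
    by apply: ler_sum => j _; have [_ h _ _] := hw j; exact: h.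
Qed.

(** By uniqueness, [f \o w] has the same integrals over slabs as the weak limit of the difference
    quotients; near the slabs these are the quotients of [f \o g] in the first coordinate, evaluated
    by [slab_quotient_cvg]. *)
Lemma curve_field_density (M : R) : 0 <= M -> M <= rho / 2 -> sobolev X V curve_field ->
  exists w : E -> V, bochner_L1 mu (slab x0 rho 0 M : set L) (w : L -> V) /\
    forall (f : {linear V -> R^o}) s t, (forall v, `|f v| <= `|v|) -> 0 <= s -> s <= t -> t <= M ->
      \int[mu]_(x in slab x0 rho s t) f (w x) = rho ^+ n * f (g t - g s).
Proof.
move=> M0 Mrho [_ /(_ ord0)[w uw Xw]]; exists w.
have subO s t : 0 <= s -> t <= M -> slab x0 rho s t `<=` O.
  move=> s0 tM x xs; apply: contrapT => /support_boxP.
  have := slab_norm rho0 (a := s) (b := t) (x := x) _ _ xs.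
  have := rho0; move=> r0 /(_ _ _) h; have : `|x - x0| <= rho / 2 by apply: h; lra.
  lra.
split.
  have [sw lw] := bochner_bfs_L1_loc Xw.
  have sub : slab x0 rho 0 M `<=` cbox (support_box x0 rho).
    by apply: subset_trans (@obox_sub_cbox _ _ _); exact: subO.
  split; first by apply: strongly_measurableS sw; exact: subset_trans sub pO.
  apply: le_lt_trans (lw _ (@compact_cbox _ _ _) pO).
  apply: (ge0_subset_integral mu (measurable_slab _ _ _ _) (measurable_cbox _)) => //.
  apply/measurable_EFinP; apply: (strongly_measurable_norm (@lebesgue_complete R n) (measurable_cbox _)).
  exact: (@strongly_measurableS _ L R mu V _ (Omega : set L) w pO sw).
move=> f s t f1 s0 st tM.
have [d [md dL wd lim]] := functional_partial ord0 f1.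
have wf := functional_weak_partial oO f1 uw.
have mA : measurable (slab x0 rho s t : set L) by exact: measurable_slab.
have := weak_partial_unique_integral oO pO wf wd mA.
rewrite setIidl; last exact: subO.
move=> /= ->.
have -> : \int[mu]_(x in slab x0 rho s t) d x = \int[mu]_x (\1_(slab x0 rho s t) x * d x).
  rewrite Rintegral_mkcond; apply: eq_Rintegral => x _; rewrite patchE indicE.
  by case: ifP => _; rewrite ?mul1r ?mul0r.
apply: (@cvg_unique _ (@norm_hausdorff _ R^o) _ _ _ _ (lim _ mA)).
have lipG a b : `|f (g a) - f (g b)| <= `|a - b|.
  by rewrite -linearB; apply: le_trans (f1 _) (lipg a b).
have GB a : `|f (g a)| <= B by exact: le_trans (f1 _) (gB a).
rewrite linearB.
apply: cvg_trans (slab_quotient_cvg x0 rho0 lipG GB st (step_size_gt0 rho0) (step_size_cvg rho)).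
apply: near_eq_cvg.
(* Points of the slab are within rho/2 of [x0]; once the step is below rho/2 the shifted point stays
   where the tent is 1. *)
have r2 : 0 < rho / 2 by rewrite divr_gt0.
have /cvgrPdist_lt/(_ _ r2) := step_size_cvg rho; apply: filterS => i.
have si := step_size_gt0 rho0 i; rewrite sub0r normrN (gtr0_norm si) => hi.
rewrite Rintegral_mkcond; apply: eq_Rintegral => x _; rewrite patchE indicE.
case: ifPn => [/set_mem xs|_]; last by rewrite !mul0r.
rewrite indicE mem_set; last exact: (subO s t).
rewrite !mul1r /diff_quot.
have xr : `|x - x0| <= rho / 2.
  by apply: (slab_norm rho0 (a := s) (b := t)) => //; have := rho0; lra.
have xr' : `|x + step_size rho i *: delta_mx ord0 ord0 - x0| <= rho.
  rewrite addrAC; apply: le_trans (ler_normD _ _) _.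
  have := norm_line_le (n := n) (step_size rho i) ord0; rewrite (gtr0_norm si); lra.
have xr1 : `|x - x0| <= rho by lra.
by rewrite /curve_field !tent1// !scale1r.
Qed.

End curve_fields.

(** * The equivalence *)

Lemma radon_nikodym_of_sobolev {R : realType} {n : nat} {Omega : set 'rV[R]_n.+1}
    (X : banach_function_space Omega) (V : completeNormedModType R) :
  open Omega -> Omega !=set0 -> reshetnyak_sobolev X V `<=` sobolev X V ->
  radon_nikodym_property V.
Proof.
move=> oO [x0 Ox0] RW d S m nu sf cm vm var ac.
have [r /= r0 rO] : exists2 r : R, 0 < r & ball x0 r `<=` Omega.
  by have /nbhs_ballP := open_nbhs_nbhs (conj oO Ox0).
(* The closed support box has half-side 3 rho, which is less than [r]. *)
pose rho := r / 4; have rho0 : 0 < rho by rewrite divr_gt0.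
have pO : cbox (support_box x0 rho) `<=` Omega.
  move=> x cx; apply: rO; rewrite -ball_normE/=; apply: (@le_lt_trans _ _ (3 * rho)); last by rewrite /rho; lra.
  apply: norm_le_coord => [|i]; first by lra.
  by have := cx i; rewrite !mxE ler_norml => /andP[h1 h2]; apply/andP; split; lra.
have [h [h0 ih nuh]] := variation_density vm var ac sf.
pose mass A := \int[m]_(x in A) h x.
have nuD := vector_measureU vm ac.
have massD A B : measurable A -> measurable B -> A `&` B = set0 -> mass (A `|` B) = mass A + mass B.
  move=> mA mB AB; apply: Rintegral_setU => //; last by apply/disj_setPS; rewrite AB.
  by apply: (integrableS measurableT) => //; exact: measurableU.
apply: (step_density h0 ih cm) => e e0; apply: contrapT => nstep.
have bad C (v : nat -> V) (T : nat -> set S) : (forall i, measurable (T i)) ->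
    exists N t, finite_partition N t /\
      e < \sum_(r < N) `|nu (t @^-1` [set val r]) - \sum_(i < C) mass (t @^-1` [set val r] `&` T i) *: v i|.
  move=> mT; apply: contrapT => nbad; apply: nstep; exists C, v, T; split=> // N t pt.
  by rewrite leNgt; apply/negP => lt; apply: nbad; exists N, t.
have massT : 0 <= mass setT by apply: Rintegral_ge0.
(* This scale makes the parameter length [M] at most rho/2, so that the slabs stay in the region
   where the tent is 1; adding 1 covers total mass 0. *)
pose c := rho / (2 * (mass setT + 1)).
have c0 : 0 < c by rewrite divr_gt0// mulr_gt0//; lra.
pose M := c * mass setT.
have M0 : 0 <= M by rewrite mulr_ge0// ltW.
have Mrho : M <= rho / 2.
  rewrite /M /c mulrAC ler_pdivrMr; last by rewrite mulr_gt0//; lra.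
  have -> : rho / 2 * (2 * (mass setT + 1)) = rho * (mass setT + 1) by field.
  by rewrite ler_pM2l//; lra.
have [C [B [L [G [CS cons lip ends osc]]]]] := martingale_tree nuD massD nuh c0 bad.
have [g [lipg gE]] := tree_curve CS cons lip ends M0.
(* Stopping the parameter at -M and M makes the curve bounded, as [curve_field] requires, and leaves
   the values at the nodes, which lie in [0, M], unchanged. *)
pose cl t := Num.max (- M) (Num.min t M).
have clE t : 0 <= t <= M -> cl t = t by move=> /andP[t0 tM]; rewrite /cl min_l// max_r//; lra.
pose g' t := g (cl t).
have lipg' s t : `|g' s - g' t| <= `|s - t| by apply: le_trans (lipg _ _) (clamp_lipschitz _ _ _ _).
have g'B t : `|g' t| <= `|g 0| + M.
  have := lipg (cl t) 0; rewrite subr0 => h1; have h2 := norm_clip_le t M0.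
  have := ler_normD (g' t - g 0) (g 0); rewrite subrK; rewrite /g' in h1 *; rewrite -/(cl t) in h2; lra.
have Lmono k i j : (i <= j)%N -> L k i <= L k j by exact: tree_nondecreasing lip k i j.
have g'E k i : (i <= C k)%N -> g' (L k i) = G k i.
  move=> iC; rewrite /g' clE ?gE//; have [h1 h2] := ends k; apply/andP; split.
    by rewrite -h1 Lmono.
  by rewrite /M -h2 Lmono.
have [w [L1w wE]] := curve_field_density oO rho0 pO lipg' g'B M0 Mrho
  (RW _ (curve_field_reshetnyak X oO rho0 pO lipg' g'B)).
have oscg := tree_density_oscillation (@lebesgue_complete R n) CS (fun k i => (cons k i).1)
  (fun k i => Lmono k i i.+1 (leqnSn i)) ends (exprn_gt0 n rho0) (measurable_slab x0 rho)
  (slabU x0 rho) (slab_measure x0 rho0) M0 L1w wE.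
have ce0 : 0 < c * e by rewrite mulr_gt0.
have /cvgrPdist_lt/(_ _ ce0) [k _ /(_ k (leqnn k))] := oscg.
rewrite /= sub0r normrN => /(le_lt_trans (ler_norm _)).
apply/negP; rewrite -leNgt; apply: le_trans (osc k) _.
rewrite le_eqVlt; apply/orP; left; apply/eqP.
apply: eq_bigr => i _; apply: eq_bigr => j _.
have jC : (i * B k + j < C k.+1)%N.
  rewrite CS; apply: (@leq_trans (i.+1 * B k)); last by rewrite leq_mul2r ltn_ord orbT.
  by rewrite mulSnr ltn_add2l.
by rewrite !g'E// ltnW.
Qed.

Theorem theorem3p6 (R : realType) (n : nat) (Omega : set 'rV[R]_n.+1)
    (X : banach_function_space Omega) (V : completeNormedModType R) :
  open Omega -> Omega !=set0 ->
  (radon_nikodym_property V <-> reshetnyak_sobolev X V = sobolev X V).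
Proof.
move=> oO O0; split=> [rnp|eqRW]; last first.
  by apply: (radon_nikodym_of_sobolev (X := X) oO O0); rewrite eqRW.
apply/seteqP; split; first exact: reshetnyak_sub_sobolev.
exact: sobolev_sub_reshetnyak.
Qed.
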